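(* Consider the controlled-predictor MDP and the quantized Q-learning iteration $\mathbf{Q}_t$ described in the context, run from any initial $\pi_0$ under the uniform exploration policy, with the irreducibility/aperiodicity assumption stated in the context. For each $(\hat\pi,Q,\eta)\in\mathcal{P}_n^\lambda(\mathbb{X})\times\mathcal{Q}\times\mathcal{H}$, $\mathbf{Q}_t(\hat\pi,Q,\eta)$ converges almost surely to a limit $\mathbf{Q}^*(\hat\pi,Q,\eta)$, and the limit satisfies $$\mathbf{Q}^*(\hat\pi,Q,\eta)=c_n(\hat\pi,Q,\eta)+\beta\sum_{\hat\pi'\in\mathcal{P}_n^\lambda(\mathbb{X})}P_n(\hat\pi'\mid\hat\pi,Q,\eta)\min_{(Q',\eta')\in\mathcal{Q}\times\mathcal{H}}\mathbf{Q}^*(\hat\pi',Q',\eta').$$ This coincides with the discounted cost optimality equation for $\mathrm{MDP}_n=(\mathcal{P}_n^\lambda(\mathbb{X}),\mathcal{Q}\times\mathcal{H},P_n,c_n)$, and therefore the policy $\hat\gamma_n^*(\hat\pi)=\arg\min_{(Q,\eta)}\mathbf{Q}^*(\hat\pi,Q,\eta)$ is optimal for $\mathrm{MDP}_n$. Moreover, defining $\tilde\gamma_n^*(\pi)=\hat\gamma_n^*(\rho(\pi))$, one has $$\lim_{n\to\infty}|J_\beta(\pi_0,\tilde\gamma_n^* )-J_\beta(\pi_0)|=0$$ for any $\pi_0\in\mathcal{P}(\mathbb{X})$ such that $\lambda(\{\pi_0\})>0$.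
   Context: $\mathbb{X}$ (states), $\mathbb{U}$ (actions), $\mathbb{M}$ (channel symbols) are finite nonempty sets, $P(x'\mid x,u)$ is the transition kernel of the controlled source $x_{t+1}=f(x_t,u_t,w_t)$ ($w_t$ i.i.d.), $c:\mathbb{X}\times\mathbb{U}\to\mathbb{R}$ is a cost, $\beta\in(0,1)$. $\mathcal{Q}=\{Q:\mathbb{X}\to\mathbb{M}\}$, $\mathcal{H}=\{\eta:\mathcal{Q}\times\mathbb{M}\to\mathbb{U}\}$; $\mathcal{P}(\mathbb{X})$ is the set of probability measures on $\mathbb{X}$ with the weak topology. It is assumed that $\mathcal{Q}$ contains some $Q$ with $Q^{-1}(q)=\{x\}$ for some $x\in\mathbb{X}$, $q\in\mathbb{M}$. Controlled-predictor MDP: $x_0\sim\pi_0$, $q_t=Q_t(x_t)$, $u_t=\eta_t(Q_t,q_t)$, $\pi_{t+1}=F(\pi_t,Q_t,\eta_t,q_t)$ with $$F(\pi,Q,\eta,q)(x')=\frac{1}{\pi(Q^{-1}(q))}\sum_{x\in Q^{-1}(q)}P(x'\mid x,\eta(Q,q))\pi(x);$$ the transition kernel is $P(D\mid\pi,Q,\eta)=\sum_{q}\pi(Q^{-1}(q))\mathbf{1}\{F(\pi,Q,\eta,q)\in D\}$ and the cost is $\tilde c(\pi,Q,\eta)=\sum_x\pi(x)c(x,\eta(Q,Q(x)))$. $J_\beta(\pi_0,\gamma)=E^\gamma_{\pi_0}[\sum_{k\ge0}\beta^k\tilde c(\pi_k,Q_k,\eta_k)]$, $J_\beta(\pi_0)=\inf_\gamma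 J_\beta(\pi_0,\gamma)$. Assumption: under any stationary policy (choosing $u_t$ from $x_t$) of the fully observed MDP with kernel $P(x'\mid x,u)$, the induced Markov chain on $\mathbb{X}$ is irreducible and aperiodic. Exploration: $(Q_t,\eta_t)$ is chosen independently and uniformly from $\mathcal{Q}\times\mathcal{H}$ at each $t\ge0$. Under it and the Assumption, $\{\pi_t\}$ is a Markov process with a unique invariant probability measure, denoted $\lambda$. Quantization: $\mathcal{P}_n(\mathbb{X})=\{\hat\pi\in\mathcal{P}(\mathbb{X}):\hat\pi=[k_1/n,\dots,k_{|\mathbb{X}|}/n],\ k_i\in\{0,\dots,n\}\}$; $\rho=\rho_n$ is the nearest-neighbour map $\mathcal{P}(\mathbb{X})\to\mathcal{P}_n(\mathbb{X})$ for a metric on $\mathcal{P}(\mathbb{X})$ inducing its topology (say $L^1$; ties broken measurably); $\mathcal{P}_n^\lambda(\mathbb{X})=\{\hat\pi\in\mathcal{P}_n(\mathbb{X}):\lambda(\rho^{-1}(\hat\pi))>0\}$; $\hat\pi_t=\rho(\pi_t)$. For $\hat\pi\in\mathcal{P}_n^\lambda(\mathbb{X})$ with bin $B=\rho^{-1}(\hat\pi)$, $$c_n(\hat\pi,Q,\eta)=\int_B\tilde c(\pi,Q,\eta)\frac{\lambda(d\pi)}{\lambda(B)},\qquad P_n(\hat\pi'\mid\hat\pi,Q,\eta)=\int_B P(\rho^{-1}(\hat\pi')\mid\pi,Q,\eta)\frac{\lambda(d\pi)}{\lambda(B)}.$$ Q-learning: $\mathbf{Q}_0\equiv0$ on $\mathcal{P}_n(\mathbb{X})\times\mathcal{Q}\times\mathcal{H}$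 and $$\mathbf{Q}_{t+1}(\hat\pi,Q,\eta)=(1-\alpha_t(\hat\pi,Q,\eta))\mathbf{Q}_t(\hat\pi,Q,\eta)+\alpha_t(\hat\pi,Q,\eta)\Big(\tilde c(\pi_t,Q_t,\eta_t)+\beta\min_{(Q',\eta')}\mathbf{Q}_t(\hat\pi_{t+1},Q',\eta')\Big),$$ where $\alpha_t(\hat\pi,Q,\eta)=\big(1+\sum_{k=0}^t\mathbf{1}\{(\hat\pi_k,Q_k,\eta_k)=(\hat\pi,Q,\eta)\}\big)^{-1}$ if $(\hat\pi_t,Q_t,\eta_t)=(\hat\pi,Q,\eta)$ and $0$ otherwise. Values of $\tilde\gamma_n^*(\pi)$ for $\rho(\pi)\notin\mathcal{P}_n^\lambda(\mathbb{X})$ are arbitrary. *)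

(* Defs.v *)
From HB Require Import structures.
From mathcomp Require Import all_boot all_order all_algebra.
From mathcomp Require Import all_classical all_reals all_analysis.

Set Implicit Arguments.
Unset Strict Implicit.
Unset Printing Implicit Defensive.
Import Order.TTheory GRing.Theory Num.Theory.
Import numFieldNormedType.Exports.
Local Open Scope classical_set_scope.
Local Open Scope ring_scope.

(* Nonempty finite sets. The distinguished element only witnesses
   nonemptiness; no definition below depends on which element it is. *)
#[short(type="finPointedType")]
HB.structure Definition FinPointed := {T of Finite T & Pointed T}.

Section Distributions.
Variables (R : realType) (X : finPointedType).

Record pdist := Pdist {
  pmf :> {ffun X -> R};
  _ : [forall x, 0 <= pmf x] && (\sum_x pmf x == 1) }.

HB.instance Definition _ := [isSub for pmf].
HB.instance Definition _ := [Choice of pdist by <:].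

Fact dirac_pdist_subproof (x0 : X) :
  let f := [ffun x => (x == x0)%:R : R] in
  [forall x, 0 <= f x] && (\sum_x f x == 1).
Proof.
rewrite /=; apply/andP; split.
  by apply/forallP => x; rewrite ffunE ler0n.
rewrite (bigD1 x0)//= ffunE eqxx big1 ?addr0// => x xx0.
by rewrite ffunE (negbTE xx0).
Qed.

Definition dirac_pdist (x0 : X) : pdist := Pdist (dirac_pdist_subproof x0).

HB.instance Definition _ := isPointed.Build pdist (dirac_pdist point).

(* The sigma-algebra generated by the evaluations p |-> p x. As X is finite,
   the weak topology on pdist is that of pointwise convergence, which is second
   countable, so this is its Borel sigma-algebra. *)
Definition pdist_cylinder : set (set pdist) :=
  [set D | exists (x : X) (A : set R),
     measurable A /\ D = [set p : pdist | A (p x)]].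

HB.instance Definition _ := @isMeasurable.Build
  (sigma_display pdist_cylinder) pdist <<s pdist_cylinder >>
  (@sigma_algebra0 _ setT pdist_cylinder) (@sigma_algebraC _ pdist_cylinder)
  (@sigma_algebra_bigcup _ setT pdist_cylinder).

Definition weak_cvg (u : nat -> pdist) (p : pdist) : Prop :=
  forall f : X -> R,
    (fun k => \sum_x f x * u k x) @ \oo --> \sum_x f x * p x.

(* d is a metric on pdist that induces the weak topology; the latter is
   metrizable, hence determined by its convergent sequences. *)
Definition weak_metric (d : pdist -> pdist -> R) : Prop :=
  [/\ forall p p', 0 <= d p p',
      forall p p', d p p' = 0 <-> p = p',
      forall p p', d p p' = d p' p,
      forall p1 p2 p3, d p1 p3 <= d p1 p2 + d p2 p3 &
      forall (u : nat -> pdist) (p : pdist),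
        weak_cvg u p <-> (fun k => d (u k) p) @ \oo --> (0 : R)].

End Distributions.

Section Chains.
Variables (R : realType) (X : finType).

Fixpoint nstep (T : X -> X -> R) (n : nat) (x y : X) : R :=
  if n is m.+1 then \sum_z T x z * nstep T m z y else (x == y)%:R.

Definition irreducible_chain (T : X -> X -> R) : Prop :=
  forall x y, exists n, 0 < nstep T n x y.

Definition aperiodic_chain (T : X -> X -> R) : Prop :=
  forall x (g : nat),
    (forall n, (0 < n)%N -> 0 < nstep T n x x -> (g %| n)%N) -> g = 1%N.

End Chains.

(* The transition kernel is given in the form
   P(D | s, a) = \sum_z weight s a z * 1{next s a z \in D}. *)
Record mdp (R : realType) := MDP {
  state : Type;
  action : finType;
  noise : finType;
  weight : state -> action -> noise -> R;
  next : state -> action -> noise -> state;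
  stage_cost : state -> action -> R }.

(* A finite set: this is the minimum of f when A is nonempty. *)
Definition min_over (R : realType) (A : finType) (f : A -> R) : R := inf (range f).

Section MDPTheory.
Variables (R : realType) (m : mdp R).
Local Notation S := (state m).
Local Notation A := (action m).
Local Notation Z := (noise m).

Definition kernel (s : S) (a : A) (D : set S) : R :=
  \sum_z weight s a z * \1_D (next s a z).

(* A randomized history-dependent policy: [g h s a] is the probability of
   choosing a in state s, when h lists the earlier state-action pairs, oldest
   first. *)
Definition policy := seq (S * A) -> S -> A -> R.

Definition admissible (g : policy) : Prop :=
  forall h s, (forall a, 0 <= g h s a) /\ \sum_a g h s a = 1.

Definition stationary (f : S -> A) : policy := fun _ s a => (f s == a)%:R.

Fixpoint state_at (s0 : S) (w : nat -> A * Z) (t : nat) : S :=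
  if t is k.+1 then next (state_at s0 w k) (w k).1 (w k).2 else s0.

Definition history (s0 : S) (w : nat -> A * Z) (t : nat) : seq (S * A) :=
  [seq (state_at s0 w k, (w k).1) | k <- iota 0 t].

(* W is the sequence of actions and transition noises of the process started
   at s0 and controlled by g; the finite-dimensional laws below determine the
   law of W. *)
Definition controlled_process (g : policy) (s0 : S)
    (d : measure_display) (Omega : measurableType d) (P : probability Omega R)
    (W : nat -> Omega -> A * Z) : Prop :=
  forall (t : nat) (w : nat -> A * Z),
    let E := [set om | forall k, (k < t)%N -> W k om = w k] in
    measurable E /\
    P E = (\prod_(k < t)
             (g (history s0 w k) (state_at s0 w k) (w k).1 *
              weight (state_at s0 w k) (w k).1 (w k).2))%:E.

Definition expected_cost (beta : R) (s0 : S)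
    (d : measure_display) (Omega : measurableType d) (P : probability Omega R)
    (W : nat -> Omega -> A * Z) : R :=
  \int[P]_om limn (series (fun k : nat =>
    beta ^+ k * stage_cost (state_at s0 (W ^~ om) k) (W k om).1)).

(* The expectation under g from s0. The set has exactly one element when g is
   admissible and the weights of each transition form a probability vector: the
   process exists, and its law does not depend on the probability space. *)
Definition discounted_cost (beta : R) (s0 : S) (g : policy) : R :=
  xget 0 [set v | exists (d : measure_display) (Omega : measurableType d)
    (P : probability Omega R) (W : nat -> Omega -> A * Z),
    controlled_process g s0 P W /\ v = expected_cost beta s0 P W].

Definition optimal_cost (beta : R) (s0 : S) : R :=
  inf [set discounted_cost beta s0 g | g in admissible].

Definition optimal_policy (beta : R) (g : policy) : Prop :=
  admissible g /\
  forall s0, discounted_cost beta s0 g = optimal_cost beta s0.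

Definition dcoe (beta : R) (V : S -> R) : Prop :=
  forall s, V s = min_over (fun a : A =>
    stage_cost s a + beta * \sum_z weight s a z * V (next s a z)).

End MDPTheory.

Section Predictor.
Variables (R : realType) (X U M : finPointedType).
Variables (K : X -> U -> pdist R X) (c : X -> U -> R).

Definition quantizer := {ffun X -> M}.
Definition controller := {ffun {ffun X -> M} * M -> U}.
Definition act : finType := (quantizer * controller)%type.

Definition cell_mass (p : pdist R X) (Q : quantizer) (q : M) : R :=
  \sum_(x | Q x == q) p x.

(* When the cell has mass 0, in which case the formula is meaningless and the
   transition has weight 0, the value is p. *)
Definition predF (p : pdist R X) (Q : quantizer) (eta : controller) (q : M) :
    pdist R X :=
  insubd p [ffun x' : X => (cell_mass p Q q)^-1 *
                           \sum_(x | Q x == q) K x (eta (Q, q)) x' * p x].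

Lemma predFE p Q eta q x' : cell_mass p Q q != 0 ->
  predF p Q eta q x' =
  (cell_mass p Q q)^-1 * \sum_(x | Q x == q) K x (eta (Q, q)) x' * p x.
Proof.
have pge0 (r : pdist R X) x : 0 <= r x by case: r => f /= /andP[/forallP].
have psum (r : pdist R X) : \sum_x r x = 1 by case: r => f /= /andP[_ /eqP].
move=> m0; rewrite /predF; set f := [ffun _ => _].
have -> : pmf (insubd p f) = val (insubd p f) by [].
rewrite val_insubd; case: ifPn => [_|/negP[]]; first by rewrite ffunE.
apply/andP; split.
  apply/forallP => y; rewrite ffunE mulr_ge0 ?invr_ge0 ?sumr_ge0// => x _.
  by rewrite mulr_ge0.
under eq_bigr do rewrite ffunE.
rewrite -mulr_sumr exchange_big/=.
under eq_bigr do rewrite -mulr_suml psum mul1r.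
by rewrite mulVf.
Qed.

Definition pred_cost (p : pdist R X) (a : act) : R :=
  \sum_x p x * c x (a.2 (a.1, a.1 x)).

Definition predictor_mdp : mdp R :=
  @MDP R (pdist R X) act M
    (fun p a q => cell_mass p a.1 q) (fun p a q => predF p a.1 a.2 q)
    pred_cost.

(* lam is invariant for the belief process when the action is uniform. *)
Definition exploration_invariant (lam : probability (pdist R X) R) : Prop :=
  forall D : set (pdist R X), measurable D ->
    lam D = (\int[lam]_p
      ((#|act|%:R)^-1 * \sum_a kernel (m := predictor_mdp) p a D)%:E)%E.

Fixpoint belief (pi0 : pdist R X) (x : nat -> X) (a : nat -> act) (t : nat) :
    pdist R X :=
  if t is k.+1 then predF (belief pi0 x a k) (a k).1 (a k).2 ((a k).1 (x k))
  else pi0.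

(* x is the source, started from the law pi0, and a the sequence of actions,
   which at each time is uniform and independent of the past. *)
Definition exploration_run (pi0 : pdist R X)
    (d : measure_display) (Omega : measurableType d) (P : probability Omega R)
    (x : nat -> Omega -> X) (a : nat -> Omega -> act) : Prop :=
  forall (t : nat) (y : nat -> X) (b : nat -> act),
    let E := [set om | forall k, (k <= t)%N -> x k om = y k /\ a k om = b k] in
    measurable E /\
    P E = (pi0 (y 0%N) *
           (\prod_(k < t) K (y k) ((b k).2 ((b k).1, (b k).1 (y k))) (y k.+1)) *
           (#|act|%:R)^-1 ^+ t.+1)%:E.

End Predictor.

(* k stands for the distribution k / n.+1: index n is resolution n.+1, so that
   the resolution is positive. *)
Definition grid (X : finPointedType) (n : nat) : finType :=
  {k : {ffun X -> 'I_n.+2} | (\sum_x k x == n.+1)%N}.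

Fact grid_point_subproof (R : realType) (X : finPointedType) (n : nat)
    (k : grid X n) :
  let f := [ffun x => (val k x)%:R / n.+1%:R : R] in
  [forall x, 0 <= f x] && (\sum_x f x == 1).
Proof.
rewrite /=; apply/andP; split.
  by apply/forallP => x; rewrite ffunE divr_ge0 ?ler0n.
under eq_bigr do rewrite ffunE.
by rewrite -mulr_suml -natr_sum (eqP (valP k)) divff// pnatr_eq0.
Qed.

Definition grid_point (R : realType) (X : finPointedType) (n : nat)
  (k : grid X n) : pdist R X := Pdist (grid_point_subproof R k).

Section Quantized.
Variables (R : realType) (X U M : finPointedType).
Variables (K : X -> U -> pdist R X) (c : X -> U -> R) (beta : R).
Variables (lam : probability (pdist R X) R) (n : nat).
Variable rho : pdist R X -> grid X n.
Local Notation act := (act X U M).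

Definition nearest_neighbour (d : pdist R X -> pdist R X -> R) : Prop :=
  (forall p (k : grid X n), d p (grid_point R (rho p)) <= d p (grid_point R k)) /\
  (forall k, measurable (rho @^-1` [set k])).

Definition bin (k : grid X n) : set (pdist R X) := rho @^-1` [set k].

Definition charged_grid : finType := {k : grid X n | (0 < lam (bin k))%E}.

Definition bin_cost (k : charged_grid) (a : act) : R :=
  (\int[lam]_(p in bin (val k)) pred_cost c p a) / fine (lam (bin (val k))).

Definition bin_kernel (k : charged_grid) (a : act) (k' : charged_grid) : R :=
  (\int[lam]_(p in bin (val k))
     kernel (m := predictor_mdp M K c) p a (bin (val k'))) /
  fine (lam (bin (val k))).

Definition quantized_mdp : mdp R :=
  @MDP R charged_grid act charged_grid bin_kernel (fun _ _ k' => k') bin_cost.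

Definition learning_rate (p : nat -> pdist R X) (a : nat -> act) (t : nat)
    (k : grid X n) (b : act) : R :=
  if (rho (p t), a t) == (k, b)
  then (1 + \sum_(j < t.+1) ((rho (p j), a j) == (k, b))%:R)^-1 else 0.

Fixpoint Qlearn (p : nat -> pdist R X) (a : nat -> act) (t : nat)
    (k : grid X n) (b : act) : R :=
  if t is s.+1 then
    (1 - learning_rate p a s k b) * Qlearn p a s k b +
    learning_rate p a s k b *
      (pred_cost c (p s) (a s) + beta * min_over (Qlearn p a s (rho (p s.+1))))
  else 0.

End Quantized.

(* Main.v *)
Require Import Defs.
From HB Require Import structures.
From mathcomp Require Import all_boot all_order all_algebra.
From mathcomp Require Import all_classical all_reals all_analysis.
From mathcomp Require Import measurable_realfun.
From mathcomp Require Import ring lra zify.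

Set Implicit Arguments.
Unset Strict Implicit.
Unset Printing Implicit Defensive.
Import Order.TTheory GRing.Theory Num.Theory.
Import numFieldNormedType.Exports.
Local Open Scope classical_set_scope.
Local Open Scope ring_scope.

(** Under uniform exploration the predictor process regenerates. Some quantizer
    isolates a source state, and when its symbol is received the next predictor
    does not depend on the past; irreducibility of the source makes this happen
    within a bounded time with probability bounded below [minorization]. A
    Doeblin contraction then solves the Poisson equation up to any given error
    [approximate_poisson]. Combined with a strong law for bounded martingale
    differences [martingale_lln], proved from second moments along the squares,
    this yields the ergodic theorem from every initial predictor
    [ergodic_theorem]. The source itself enters only through the filtering
    identity, by which the observed actions and symbols are a trajectory of the
    predictor MDP under the uniform policy [exploration_law].

    With the learning rates at hand a Q-iterate is the plain average of the
    targets met at the visits [Qlearn_average]. The ergodic theorem gives the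
    limits of the frequencies, of the averaged Bellman errors of the solution of
    the quantized optimality equation, and of the visits to bins that lam does
    not charge. A deterministic argument on each path then shows that an
    eventual error bound E can be improved to beta * E + eta, so that the
    iterates converge to that solution [Qlearn_cvg, Qlearn_almost_sure].

    A bounded solution of an optimality equation is the optimal cost
    [optimal_cost_eq]. This rests on the fact that finite-dimensional laws
    determine expected costs up to geometric tails, and on the existence of a
    process with given conditional laws, sampled from a uniform variable
    [sample_law].

    For near optimality, the value of the predictor MDP is Lipschitz in L1, since
    its homogeneous extension to the cone of finite measures is so along value
    iteration [optimal_value_lipschitz]. The bins have small diameter by
    compactness [bin_diameter_cvg0], hence the quantized values and action values
    are close to the exact ones [quantized_value_close]. The greedy policy of the
    quantized model is therefore nearly greedy at all predictors in charged bins.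
    From an atom of lam the process visits only atoms of lam, by invariance
    [atom_closed], and these lie in charged bins; this is why the initial
    predictor is taken to be an atom. *)

(** * Expectations of bounded measurable functions *)

Section BoundedMeasurable.
Context {R : realType} {d : measure_display} {T : measurableType d}.
Implicit Types f g : T -> R.

Definition bounded_measurable f :=
  measurable_fun setT f /\ exists B : R, forall x, `|f x| <= B.

Lemma bmf_ext f g : f =1 g -> bounded_measurable f -> bounded_measurable g.
Proof. by move=> /funext ->. Qed.

Lemma bmf_cst r : bounded_measurable (fun _ => r).
Proof. by split; [exact: measurable_cst | exists `|r|]. Qed.

Lemma bmfD f g : bounded_measurable f -> bounded_measurable g ->
  bounded_measurable (fun x => f x + g x).
Proof.
move=> [mf [B fB]] [mg [C gC]]; split; first exact: measurable_funD.
by exists (B + C) => x; rewrite (le_trans (ler_normD _ _)) ?lerD.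
Qed.

Lemma bmfM f g : bounded_measurable f -> bounded_measurable g ->
  bounded_measurable (fun x => f x * g x).
Proof.
move=> [mf [B fB]] [mg [C gC]]; split; first exact: measurable_funM.
by exists (B * C) => x; rewrite normrM ler_pM.
Qed.

Lemma bmfZ r f : bounded_measurable f -> bounded_measurable (fun x => r * f x).
Proof. by move=> bf; apply: bmfM => //; exact: bmf_cst. Qed.

Lemma bmfN f : bounded_measurable f -> bounded_measurable (fun x => - f x).
Proof.
move=> bf; apply: (bmf_ext (f := fun x => -1 * f x)); last exact: bmfZ.
by move=> x; rewrite mulN1r.
Qed.

Lemma bmfB f g : bounded_measurable f -> bounded_measurable g ->
  bounded_measurable (fun x => f x - g x).
Proof. by move=> bf bg; apply: bmfD => //; exact: bmfN. Qed.

Lemma bmf_sum (I : Type) (s : seq I) (F : I -> T -> R) :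
  (forall i, bounded_measurable (F i)) ->
  bounded_measurable (fun x => \sum_(i <- s) F i x).
Proof.
move=> bF; elim: s => [|i s IH].
  by apply: (bmf_ext (f := fun=> 0)); [move=> x; rewrite big_nil|exact: bmf_cst].
apply: (bmf_ext (f := fun x => F i x + \sum_(j <- s) F j x)).
  by move=> x; rewrite big_cons.
exact: bmfD.
Qed.

Lemma bmf_indic (A : set T) : measurable A -> bounded_measurable (\1_A : T -> R).
Proof.
move=> mA; split; first exact: measurable_indic.
exists 1 => x; rewrite indicE; case: (x \in A) => /=; by rewrite ?normr1 ?normr0.
Qed.

Variable P : probability T R.

Lemma bmf_integrable f : bounded_measurable f -> P.-integrable setT (EFin \o f).
Proof.
move=> [mf [B fB]]; apply: measurable_bounded_integrable => //.
  by apply: (le_lt_trans (probability_le1 P measurableT)); rewrite ltry.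
exists B; split; first exact: num_real.
by move=> M BM x _ /=; rewrite (le_trans (fB x))// ltW.
Qed.

Lemma expect_cst r : \int[P]_x r = r.
Proof. by rewrite Rintegral_cst// /= (probability_setT P) mulr1. Qed.

Lemma expectD f g : bounded_measurable f -> bounded_measurable g ->
  \int[P]_x (f x + g x) = \int[P]_x f x + \int[P]_x g x.
Proof. by move=> bf bg; rewrite RintegralD//; exact: bmf_integrable. Qed.

Lemma expectB f g : bounded_measurable f -> bounded_measurable g ->
  \int[P]_x (f x - g x) = \int[P]_x f x - \int[P]_x g x.
Proof. by move=> bf bg; rewrite RintegralB//; exact: bmf_integrable. Qed.

Lemma expectZ r f : bounded_measurable f ->
  \int[P]_x (r * f x) = r * \int[P]_x f x.
Proof. by move=> bf; rewrite RintegralZl//; exact: bmf_integrable. Qed.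

Lemma le_expect f g : bounded_measurable f -> bounded_measurable g ->
  (forall x, f x <= g x) -> \int[P]_x f x <= \int[P]_x g x.
Proof. by move=> bf bg fg; apply: le_Rintegral => //; exact: bmf_integrable. Qed.

Lemma expect_sum (I : Type) (s : seq I) (F : I -> T -> R) :
  (forall i, bounded_measurable (F i)) ->
  \int[P]_x (\sum_(i <- s) F i x) = \sum_(i <- s) \int[P]_x F i x.
Proof.
move=> bF; elim: s => [|i s IH].
  under eq_Rintegral do rewrite big_nil.
  by rewrite expect_cst big_nil.
under eq_Rintegral do rewrite big_cons.
by rewrite expectD ?IH ?big_cons//; exact: bmf_sum.
Qed.

Lemma expect_indic (A : set T) : measurable A ->
  \int[P]_x (\1_A x : R) = fine (P A).
Proof. by move=> mA; rewrite /Rintegral integral_indic ?setIT. Qed.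

Lemma expect_norm_le f B : bounded_measurable f -> (forall x, `|f x| <= B) ->
  `|\int[P]_x f x| <= B.
Proof.
move=> bf fB; rewrite ler_norml; apply/andP; split.
  rewrite -(expect_cst (- B)); apply: le_expect => //; first exact: bmf_cst.
  by move=> x; have := fB x; rewrite ler_norml => /andP[].
rewrite -[leRHS](expect_cst B); apply: le_expect => //; first exact: bmf_cst.
by move=> x; have := fB x; rewrite ler_norml => /andP[].
Qed.

End BoundedMeasurable.

(** * Finite-dimensional laws *)

Section Words.
Context {T : Type}.

Definition upd (w : nat -> T) (t : nat) (z : T) : nat -> T :=
  fun k => if k == t then z else w k.

Definition agree (t : nat) (w w' : nat -> T) :=
  forall k, (k < t)%N -> w k = w' k.

(** Words are total functions, of which an adapted function reads only the
    first t letters; this avoids words indexed by their length. *)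
Definition adapted {V : Type} (t : nat) (F : (nat -> T) -> V) :=
  forall w w', agree t w w' -> F w = F w'.

Lemma agree_upd t s (w : nat -> T) z : (t <= s)%N -> agree t (upd w s z) w.
Proof. by move=> ts k kt; rewrite /upd ltn_eqF// (leq_trans kt). Qed.

Lemma agreeS t (w w' : nat -> T) : agree t w w' -> w t = w' t -> agree t.+1 w w'.
Proof. by move=> h e k; rewrite ltnS leq_eqVlt => /orP[/eqP->|/h]. Qed.

Lemma adaptedW {V : Type} s t (F : (nat -> T) -> V) :
  (s <= t)%N -> adapted s F -> adapted t F.
Proof. by move=> st aF w w' h; apply: aF => k ks; apply: h; exact: leq_trans st. Qed.

End Words.

Section FiniteLaws.
Context {R : realType} {T : finType}.
Variables (z0 : T) (p : (nat -> T) -> nat -> T -> R).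

(** The positions from t on carry the letter z0, which no adapted function
    sees. *)
Fixpoint wsum (t : nat) (F : (nat -> T) -> R) : R :=
  if t is s.+1 then wsum s (fun w => \sum_z F (upd w s z)) else F (fun=> z0).

(** Expectation of F when letter s is drawn from p w s, given the earlier
    letters of w. The recursion conditions on the last letter, since this is how
    martingale differences and dynamic programming use it. *)
Fixpoint wE (t : nat) (F : (nat -> T) -> R) : R :=
  if t is s.+1 then wE s (fun w => \sum_z p w s z * F (upd w s z))
  else F (fun=> z0).

Definition word_prob (t : nat) (w : nat -> T) : R := \prod_(k < t) p w k (w k).

Hypothesis p_adapted : forall t, adapted t (fun w => p w t).

Lemma adapted_word_prob t : adapted t (word_prob t).
Proof.
move=> w w' h; apply: eq_bigr => -[k kt] _ /=.
by rewrite (h k kt) (p_adapted (w' := w'))// => j jk; apply: h; exact: ltn_trans kt.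
Qed.

Lemma wE_wsum t F : wE t F = wsum t (fun w => F w * word_prob t w).
Proof.
elim: t F => [|t IH] F /=; first by rewrite /word_prob big_ord0 mulr1.
rewrite IH; congr wsum; apply/funext => w.
rewrite mulr_suml; apply: eq_bigr => z _.
have -> : word_prob t.+1 (upd w t z) = word_prob t w * p w t z.
  rewrite /word_prob big_ord_recr/= -[X in X * _]/(word_prob t (upd w t z)).
  rewrite (adapted_word_prob (agree_upd w z (leqnn t))).
  by rewrite (p_adapted (agree_upd w z (leqnn t))) /upd eqxx.
by rewrite mulrAC mulrC [p _ _ _ * _]mulrC.
Qed.

Lemma wED t F G : wE t (fun w => F w + G w) = wE t F + wE t G.
Proof.
elim: t F G => [//|t IH] F G /=.
rewrite -IH; congr wE; apply/funext => w.
by rewrite -big_split/=; apply: eq_bigr => z _; rewrite mulrDr.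
Qed.

Lemma wEZ t r F : wE t (fun w => r * F w) = r * wE t F.
Proof.
elim: t F => [//|t IH] F /=.
rewrite -IH; congr wE; apply/funext => w.
by rewrite mulr_sumr; apply: eq_bigr => z _; rewrite mulrCA.
Qed.

Hypothesis p_ge0 : forall w t z, 0 <= p w t z.

Lemma le_wE t F G : (forall w, F w <= G w) -> wE t F <= wE t G.
Proof.
elim: t F G => [|t IH] F G FG /=; first exact: FG.
by apply: IH => w; apply: ler_sum => z _; rewrite ler_wpM2l.
Qed.

Hypothesis p_sum1 : forall w t, \sum_z p w t z = 1.

Lemma wE_cst t r : wE t (fun _ => r) = r.
Proof.
elim: t => [//|t IH] /=.
rewrite -[RHS]IH; congr wE; apply/funext => w.
by rewrite -mulr_suml p_sum1 mul1r.
Qed.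

End FiniteLaws.

Section ProcessLaw.
Context {R : realType} {T : finType}.
Variables (z0 : T) (p : (nat -> T) -> nat -> T -> R).
Hypothesis p_adapted : forall t, adapted t (fun w => p w t).
Context {d : measure_display} {Omega : measurableType d}.
Variables (P : probability Omega R) (W : nat -> Omega -> T).

Definition cylinder (t : nat) (w : nat -> T) : set Omega :=
  [set om | forall k, (k < t)%N -> W k om = w k].

Definition has_law := forall t w,
  measurable (cylinder t w) /\ P (cylinder t w) = (word_prob p t w)%:E.

Lemma cylinderS t w z om :
  (\1_(cylinder t.+1 (upd w t z)) om : R) =
  \1_(cylinder t w) om * (W t om == z)%:R.
Proof.
rewrite !indicE -natrM mulnb; congr (_%:R : R); apply: congr1.
apply/idP/andP.
  rewrite inE => h; split; last first.
    by have := h t (ltnSn t); rewrite /upd eqxx => ->.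
  by rewrite inE => k kt; rewrite h ?(ltn_trans kt)// /upd ltn_eqF.
rewrite !inE => -[h /eqP e] k; rewrite ltnS leq_eqVlt /upd => /orP[/eqP->|kt].
  by rewrite eqxx.
by rewrite ltn_eqF// h.
Qed.

(** An adapted function of the process is constant on cylinders, hence a
    finite combination of their indicators. Its measurability and its
    expectation are read off from this identity. *)
Lemma wsum_cylinder t (F : (nat -> T) -> R) om : adapted t F ->
  wsum z0 t (fun w => F w * \1_(cylinder t w) om) = F (W ^~ om).
Proof.
elim: t F => [|t IH] F aF /=.
  rewrite indicE mem_set// mulr1; exact: aF.
transitivity (F (upd (W ^~ om) t (W t om))); last first.
  by apply: aF => k _; rewrite /upd; case: eqP => [->|].
rewrite -(IH (fun w => F (upd w t (W t om)))); last first.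
  move=> w w' h; apply: aF => k; rewrite ltnS leq_eqVlt /upd => /orP[/eqP->|kt].
    by rewrite eqxx.
  by rewrite ltn_eqF// h.
congr wsum; apply/funext => w.
rewrite (bigD1 (W t om))//= big1 ?addr0; last first.
  by move=> z /negbTE zW; rewrite cylinderS eq_sym zW mulr0 mulr0.
by rewrite cylinderS eqxx mulr1.
Qed.

Lemma wsum_bmf t (G : (nat -> T) -> Omega -> R) :
  (forall w, bounded_measurable (G w)) ->
  bounded_measurable (fun om => wsum z0 t (fun w => G w om)) /\
  \int[P]_om wsum z0 t (fun w => G w om) = wsum z0 t (fun w => \int[P]_om G w om).
Proof.
elim: t G => [|t IH] G bG /=; first by split.
have bG' w : bounded_measurable (fun om => \sum_z G (upd w t z) om).
  exact: bmf_sum.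
have [b1 e1] := IH (fun w om => \sum_z G (upd w t z) om) bG'.
split; first exact: b1.
rewrite e1; congr wsum; apply/funext => w; exact: expect_sum.
Qed.

Hypothesis lawW : has_law.

Lemma adapted_bmf t (F : (nat -> T) -> R) : adapted t F -> bounded_measurable (fun om => F (W ^~ om)).
Proof.
move=> aF.
apply: (bmf_ext (f := fun om => wsum z0 t (fun w => F w * \1_(cylinder t w) om))).
  by move=> om; exact: wsum_cylinder.
apply: (proj1 (wsum_bmf t _)) => w.
by apply: bmfZ; apply: bmf_indic; exact: (lawW t w).1.
Qed.

Lemma adapted_expect t (F : (nat -> T) -> R) : adapted t F ->
  \int[P]_om F (W ^~ om) = wE z0 p t F.
Proof.
move=> aF; rewrite (wE_wsum _ p_adapted).
under eq_Rintegral do rewrite -(wsum_cylinder _ aF).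
have bw w : bounded_measurable (fun om => F w * \1_(cylinder t w) om).
  by apply: bmfZ; apply: bmf_indic; exact: (lawW t w).1.
rewrite (proj2 (wsum_bmf t bw)).
congr wsum; apply/funext => w.
have [mE PE] := lawW t w.
by rewrite expectZ ?expect_indic ?PE//; exact: bmf_indic.
Qed.

End ProcessLaw.

(** * Existence of a process with given conditional laws *)

Section Subdivision.
Context {R : realType} {T : finType}.
Implicit Types a : T -> R.

(** The mass of the letters that precede z in the enumeration of T: the
    intervals from cumul a z to cumul a z + a z tile the unit interval. *)
Definition cumul a (z : T) : R :=
  \sum_(y <- take (index z (enum T)) (enum T)) a y.

Lemma cumulD a z :
  cumul a z + a z = \sum_(y <- take (index z (enum T)).+1 (enum T)) a y.
Proof.
have zT : (index z (enum T) < size (enum T))%N by rewrite index_mem mem_enum.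
by rewrite (take_nth z)// nth_index ?mem_enum// -cats1 big_cat big_seq1.
Qed.

Lemma sum_take_mono a (s : seq T) i j : (forall z, 0 <= a z) -> (i <= j)%N ->
  \sum_(y <- take i s) a y <= \sum_(y <- take j s) a y.
Proof.
move=> a0 ij; rewrite -(subnKC ij) takeD big_cat/= lerDl.
by apply: sumr_ge0.
Qed.

Lemma cumul_ge0 a z : (forall z, 0 <= a z) -> 0 <= cumul a z.
Proof. by move=> a0; apply: sumr_ge0. Qed.

Lemma cumulD_le1 a z : (forall z, 0 <= a z) -> \sum_z a z = 1 ->
  cumul a z + a z <= 1.
Proof.
move=> a0 <-; have -> : \sum_z a z = \sum_(y <- take (size (enum T)) (enum T)) a y.
  by rewrite take_size big_enum.
by rewrite cumulD; apply: sum_take_mono => //; rewrite index_mem mem_enum.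
Qed.

Lemma subdivision_ex a (l m u : R) : 0 < m -> \sum_z a z = 1 ->
  l <= u < l + m ->
  exists z, l + m * cumul a z <= u < l + m * (cumul a z + a z).
Proof.
move=> m0 a1 lu.
suff [i iT hi] : exists2 i, (i < size (enum T))%N &
    l + m * (\sum_(y <- take i (enum T)) a y) <= u <
    l + m * (\sum_(y <- take i.+1 (enum T)) a y).
  have [z0 _] : exists z0 : T, true.
    by case: (enum T) iT => // z0 *; exists z0.
  exists (nth z0 (enum T) i); rewrite cumulD /cumul index_uniq ?enum_uniq//.
have : l <= u < l + m * (\sum_(y <- enum T) a y) by rewrite big_enum/= a1 mulr1.
elim: (enum T) l {lu} => [|z s IH] l.
  by rewrite big_nil mulr0 addr0 => /andP[/le_lt_trans h /h]; rewrite ltxx.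
rewrite big_cons => /andP[lu us].
have [uz|uz] := ltP u (l + m * a z).
  exists 0%N => //=.
  by rewrite take0 big_cons !big_nil mulr0 !addr0 lu.
have [|i iT hi] := IH (l + m * a z); first by rewrite uz -addrA -mulrDr.
by exists i.+1 => //=; rewrite !big_cons !mulrDr !addrA.
Qed.

Lemma subdivision_uniq a (l m u : R) z z' : 0 <= m -> (forall z, 0 <= a z) ->
  l + m * cumul a z <= u < l + m * (cumul a z + a z) ->
  l + m * cumul a z' <= u < l + m * (cumul a z' + a z') -> z = z'.
Proof.
move=> m0 a0.
wlog : z z' / (index z (enum T) <= index z' (enum T))%N => [wl h h'|].
  by have [le|/ltnW le] := leqP (index z (enum T)) (index z' (enum T));
    [exact: wl|apply/esym; exact: wl].
rewrite leq_eqVlt => /orP[/eqP e _ _|lt /andP[_ h1] /andP[h2 _]].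
  have := nth_index z (s := enum T) (x := z).
  by rewrite e mem_enum => <-//; rewrite nth_index// mem_enum.
have := le_lt_trans h2 h1; rewrite ltrD2l => /lt_geF/negbT/negP[].
by rewrite ler_wpM2l// cumulD; exact: sum_take_mono.
Qed.

End Subdivision.

Section Existence.
Context {R : realType} {T : finType}.
Variables (z0 : T) (p : (nat -> T) -> nat -> T -> R).
Hypothesis p_adapted : forall t, adapted t (fun w => p w t).
Hypothesis p_ge0 : forall w t z, 0 <= p w t z.
Hypothesis p_sum1 : forall w t, \sum_z p w t z = 1.

(** The words of length t label a tiling of the unit interval by cells of
    length word_prob p t w; each further letter subdivides a cell in proportion
    to the conditional law of that letter. *)
Fixpoint left_end (t : nat) (w : nat -> T) : R :=
  if t is s.+1 then left_end s w + word_prob p s w * cumul (p w s) (w s) else 0.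

Definition in_cell t w (u : R) :=
  left_end t w <= u < left_end t w + word_prob p t w.

Lemma word_prob_ge0 t w : 0 <= word_prob p t w.
Proof. exact: prodr_ge0. Qed.

Lemma word_probS t w : word_prob p t.+1 w = word_prob p t w * p w t (w t).
Proof. by rewrite /word_prob big_ord_recr. Qed.

Lemma adapted_left_end t : adapted t (left_end t).
Proof.
elim: t => [//|t IH] w w' h /=.
have ht : agree t w w' by move=> k kt; apply: h; exact: ltnW.
by rewrite (IH _ _ ht) (adapted_word_prob p_adapted ht) (p_adapted ht) h.
Qed.

Lemma adapted_in_cell t : adapted t (in_cell t).
Proof.
move=> w w' h; rewrite /in_cell.
by rewrite (adapted_left_end h) (adapted_word_prob p_adapted h).
Qed.

Lemma in_cellS t w u :
  in_cell t.+1 w u = (left_end t w + word_prob p t w * cumul (p w t) (w t) <= u <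
    left_end t w + word_prob p t w * (cumul (p w t) (w t) + p w t (w t))).
Proof. by rewrite /in_cell /= word_probS mulrDr addrA. Qed.

Lemma in_cell_upd t w z u :
  in_cell t.+1 (upd w t z) u =
  (left_end t w + word_prob p t w * cumul (p w t) z <= u <
   left_end t w + word_prob p t w * (cumul (p w t) z + p w t z)).
Proof.
rewrite in_cellS (adapted_left_end (agree_upd w z (leqnn t))).
rewrite (adapted_word_prob p_adapted (agree_upd w z (leqnn t))).
by rewrite (p_adapted (agree_upd w z (leqnn t))) /upd eqxx.
Qed.

Lemma left_end_bounds t w : 0 <= left_end t w /\ left_end t w + word_prob p t w <= 1.
Proof.
elim: t => [|t [IH1 IH2]] /=; first by rewrite /word_prob big_ord0 add0r.
split; first by rewrite addr_ge0// mulr_ge0 ?word_prob_ge0// cumul_ge0.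
rewrite word_probS -addrA -mulrDr (le_trans _ IH2)// lerD2l.
by rewrite ler_piMr ?word_prob_ge0// cumulD_le1.
Qed.

Lemma in_cellW t w u : in_cell t.+1 w u -> in_cell t w u.
Proof.
rewrite in_cellS => /andP[h1 h2]; rewrite /in_cell (le_trans _ h1)/=; last first.
  by rewrite lerDl mulr_ge0 ?word_prob_ge0// cumul_ge0.
rewrite (lt_le_trans h2)// lerD2l ler_piMr ?word_prob_ge0//.
exact: cumulD_le1.
Qed.

(** The word whose cell contains u. Outside the interval from 0
    (included) to 1 (excluded) no cell contains u, and all letters are z0. *)
Fixpoint word_of (t : nat) (u : R) : nat -> T :=
  if t is s.+1 then
    let w := word_of s u in
    upd w s (odflt z0 [pick z | in_cell s.+1 (upd w s z) u])
  else fun=> z0.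

Definition sample (t : nat) (u : R) : T := word_of t.+1 u t.

Lemma agree_word_of t u : agree t (word_of t u) (sample ^~ u).
Proof.
elim: t => [//|t IH]; apply: agreeS => //= k kt.
by rewrite {1}/upd ltn_eqF// IH.
Qed.

Lemma sample_cell t w u : 0 <= u < 1 ->
  in_cell t w u <-> agree t (sample ^~ u) w.
Proof.
move=> u01; elim: t w => [|t IH] w.
  by split => // _; rewrite /in_cell /= /word_prob big_ord0 add0r.
have wS : sample t u = odflt z0 [pick z | in_cell t.+1 (upd (word_of t u) t z) u].
  by rewrite /sample /= {1}/upd eqxx.
split=> [h|h].
  have ht := (IH w).1 (in_cellW h).
  apply: agreeS => //.
  have hw : agree t (word_of t u) w.
    by move=> k kt; rewrite (@agree_word_of t u k kt) ht.
  have eqc z : in_cell t.+1 (upd (word_of t u) t z) u = in_cell t.+1 (upd w t z) u.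
    apply: (congr1 (fun f => f u)); apply: adapted_in_cell.
    apply: agreeS; last by rewrite /upd eqxx.
    by move=> k kt; rewrite /upd ltn_eqF// hw.
  have hz : in_cell t.+1 (upd w t (w t)) u.
    rewrite (_ : upd _ _ _ = w)//; apply/funext => k; rewrite /upd.
    by case: eqP => [->|].
  rewrite wS; case: pickP => [z|/(_ (w t))]; last by rewrite eqc hz.
  rewrite eqc /= => hz'; move: hz hz'; rewrite !in_cell_upd => hz hz'.
  exact: (subdivision_uniq (word_prob_ge0 t w) _ hz' hz).
have ht : agree t (sample ^~ u) w by move=> k kt; apply: h; exact: ltnW.
have hc := (IH w).2 ht.
have hw : agree t (word_of t u) w.
  by move=> k kt; rewrite (@agree_word_of t u k kt) ht.
have m0 : 0 < word_prob p t w.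
  by move: hc => /andP[h1 h2]; move: (le_lt_trans h1 h2); rewrite ltrDl.
have [z hz] := subdivision_ex m0 (p_sum1 w t) hc.
have eqc y : in_cell t.+1 (upd (word_of t u) t y) u = in_cell t.+1 (upd w t y) u.
  apply: (congr1 (fun f => f u)); apply: adapted_in_cell.
  apply: agreeS; last by rewrite /upd eqxx.
  by move=> k kt; rewrite /upd ltn_eqF// hw.
have := h t (ltnSn t); rewrite wS.
case: pickP => [y|/(_ z)]; last by rewrite eqc in_cell_upd hz.
rewrite eqc => hy /= yw; move: hy; rewrite yw (_ : upd _ _ _ = w)//.
by apply/funext => k; rewrite /upd; case: eqP => [->|].
Qed.

Lemma sample_out t u : ~~ (0 <= u < 1) -> sample t u = z0.
Proof.
move=> u01.
rewrite /sample /= {1}/upd eqxx; case: pickP => [z /andP[h1 h2]|//].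
have [b1 b2] := left_end_bounds t.+1 (upd (word_of t u) t z).
by move: u01; rewrite (le_trans b1 h1) (lt_le_trans h2 b2).
Qed.

Lemma uniform_prob_itv (l m : R) : 0 <= l -> 0 <= m -> l + m <= 1 ->
  uniform_prob (@ltr01 R) `[l, (l + m)[%classic = m%:E.
Proof.
move=> l0 m0 lm1; rewrite /uniform_prob.
rewrite (eq_integral (fun=> 1%E)); last first.
  move=> x; rewrite inE/= in_itv/= => /andP[lx xm].
  by rewrite /uniform_pdf (le_trans l0 lx) (le_trans (ltW xm) lm1) subr0 invr1.
rewrite integral_cst//= mul1e.
rewrite lebesgue_measure_itv/= lte_fin; case: ltP => h.
  by rewrite -EFinB addrC addKr.
congr EFin; apply/eqP; rewrite eq_le m0/=.
by move: h; rewrite gerDl.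
Qed.

(** A uniform point of the unit interval selects a decreasing sequence of
    cells, and the probability of a cell is its length. *)
Theorem sample_law : has_law p (uniform_prob (@ltr01 R)) sample.
Proof.
move=> t w.
pose I : set R := `[left_end t w, (left_end t w + word_prob p t w)[%classic.
pose O : set R := ~` `[0%R, 1%R[%classic.
have [b1 b2] := left_end_bounds t w.
have OC u : O u = ~~ (0 <= u < 1) :> Prop.
  by rewrite /O /setC /= in_itv/=; apply/propext; split => /negP.
pose b := `[< forall k, (k < t)%N -> z0 = w k >].
have E : cylinder sample t w = I `|` (if b then O else set0).
  apply/seteqP; split => u.
    rewrite /cylinder /= => h; have [u01|u01] := boolP (0 <= u < 1).
      by left; rewrite /I /= in_itv/=; exact: ((sample_cell t w u01).2 h).
    right; rewrite /b; case: asboolP => [_|[]]; first by rewrite OC.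
    by move=> k kt; rewrite -(sample_out k u01) h.
  move=> [|].
    rewrite /I /= in_itv/= => h.
    have u01 : 0 <= u < 1.
      by case/andP: h => h1 h2; rewrite (le_trans b1 h1) (lt_le_trans h2 b2).
    exact: ((sample_cell t w u01).1 h).
  rewrite /b; case: asboolP => // h; rewrite OC => u01 k kt.
  by rewrite (sample_out k u01); exact: h.
have mI : measurable I by exact: measurable_itv.
have mO : measurable O by apply: measurableC; exact: measurable_itv.
have mO' : measurable (if b then O else set0) by case: ifP.
have O0 : uniform_prob (@ltr01 R) O = 0%E.
  rewrite probability_setC; last exact: measurable_itv.
  rewrite [X in (_ - X)%E](_ : _ = 1%E) ?subee//.
  have := @uniform_prob_itv 0 1 (lexx _) ler01.
  by rewrite add0r; apply.
suff : measurable (I `|` (if b then O else set0)) /\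
    uniform_prob (@ltr01 R) (I `|` (if b then O else set0)) = (word_prob p t w)%:E.
  by rewrite -E.
split; first exact: measurableU.
rewrite measureU//.
- rewrite [X in (X + _)%E](_ : _ = (word_prob p t w)%:E); last first.
    exact: uniform_prob_itv (word_prob_ge0 t w) b2.
  rewrite [X in (_ + X)%E](_ : _ = 0%E) ?adde0//.
  by case: ifP => //; rewrite measure0.
- apply/seteqP; split => // u [] /=; rewrite /I /= in_itv/= => /andP[h1 h2].
  case: ifP => //; rewrite OC.
  by rewrite (le_trans b1 h1) (lt_le_trans h2 b2).
Qed.

End Existence.

(** * Discounted cost and dynamic programming *)

Section Geometric.
Context {R : realType}.
Variables (beta : R).
Hypothesis beta01 : 0 < beta < 1.

Let beta_ge0 : 0 <= beta. Proof. by case/andP: beta01 => /ltW. Qed.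
Let beta1 : 0 < 1 - beta. Proof. by case/andP: beta01; rewrite subr_gt0. Qed.

Lemma sum_geometric_le t n : \sum_(t <= k < n) beta ^+ k <= beta ^+ t / (1 - beta).
Proof.
have [nt|tn] := leqP n t.
  by rewrite big_geq// divr_ge0 ?exprn_ge0// ltW.
rewrite ler_pdivlMr// mulr_suml.
have -> : \sum_(t <= k < n) beta ^+ k * (1 - beta) =
    \sum_(t <= k < n) (- beta ^+ k.+1 - - beta ^+ k).
  by apply: eq_bigr => k _; rewrite mulrBr mulr1 opprK -exprSr addrC.
by rewrite telescope_sumr ?(ltnW tn)// opprK addrC gerDl oppr_le0 exprn_ge0.
Qed.

Lemma series_tail (u : nat -> R) (C : R) : (forall k, `|u k| <= C * beta ^+ k) ->
  cvgn (series u) /\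
  forall t, `|limn (series u) - series u t| <= beta ^+ t * (C / (1 - beta)).
Proof.
move=> uC.
have tail t n : (t <= n)%N ->
    `|series u n - series u t| <= beta ^+ t * (C / (1 - beta)).
  move=> tn; rewrite /series/= (@big_cat_nat _ _ _ t)//=.
  rewrite addrAC subrr add0r (le_trans (ler_norm_sum _ _ _))//.
  apply: (@le_trans _ _ (\sum_(t <= k < n) C * beta ^+ k)); first exact: ler_sum.
  have C0 : 0 <= C by have := le_trans (normr_ge0 _) (uC 0%N); rewrite expr0 mulr1.
  by rewrite -mulr_sumr mulrCA ler_wpM2l// sum_geometric_le.
have cu : cvgn (series u).
  apply: normed_cvg; apply: (@series_le_cvg _ _ (geometric C beta)).
  - by move=> n; exact: normr_ge0.
  - move=> n; rewrite /geometric /=; apply: mulr_ge0; last exact: exprn_ge0.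
    by have := le_trans (normr_ge0 _) (uC 0%N); rewrite expr0 mulr1.
  - by move=> n; exact: uC.
  - by apply: is_cvg_geometric_series; rewrite ger0_norm//; case/andP: beta01.
split => // t.
have cn : (fun n => `|series u n - series u t|) @ \oo -->
    `|limn (series u) - series u t|.
  by apply: cvg_norm; apply: cvgB => //; exact: cvg_cst.
rewrite -(cvg_lim _ cn)//; apply: limr_le; first by apply/cvg_ex; exists (`|limn (series u) - series u t|).
by exists t => // n; exact: tail.
Qed.

(** An error that decays geometrically in a free parameter can be dropped. *)
Lemma geometric_absorb (x y D : R) : (forall t, x <= y + beta ^+ t * D) -> x <= y.
Proof.
move=> h.
have c0 : (fun t => y + beta ^+ t * D) @ \oo --> y + 0 * D.
  apply: cvgD; first exact: cvg_cst.
  apply: cvgMl; apply: cvg_expr; by rewrite ger0_norm//; case/andP: beta01.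
rewrite mul0r addr0 in c0.
rewrite -(cvg_lim _ c0)//; apply: limr_ge; first by apply/cvg_ex; exists y.
exact: nearW.
Qed.

End Geometric.

Section WordSupport.
Context {R : realType} {T : finType}.
Variables (z0 : T) (p : (nat -> T) -> nat -> T -> R).
Hypothesis p_adapted : forall t, adapted t (fun w => p w t).
Hypothesis p_ge0 : forall w t z, 0 <= p w t z.

Lemma le_wsum t (F G : (nat -> T) -> R) : (forall w, F w <= G w) ->
  wsum z0 t F <= wsum z0 t G.
Proof.
elim: t F G => [|t IH] F G FG /=; first exact: FG.
by apply: IH => w; apply: ler_sum => z _; exact: FG.
Qed.

Lemma le_wE_supp t F G : (forall w, 0 < word_prob p t w -> F w <= G w) ->
  wE z0 p t F <= wE z0 p t G.
Proof.
move=> FG; rewrite !(wE_wsum _ p_adapted); apply: le_wsum => w.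
have := word_prob_ge0 p_ge0 t w; rewrite le_eqVlt => /orP[/eqP <-|w0].
  by rewrite !mulr0.
by rewrite ler_pM2r// FG.
Qed.

End WordSupport.

Section DiscountedCost.
Context {R : realType}.
Variables (m : mdp R) (beta C : R).
Local Notation S := (state m).
Local Notation A := (action m).
Local Notation Z := (noise m).
Local Notation AZ := (A * Z)%type.
Hypothesis beta01 : 0 < beta < 1.
Hypothesis weight_ge0 : forall (s : S) (a : A) (z : Z), 0 <= weight s a z.
Hypothesis weight_sum1 : forall (s : S) (a : A), \sum_z weight s a z = 1.
Hypothesis cost_le : forall (s : S) (a : A), `|stage_cost s a| <= C.

Definition action_value (V : S -> R) (s : S) (a : A) : R :=
  stage_cost s a + beta * \sum_z weight s a z * V (Defs.next s a z).

Definition mdp_law (g : policy m) (s0 : S) (w : nat -> AZ) (k : nat) (z : AZ) : R :=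
  g (history s0 w k) (state_at s0 w k) z.1 * weight (state_at s0 w k) z.1 z.2.

Definition partial_cost (s0 : S) (t : nat) (w : nat -> AZ) : R :=
  \sum_(k < t) beta ^+ k * stage_cost (state_at s0 w k) (w k).1.

Lemma adapted_state_at (s0 : S) t : adapted t (fun w => state_at s0 w t).
Proof.
elim: t => [//|t IH] w w' h /=.
by rewrite (IH w w') ?h// => k kt; apply: h; exact: ltnW.
Qed.

Lemma adapted_history (s0 : S) t : adapted t (fun w => history s0 w t).
Proof.
move=> w w' h; apply/eq_in_map => k; rewrite mem_iota add0n => kt.
have -> : state_at s0 w k = state_at s0 w' k.
  by apply: adapted_state_at => j jk; apply: h; exact: ltn_trans kt.
by rewrite (h _ kt).
Qed.

Lemma adapted_mdp_law g s0 t : adapted t (fun w => mdp_law g s0 w t).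
Proof.
move=> w w' h; apply/funext => z; rewrite /mdp_law.
by rewrite (adapted_history _ h) (adapted_state_at _ h).
Qed.

Lemma adapted_partial_cost (s0 : S) t : adapted t (partial_cost s0 t).
Proof.
move=> w w' h; apply: eq_bigr => -[k kt] _ /=.
have -> : state_at s0 w k = state_at s0 w' k.
  by apply: adapted_state_at => j jk; apply: h; exact: ltn_trans kt.
by rewrite (h _ kt).
Qed.

Lemma partial_costS (s0 : S) t w z : partial_cost s0 t.+1 (upd w t z) =
  partial_cost s0 t w + beta ^+ t * stage_cost (state_at s0 w t) z.1.
Proof.
rewrite /partial_cost big_ord_recr/= -/(partial_cost s0 t (upd w t z)).
rewrite (adapted_partial_cost _ (agree_upd w z (leqnn t))).
by rewrite (adapted_state_at _ (agree_upd w z (leqnn t))) /upd eqxx.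
Qed.

Lemma state_atS (s0 : S) t w z :
  state_at s0 (upd w t z) t.+1 = Defs.next (state_at s0 w t) z.1 z.2.
Proof.
by rewrite /= (adapted_state_at _ (agree_upd w z (leqnn t))) /upd eqxx.
Qed.

Section Admissible.
Variables (g : policy m).
Hypothesis g_adm : admissible g.

Lemma mdp_law_ge0 s0 w t z : 0 <= mdp_law g s0 w t z.
Proof. by rewrite mulr_ge0//; exact: (g_adm _ _).1. Qed.

Lemma mdp_law_sum (s0 : S) w t (F : AZ -> R) :
  \sum_z mdp_law g s0 w t z * F z =
  \sum_a g (history s0 w t) (state_at s0 w t) a *
    \sum_z weight (state_at s0 w t) a z * F (a, z).
Proof.
transitivity (\sum_a \sum_z mdp_law g s0 w t (a, z) * F (a, z)).
  by rewrite pair_big/=; apply: eq_bigr => -[].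
by apply: eq_bigr => a _; rewrite mulr_sumr; apply: eq_bigr => z _; rewrite mulrA.
Qed.

Lemma mdp_law_sum1 s0 w t : \sum_z mdp_law g s0 w t z = 1.
Proof.
under eq_bigr do rewrite -[mdp_law _ _ _ _ _]mulr1.
rewrite (mdp_law_sum s0 w t (fun=> 1)) -[RHS](g_adm (history s0 w t) (state_at s0 w t)).2.
apply: eq_bigr => a _; under eq_bigr do rewrite mulr1.
by rewrite weight_sum1 mulr1.
Qed.

Lemma action_noise_inhabited (s0 : S) : inhabited AZ.
Proof.
have A0 : exists a : A, true.
  apply: contrapT => h; have := (g_adm [::] s0).2.
  rewrite big1 => [/eqP|a _]; first by rewrite eq_sym oner_eq0.
  by exfalso; apply: h; exists a.
have [a _] := A0.
have Z0 : exists z : Z, true.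
  apply: contrapT => h; have := weight_sum1 s0 a.
  rewrite big1 => [/eqP|z _]; first by rewrite eq_sym oner_eq0.
  by exfalso; apply: h; exists z.
by have [z _] := Z0; exists; exact: (a, z).
Qed.

Lemma expected_cost_approx (z0 : AZ) s0 d (Omega : measurableType d)
    (P : probability Omega R) (W : nat -> Omega -> AZ) t :
  has_law (mdp_law g s0) P W ->
  `|expected_cost beta s0 P W - wE z0 (mdp_law g s0) t (partial_cost s0 t)| <=
    beta ^+ t * (C / (1 - beta)).
Proof.
move=> lawW.
pose u om k := beta ^+ k * stage_cost (state_at s0 (W ^~ om) k) (W k om).1.
have uC om k : `|u om k| <= C * beta ^+ k.
  rewrite normrM normrX ger0_norm; last by case/andP: beta01 => /ltW.
  rewrite mulrC ler_wpM2r// exprn_ge0//; by case/andP: beta01 => /ltW.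
have tail om := (series_tail beta01 (uC om)).2.
have cu om := (series_tail beta01 (uC om)).1.
have su om k : series (u om) k = partial_cost s0 k (W ^~ om).
  by rewrite /series/= big_mkord.
have bp k := adapted_bmf z0 lawW (@adapted_partial_cost s0 k).
have bl : bounded_measurable (fun om => limn (series (u om))).
  split.
    apply: (measurable_fun_cvg (h := fun k om => series (u om) k)).
      move=> k; apply: (eq_measurable_fun (fun om => partial_cost s0 k (W ^~ om))).
        by move=> om _; rewrite su.
      exact: (bp k).1.
    by move=> om _; exact: cu.
  exists (C / (1 - beta)) => om; have := tail om 0%N.
  by rewrite expr0 mul1r /series/= big_geq// subr0.
rewrite -(adapted_expect z0 (@adapted_mdp_law g s0) lawW
  (@adapted_partial_cost s0 t)).
rewrite /expected_cost -(expectB P bl (bp t)).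
apply: expect_norm_le; first exact: bmfB.
by move=> om; have := tail om t; rewrite su.
Qed.

(** The set that defines the discounted cost is inhabited by sample_law.
    Whichever element is chosen, the cost of the first t stages is determined by
    the finite-dimensional laws, and the later stages contribute a geometric
    tail. *)
Lemma discounted_cost_approx (z0 : AZ) s0 t :
  `|discounted_cost beta s0 g - wE z0 (mdp_law g s0) t (partial_cost s0 t)| <=
    beta ^+ t * (C / (1 - beta)).
Proof.
rewrite /discounted_cost; case: xgetP => [v _|h].
  case=> d [ Omega] [P] [W] [h ->]; exact: expected_cost_approx.
exfalso.
have lawW := sample_law z0 (@adapted_mdp_law g s0) (mdp_law_ge0 s0) (mdp_law_sum1 s0).
apply: (h (expected_cost beta s0 (uniform_prob (@ltr01 R)) (sample z0 (mdp_law g s0)))).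
exists _, _, (uniform_prob (@ltr01 R)), (sample z0 (mdp_law g s0)); split => //.
Qed.

Section Verification.
Variables (V : S -> R) (B delta : R) (S0 : set S) (s0 : S).
Hypothesis V_le : forall s, `|V s| <= B.
Hypothesis S0s0 : S0 s0.
Hypothesis S0_closed : forall s a z, S0 s -> 0 < weight s a z -> S0 (Defs.next s a z).
Hypothesis delta_ge0 : 0 <= delta.

Lemma support_closed t w : 0 < word_prob (mdp_law g s0) t w ->
  S0 (state_at s0 w t).
Proof.
elim: t => [//|t IH]; rewrite word_probS => h.
have h1 : 0 < word_prob (mdp_law g s0) t w.
  rewrite lt_def (word_prob_ge0 (mdp_law_ge0 s0)) andbT.
  by apply/eqP => e; move: h; rewrite e mul0r ltxx.
rewrite /=; apply: S0_closed; first exact: IH.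
rewrite lt_def weight_ge0 andbT; apply/eqP => e; move: h.
by rewrite /mdp_law e mulr0 mulr0 ltxx.
Qed.

(** Averaging over the last action and noise replaces the terminal value V
    by the action values of V: one step of dynamic programming. *)
Lemma wE_partial_costS (z0 : AZ) t :
  wE z0 (mdp_law g s0) t.+1
    (fun w => partial_cost s0 t.+1 w + beta ^+ t.+1 * V (state_at s0 w t.+1)) =
  wE z0 (mdp_law g s0) t (fun w => partial_cost s0 t w + beta ^+ t *
    \sum_a g (history s0 w t) (state_at s0 w t) a * action_value V (state_at s0 w t) a).
Proof.
rewrite [LHS]/=; congr wE; apply/funext => w.
under eq_bigr do rewrite -/(state_at s0 (upd w t _) t.+1) partial_costS state_atS.
rewrite (mdp_law_sum s0 w t (fun z => partial_cost s0 t w +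
  beta ^+ t * stage_cost (state_at s0 w t) z.1 +
  beta ^+ t.+1 * V (Defs.next (state_at s0 w t) z.1 z.2)))/=.
rewrite -[X in _ = X + _]mul1r -(g_adm (history s0 w t) (state_at s0 w t)).2.
rewrite mulr_suml mulr_sumr -big_split/=; apply: eq_bigr => a _.
rewrite [X in _ = _ + X]mulrCA -mulrDr; congr (_ * _).
rewrite /action_value -[X in _ = X + _ * (_ + _)]mul1r.
rewrite -[X in _ = _ + _ * (X + _)]mul1r -(weight_sum1 (state_at s0 w t) a).
rewrite !mulr_suml mulr_sumr -big_split/= mulr_sumr -big_split/=.
apply: eq_bigr => z _.
by rewrite exprS; ring.
Qed.

Let bound (z0 : AZ) t :
  `|wE z0 (mdp_law g s0) t (partial_cost s0 t) -
    wE z0 (mdp_law g s0) t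
      (fun w => partial_cost s0 t w + beta ^+ t * V (state_at s0 w t))| <=
  beta ^+ t * B.
Proof.
rewrite wED opprD addrA subrr add0r normrN wEZ normrM normrX.
have b0 : 0 <= beta by case/andP: beta01 => /ltW.
rewrite ger0_norm// ler_wpM2l ?exprn_ge0//.
have p0 := mdp_law_ge0 s0; have p1 := mdp_law_sum1 s0.
rewrite ler_norml; apply/andP; split.
  rewrite -(wE_cst z0 p1 t (- B)); apply: le_wE => // w.
  by have := V_le (state_at s0 w t); rewrite ler_norml => /andP[].
rewrite -[leRHS](wE_cst z0 p1 t B); apply: le_wE => // w.
by have := V_le (state_at s0 w t); rewrite ler_norml => /andP[].
Qed.

(** The accumulated cost plus the discounted terminal value grows in mean by
    at most beta ^+ t * delta at stage t, and the terminal value vanishes in the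
    limit. *)
Lemma cost_upper :
  (forall h s, S0 s -> \sum_a g h s a * action_value V s a <= V s + delta) ->
  discounted_cost beta s0 g <= V s0 + delta / (1 - beta).
Proof.
move=> Vstep; have [z0] := action_noise_inhabited s0.
have b0 : 0 <= beta by case/andP: beta01 => /ltW.
have p0 := mdp_law_ge0 s0; have p1 := mdp_law_sum1 s0.
have step t : wE z0 (mdp_law g s0) t
    (fun w => partial_cost s0 t w + beta ^+ t * V (state_at s0 w t)) <=
    V s0 + delta * \sum_(0 <= k < t) beta ^+ k.
  elim: t => [|t IH].
    by rewrite /= /partial_cost big_ord0 add0r expr0 mul1r big_geq// mulr0 addr0.
  rewrite wE_partial_costS big_nat_recr//= mulrDr addrA.
  rewrite -(wE_cst z0 p1 t (delta * beta ^+ t)).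
  apply: le_trans (lerD IH (lexx _)).
  rewrite -wED; apply: le_wE_supp => //; first exact: adapted_mdp_law.
  move=> w /support_closed Sw; rewrite -addrA lerD2l [delta * _]mulrC -mulrDr.
  by rewrite ler_wpM2l ?exprn_ge0// Vstep.
apply: (geometric_absorb beta01 (D := C / (1 - beta) + B)) => t.
have h1 := discounted_cost_approx z0 s0 t.
have h2 := bound z0 t.
have h3 := step t.
have h4 : delta * \sum_(0 <= k < t) beta ^+ k <= delta / (1 - beta).
  by rewrite ler_wpM2l// (le_trans (sum_geometric_le beta01 0 t))// expr0 mul1r.
rewrite mulrDr; move: h1 h2; rewrite !ler_norml => /andP[_ h1] /andP[_ h2]; lra.
Qed.

Lemma cost_lower :
  (forall h s, S0 s -> V s - delta <= \sum_a g h s a * action_value V s a) ->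
  V s0 - delta / (1 - beta) <= discounted_cost beta s0 g.
Proof.
move=> Vstep; have [z0] := action_noise_inhabited s0.
have b0 : 0 <= beta by case/andP: beta01 => /ltW.
have p0 := mdp_law_ge0 s0; have p1 := mdp_law_sum1 s0.
have step t : V s0 - delta * \sum_(0 <= k < t) beta ^+ k <=
    wE z0 (mdp_law g s0) t
    (fun w => partial_cost s0 t w + beta ^+ t * V (state_at s0 w t)).
  elim: t => [|t IH].
    by rewrite /= /partial_cost big_ord0 add0r expr0 mul1r big_geq// mulr0 subr0.
  rewrite wE_partial_costS big_nat_recr//= mulrDr opprD addrA.
  rewrite lerBlDr (le_trans IH)//.
  rewrite -(wE_cst z0 p1 t (delta * beta ^+ t)).
  rewrite -wED; apply: le_wE_supp => //; first exact: adapted_mdp_law.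
  move=> w /support_closed Sw; rewrite -addrA lerD2l [delta * _]mulrC -mulrDr.
  by rewrite ler_wpM2l ?exprn_ge0// -lerBlDr Vstep.
apply: (geometric_absorb beta01 (D := C / (1 - beta) + B)) => t.
have h1 := discounted_cost_approx z0 s0 t.
have h2 := bound z0 t.
have h3 := step t.
have h4 : delta * \sum_(0 <= k < t) beta ^+ k <= delta / (1 - beta).
  by rewrite ler_wpM2l// (le_trans (sum_geometric_le beta01 0 t))// expr0 mul1r.
rewrite mulrDr; move: h1 h2; rewrite !ler_norml => /andP[h1 _] /andP[h2 _]; lra.
Qed.

End Verification.
End Admissible.

Lemma admissible_stationary (f : S -> A) : admissible (stationary f).
Proof.
move=> h s; split=> [a|]; first by rewrite /stationary ler0n.
rewrite (bigD1 (f s))//= /stationary eqxx big1 ?addr0// => a.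
by rewrite eq_sym => /negbTE ->.
Qed.

Lemma stationary_sum (f : S -> A) h s (F : A -> R) :
  \sum_a stationary f h s a * F a = F (f s).
Proof.
rewrite (bigD1 (f s))//= /stationary eqxx mul1r big1 ?addr0// => a.
by rewrite eq_sym => /negbTE ->; rewrite mul0r.
Qed.

(** Near-greediness matters only on S0, which the process never leaves;
    S0 will be the set of atoms of the invariant measure. *)
Lemma stationary_cost_upper (V : S -> R) (B delta : R) (S0 : set S) s0 (f : S -> A) :
  (forall s, `|V s| <= B) -> 0 <= delta -> S0 s0 ->
  (forall s a z, S0 s -> 0 < weight s a z -> S0 (Defs.next s a z)) ->
  (forall s, S0 s -> action_value V s (f s) <= V s + delta) ->
  discounted_cost beta s0 (stationary f) <= V s0 + delta / (1 - beta).
Proof.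
move=> VB d0 Ss0 Sc Vf; apply: (cost_upper (admissible_stationary f) VB Ss0 Sc d0).
by move=> h s Ss; rewrite stationary_sum; exact: Vf.
Qed.

Lemma discounted_cost_ge (V : S -> R) (B : R) s0 (g : policy m) :
  (forall s, `|V s| <= B) -> (forall s a, V s <= action_value V s a) ->
  admissible g -> V s0 <= discounted_cost beta s0 g.
Proof.
move=> VB Va gadm.
have := @cost_lower g gadm V B 0 setT s0 VB I (fun _ _ _ _ _ => I) (lexx _).
rewrite mul0r subr0; apply => h s _; rewrite subr0.
rewrite -[leLHS]mul1r -(gadm h s).2 mulr_suml; apply: ler_sum => a _.
by rewrite ler_wpM2l//; exact: (gadm h s).1.
Qed.

(** Verification: V bounds the cost of each admissible policy from below,
    and a greedy selector attains it. *)
Lemma optimal_cost_eq (V : S -> R) (B : R) s0 (f : S -> A) :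
  (forall s, `|V s| <= B) -> (forall s a, V s <= action_value V s a) ->
  (forall s, action_value V s (f s) <= V s) ->
  optimal_cost beta s0 = V s0 /\ discounted_cost beta s0 (stationary f) = V s0.
Proof.
move=> VB Va Vf.
have lo g : admissible g -> V s0 <= discounted_cost beta s0 g.
  exact: (discounted_cost_ge s0 VB Va).
have hi : discounted_cost beta s0 (stationary f) <= V s0.
  have := @stationary_cost_upper V B 0 setT s0 f VB (lexx _) I (fun _ _ _ _ _ => I).
  by rewrite mul0r addr0; apply => s _; rewrite addr0.
have fadm := admissible_stationary f.
split; last by apply/eqP; rewrite eq_le hi lo.
apply/eqP; rewrite eq_le; apply/andP; split.
  apply: le_trans hi; apply: ge_inf; last by exists (stationary f).
  by exists (V s0) => _ [g gadm <-]; exact: lo.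
apply: lb_le_inf; first by exists (discounted_cost beta s0 (stationary f)), (stationary f).
by move=> _ [g gadm <-]; exact: lo.
Qed.

End DiscountedCost.

(** * Convergence of averages *)

Section Convergence.
Context {R : realType}.
Implicit Types u : nat -> R.

Lemma cvgn0P u : u @ \oo --> (0 : R) <->
  forall e, 0 < e -> exists N, forall n, (N <= n)%N -> `|u n| <= e.
Proof.
split=> [/cvgr0Pnorm_le h e /h [N _ hN]|h].
  by exists N => n Nn; exact: hN.
by apply/cvgr0Pnorm_le => e /h [N hN]; exists N => // n /= /hN.
Qed.

Lemma cvgnP u (l : R) : u @ \oo --> l <->
  forall e, 0 < e -> exists N, forall n, (N <= n)%N -> `|u n - l| <= e.
Proof.
split=> [/cvgrPdist_le h e /h [N _ hN]|h].
  by exists N => n Nn; rewrite distrC; exact: hN.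
by apply/cvgrPdist_le => e /h [N hN]; exists N => // n /= /hN; rewrite distrC.
Qed.

Lemma exists_nat_gt (x : R) : exists n : nat, x < n%:R.
Proof.
exists (Num.Def.archi_bound `|x|).
by rewrite (le_lt_trans (ler_norm x))// archi_boundP.
Qed.

Lemma square_bracket t : (0 < t)%N -> exists m, (m.+1 ^ 2 <= t < m.+2 ^ 2)%N.
Proof.
elim: t => [//|t IH] _; have [->|t0] := posnP t; first by exists 0%N.
have [m /andP[m1 m2]] := IH t0.
have [lt|le] := ltnP t.+1 (m.+2 ^ 2); first by exists m; rewrite lt ltnW.
exists m.+1; rewrite le /=; apply: leq_ltn_trans m2 _.
by rewrite ltn_exp2r.
Qed.

(** Between the squares of m + 1 and m + 2 the sequence moves by at most
    B * (2 m + 3), which is negligible against the square of m. *)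
Lemma cvg_average_squares (s : nat -> R) (B : R) : 0 <= B ->
  (forall t, `|s t.+1 - s t| <= B) ->
  (fun m : nat => s (m.+1 ^ 2)%N / (m.+1 ^ 2)%N%:R) @ \oo --> (0 : R) ->
  (fun t : nat => s t / t%:R) @ \oo --> (0 : R).
Proof.
move=> B0 sB /cvgn0P sq; apply/cvgn0P => e e0.
have e20 : 0 < e / 2 by rewrite divr_gt0.
have [N1 hN1] := sq _ e20.
have [N2 hN2] := exists_nat_gt (3 * B / (e / 2)).
pose M := maxn N1 N2.
have gap t k : `|s (t + k)%N - s t| <= B * k%:R.
  elim: k => [|k IH]; first by rewrite addn0 subrr normr0 mulr0.
  rewrite addnS -(subrKA (s (t + k)%N)) (le_trans (ler_normD _ _))//.
  by rewrite -natr1 mulrDr mulr1 addrC lerD.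
exists (M.+1 ^ 2)%N => t Mt.
have t0 : (0 < t)%N by apply: leq_trans Mt; rewrite expn_gt0.
have [m /andP[m1 m2]] := square_bracket t0.
have Mm : (M <= m)%N.
  rewrite leqNgt; apply/negP => mM.
  have h : (m.+2 ^ 2 <= M.+1 ^ 2)%N by rewrite leq_exp2r.
  by have := leq_trans m2 (leq_trans h Mt); rewrite ltnn.
have hm := hN1 m (leq_trans (leq_maxl _ _) Mm).
set q := (m.+1 ^ 2)%N in hm m1 *.
have q0 : 0 < (q%:R : R) by rewrite ltr0n /q expn_gt0.
have tq : (q%:R : R) <= t%:R by rewrite ler_nat.
have tR0 : 0 < (t%:R : R) by rewrite ltr0n.
have g := gap q (t - q)%N; rewrite subnKC// in g.
have tqm : ((t - q)%N%:R : R) <= 3 * m.+1%:R.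
  rewrite -natrM ler_nat leq_subLR.
  apply: (leq_trans (ltnW m2)); rewrite /q; lia.
have hm' : `|s q| <= e / 2 * q%:R.
  by move: hm; rewrite normrM normfV (ger0_norm (ltW q0)) ler_pdivrMr.
have hB : 3 * B <= e / 2 * m.+1%:R.
  rewrite [leRHS]mulrC -ler_pdivrMr//.
  rewrite (le_trans (ltW hN2))// ler_nat ltnW// ltnS.
  exact: leq_trans (leq_maxr _ _) Mm.
have qE : (q%:R : R) = m.+1%:R * m.+1%:R by rewrite /q natrX expr2.
rewrite normrM normfV (ger0_norm (ltW tR0)) ler_pdivrMr//.
have h1 : `|s t| <= `|s q| + B * (t - q)%N%:R.
  by rewrite -lerBlDl (le_trans _ g)// lerB_dist.
have h2 : B * (t - q)%N%:R <= e / 2 * q%:R.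
  apply: (@le_trans _ _ (B * (3 * m.+1%:R))); first by rewrite ler_wpM2l.
  by rewrite qE mulrA mulrA ler_wpM2r// mulrC.
have h3 : e * q%:R <= e * t%:R by rewrite ler_wpM2l// ltW.
lra.
Qed.

Lemma sum_inv_square_le n : \sum_(0 <= m < n) ((m.+1 ^ 2)%N%:R)^-1 <= (2 : R).
Proof.
case: n => [|n]; first by rewrite big_geq.
suff h : \sum_(0 <= m < n.+1) ((m.+1 ^ 2)%N%:R)^-1 <= (2 - n.+1%:R^-1 : R).
  by rewrite (le_trans h)// gerBl.
elim: n => [|n IH]; first by rewrite big_nat1 exp1n invr1; lra.
rewrite big_nat_recr//= (le_trans (lerD IH (lexx _)))//.
have a0 : 0 < (n.+1%:R : R) by rewrite ltr0n.
have b0 : 0 < (n.+2%:R : R) by rewrite ltr0n.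
have ab : (n.+2%:R : R) = n.+1%:R + 1 by rewrite -natr1.
rewrite -addrA lerD2l -lerBrDl opprK addrC.
have -> : (n.+1%:R^-1 - n.+2%:R^-1 : R) = (n.+1%:R * n.+2%:R)^-1.
  move: a0 b0; rewrite ab; move: (n.+1%:R : R) => a a0 b0.
  by field; rewrite !lt0r_neq0.
rewrite lef_pV2 ?posrE ?mulr_gt0 ?ltr0n ?expn_gt0//.
by rewrite natrX expr2 ler_wpM2r ?ler_nat.
Qed.

End Convergence.

(** * A law of large numbers for bounded martingale differences *)

Section MartingaleLLN.
Context {R : realType} {T : finType}.
Variables (z0 : T) (p : (nat -> T) -> nat -> T -> R).
Hypothesis p_adapted : forall t, adapted t (fun w => p w t).
Hypothesis p_ge0 : forall w t z, 0 <= p w t z.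
Hypothesis p_sum1 : forall w t, \sum_z p w t z = 1.
Variables (D : nat -> (nat -> T) -> R) (B : R).
Hypothesis D_adapted : forall t, adapted t.+1 (D t).
Hypothesis D_mart : forall t w, \sum_z p w t z * D t (upd w t z) = 0.
Hypothesis D_le : forall t w, `|D t w| <= B.

Definition mart (t : nat) (w : nat -> T) : R := \sum_(k < t) D k w.

Lemma adapted_mart t : adapted t (mart t).
Proof.
move=> w w' h; apply: eq_bigr => -[k kt] _ /=.
by apply: D_adapted => j jk; apply: h; exact: leq_trans kt.
Qed.

Lemma martS t w z : mart t.+1 (upd w t z) = mart t w + D t (upd w t z).
Proof.
rewrite /mart big_ord_recr/= -/(mart t (upd w t z)).
by rewrite (adapted_mart (agree_upd w z (leqnn t))).
Qed.

(** The increments are orthogonal, so that their second moments add up. *)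
Lemma mart_second_moment t : wE z0 p t (fun w => mart t w ^+ 2) <= B ^+ 2 * t%:R.
Proof.
elim: t => [|t IH]; first by rewrite /= /mart big_ord0 expr0n/= mulr0.
apply: (@le_trans _ _ (wE z0 p t (fun w => mart t w ^+ 2 + B ^+ 2))); last first.
  by rewrite wED wE_cst// -natr1 mulrDr mulr1 lerD2r.
rewrite [X in X <= _]/=; apply: le_wE => // w.
have -> : \sum_z p w t z * mart t.+1 (upd w t z) ^+ 2 =
    mart t w ^+ 2 + \sum_z p w t z * D t (upd w t z) ^+ 2.
  transitivity (\sum_z (p w t z * mart t w ^+ 2 +
      2 * mart t w * (p w t z * D t (upd w t z)) +
      p w t z * D t (upd w t z) ^+ 2)).
    by apply: eq_bigr => z _; rewrite martS; ring.
  by rewrite !big_split/= -mulr_suml p_sum1 mul1r -mulr_sumr D_mart mulr0 addr0.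
rewrite lerD2l -[leRHS]mul1r -(p_sum1 w t) mulr_suml; apply: ler_sum => z _.
rewrite ler_wpM2l//; have h := D_le t (upd w t z).
by rewrite -[leLHS]real_normK ?num_real// ler_pXn2r// ?nnegrE// (le_trans _ h).
Qed.

Context {d : measure_display} {Omega : measurableType d}.
Variables (P : probability Omega R) (W : nat -> Omega -> T).
Hypothesis lawW : has_law p P W.

(** At time m ^ 2 the average has second moment at most B ^+ 2 / m ^ 2. These
    are summable, so the sum of the squared averages has finite expectation; it
    is almost surely finite, and its terms tend to 0. *)
Lemma mart_squares_cvg : {ae P, forall om,
  (fun m : nat => mart (m.+1 ^ 2) (W ^~ om) / (m.+1 ^ 2)%N%:R) @ \oo --> (0 : R)}.
Proof.
pose f (m : nat) (om : Omega) : R :=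
  (mart (m.+1 ^ 2) (W ^~ om) / (m.+1 ^ 2)%N%:R) ^+ 2.
pose F om := (\sum_(0 <= m <oo) (f m om)%:E)%E.
have f0 m om : 0 <= f m om by exact: sqr_ge0.
have F_adapted m : adapted (m.+1 ^ 2) (fun w => (mart (m.+1 ^ 2) w / (m.+1 ^ 2)%N%:R) ^+ 2).
  by move=> w w' h; rewrite (adapted_mart h).
have bf m : bounded_measurable (f m) by exact: (adapted_bmf z0 lawW (F_adapted m)).
have Ef m : \int[P]_om f m om <= B ^+ 2 * ((m.+1 ^ 2)%N%:R)^-1.
  rewrite (adapted_expect z0 p_adapted lawW (F_adapted m)).
  set q := (m.+1 ^ 2)%N.
  have q0 : 0 < (q%:R : R) by rewrite ltr0n /q expn_gt0.
  have -> : (fun w => (mart q w / q%:R) ^+ 2) =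
      (fun w => q%:R ^- 2 * mart q w ^+ 2).
    by apply/funext => w; rewrite exprMn exprVn mulrC.
  rewrite wEZ; apply: (@le_trans _ _ (q%:R ^- 2 * (B ^+ 2 * q%:R))).
    apply: ler_wpM2l; last exact: mart_second_moment.
    by rewrite invr_ge0 exprn_ge0// ltW.
  rewrite (_ : q%:R ^- 2 * (B ^+ 2 * q%:R) = B ^+ 2 * q%:R^-1)//.
  by move: q0; move: (q%:R : R) => a a0; field; rewrite lt0r_neq0.
have mf m : measurable_fun setT (EFin \o f m) by apply/measurable_EFinP; exact: (bf m).1.
have intF : (\int[P]_om F om <= (B ^+ 2 * 2)%:E)%E.
  rewrite /F integral_nneseries//; last by move=> m om _; rewrite lee_fin.
  apply: lime_le.
    by apply: is_cvg_nneseries => m _ _; apply: integral_ge0 => om _; rewrite lee_fin.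
  apply: nearW => n.
  apply: (@le_trans _ _ (\sum_(0 <= m < n) (B ^+ 2 * ((m.+1 ^ 2)%N%:R)^-1)%:E)%E).
    apply: lee_sum => m _.
    have ifin : (\int[P]_om (f m om)%:E)%E \is a fin_num.
      by apply: integrable_fin_num => //; exact: (bmf_integrable P (bf m)).
    by rewrite -(fineK ifin) lee_fin; exact: Ef.
  rewrite sumEFin lee_fin -mulr_sumr ler_wpM2l ?sqr_ge0//.
  exact: sum_inv_square_le.
have mF : measurable_fun setT F.
  apply: (@ge0_emeasurable_sum _ _ _ setT (fun m om => (f m om)%:E) xpredT).
    by move=> k x _ _; rewrite lee_fin.
  by move=> k _; exact: mf.
have F0 om : (0 <= F om)%E by apply: nneseries_ge0 => m _ _; rewrite lee_fin.
have iF : P.-integrable setT F.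
  apply/integrableP; split => //.
  under eq_integral do rewrite gee0_abs//.
  by apply: (le_lt_trans intF); rewrite ltry.
apply: filterS (integrable_ae measurableT iF) => om /(_ I) Ffin.
have : cvgn (series (f ^~ om)).
  apply: nondecreasing_is_cvgn.
    by apply: nondecreasing_series => n _ _; exact: f0.
  exists (fine (F om)) => _ [n _ <-].
  rewrite -lee_fin fineK// /series/= -sumEFin.
  by apply: nneseries_lim_ge => m _ _; rewrite lee_fin.
move=> /cvg_series_cvg_0/cvgn0P h; apply/cvgn0P => e e0.
have [N hN] := h _ (exprn_gt0 2 e0).
exists N => n /hN; rewrite /f normrX.
by rewrite ler_pXn2r// ?nnegrE// ltW.
Qed.

Theorem martingale_lln : {ae P, forall om,
  (fun t : nat => mart t (W ^~ om) / t%:R) @ \oo --> (0 : R)}.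
Proof.
apply: filterS mart_squares_cvg => om.
apply: (cvg_average_squares (B := B)).
  exact: le_trans (normr_ge0 _) (D_le 0 (W ^~ om)).
by move=> t; rewrite /mart big_ord_recr/= addrAC subrr add0r.
Qed.

End MartingaleLLN.

(** * The predictor process *)

Section PdistFacts.
Context {R : realType} {X : finPointedType}.
Implicit Types p q : pdist R X.

Lemma pdist_ge0 p x : 0 <= p x.
Proof. by case: p => f /= /andP[/forallP]. Qed.

Lemma pdist_sum1 p : \sum_x p x = 1.
Proof. by case: p => f /= /andP[_ /eqP]. Qed.

Lemma pdist_le1 p x : p x <= 1.
Proof.
by rewrite -(pdist_sum1 p) (bigD1 x)//= lerDl sumr_ge0// => y _; exact: pdist_ge0.
Qed.

Lemma pdist_eq p q : (forall x, p x = q x) -> p = q.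
Proof. by move=> h; apply: val_inj; apply/ffunP. Qed.

Lemma bmf_eval x : bounded_measurable (fun p : pdist R X => p x).
Proof.
split; last first.
  by exists 1 => p; rewrite ger0_norm ?pdist_ge0// pdist_le1.
move=> _ A mA; rewrite setTI; apply: sub_sigma_algebra.
by exists x, A.
Qed.

Lemma measurable_to_pdist d (T : measurableType d) (f : T -> pdist R X) :
  (forall x, measurable_fun setT (fun t => f t x)) -> measurable_fun setT f.
Proof.
move=> mf; apply: (@measurability _ _ _ _ setT f (@pdist_cylinder R X)) => //.
move=> _ [_ [x [A [mA ->]]] <-]; exact: mf.
Qed.

Lemma measurable_pdist_set1 p : measurable [set p].
Proof.
have -> : [set p] = \bigcap_(x in [set: X]) [set q : pdist R X | [set p x] (q x)].
  apply/seteqP; split => [q -> //|q h]; apply: pdist_eq => x.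
  exact: h.
apply: fin_bigcap_measurable => // x _.
by apply: sub_sigma_algebra; exists x, [set p x].
Qed.

End PdistFacts.

Lemma bmf_comp {R : realType} d d' (T : measurableType d) (T' : measurableType d')
    (f : T -> T') (g : T' -> R) :
  measurable_fun setT f -> bounded_measurable g -> bounded_measurable (g \o f).
Proof.
move=> mf [mg [B gB]]; split; first exact: measurableT_comp.
by exists B => x; exact: gB.
Qed.

Section PredictorFacts.
Context {R : realType} {X U M : finPointedType}.
Variables (K : X -> U -> pdist R X) (c : X -> U -> R).
Local Notation S := (pdist R X).
Local Notation A := (act X U M).
Local Notation pm := (predictor_mdp M K c).
Implicit Types (p : S) (a : A).

Lemma cell_mass_ge0 p (Q : quantizer X M) q : 0 <= cell_mass p Q q.
Proof. by apply: sumr_ge0 => x _; exact: pdist_ge0. Qed.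

Lemma cell_mass_sum1 p (Q : quantizer X M) : \sum_q cell_mass p Q q = 1.
Proof.
rewrite -(pdist_sum1 p) [RHS](partition_big (fun x => Q x) xpredT)//=.
Qed.

Lemma cell_mass0 p (Q : quantizer X M) q x : cell_mass p Q q = 0 -> Q x = q -> p x = 0.
Proof.
move=> m0 Qx; apply/eqP; rewrite eq_le pdist_ge0 andbT -m0 /cell_mass.
rewrite (bigD1 x) ?Qx//= lerDl sumr_ge0// => y _; exact: pdist_ge0.
Qed.

(** Multiplied by the mass of the cell, the predictor becomes linear in p; on
    a null cell both sides vanish. *)
Lemma cell_mass_predF p (Q : quantizer X M) (eta : controller X U M) q x' :
  cell_mass p Q q * predF K p Q eta q x' =
  \sum_(x | Q x == q) K x (eta (Q, q)) x' * p x.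
Proof.
have [m0|m0] := eqVneq (cell_mass p Q q) 0.
  rewrite m0 mul0r big1// => x /eqP Qx.
  by rewrite (cell_mass0 m0 Qx) mulr0.
by rewrite predFE// mulrA mulfV// mul1r.
Qed.

Lemma predF_mass0 p (Q : quantizer X M) (eta : controller X U M) q :
  cell_mass p Q q = 0 -> predF K p Q eta q = p.
Proof.
move=> m0; apply: val_inj; rewrite /predF val_insubd.
case: ifPn => // /andP[_ /eqP]; rewrite m0 invr0.
rewrite big1 => [/eqP|x _]; first by rewrite eq_sym oner_eq0.
by rewrite ffunE mul0r.
Qed.

Lemma bmf_cell_mass (Q : quantizer X M) q :
  bounded_measurable (fun p : S => cell_mass p Q q).
Proof.
apply: (bmf_ext (f := fun p : S => \sum_x (Q x == q)%:R * p x)).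
  move=> p; rewrite /cell_mass [RHS]big_mkcond/=; apply: eq_bigr => x _.
  by case: ifP => _; rewrite ?mul1r ?mul0r.
by apply: bmf_sum => x; apply: bmfZ; exact: bmf_eval.
Qed.

(** On the cells of positive mass predF is a quotient of linear functions of
    p, with the inverse written as a real power; on null cells it is p itself. *)
Lemma measurable_predF (Q : quantizer X M) (eta : controller X U M) q :
  measurable_fun setT (fun p : S => predF K p Q eta q).
Proof.
apply: measurable_to_pdist => x'.
have mm := (bmf_cell_mass Q q).1.
have -> : (fun p : S => predF K p Q eta q x') = (fun p : S =>
    (cell_mass p Q q) `^ (-1) * (cell_mass p Q q * predF K p Q eta q x') +
    \1_((fun p : S => cell_mass p Q q) @^-1` [set 0]) p * p x').
  apply/funext => p; rewrite powR_inv1 ?cell_mass_ge0// indicE.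
  have [m0|m0] := eqVneq (cell_mass p Q q) 0.
    by rewrite mem_set// predF_mass0// m0 mul0r mulr0 add0r mul1r.
  rewrite mulKf// memNset ?mul0r ?addr0//; exact/eqP.
apply: measurable_funD; last first.
  apply: measurable_funM; last exact: (bmf_eval x').1.
  apply: measurable_indic; rewrite -[X in measurable X]setTI.
  exact: mm.
apply: measurable_funM.
  exact: (measurableT_comp (measurable_powR (-1)) mm).
have -> : (fun p : S => cell_mass p Q q * predF K p Q eta q x') =
    (fun p : S => \sum_x ((Q x == q)%:R * K x (eta (Q, q)) x') * p x).
  apply/funext => p; rewrite cell_mass_predF big_mkcond/=; apply: eq_bigr => x _.
  by case: ifP => _; rewrite ?mul1r ?mul0r.
apply: measurable_sum => x; apply: (bmfZ _ (bmf_eval x)).1.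
Qed.

Definition cost_bound : R := \sum_x \sum_u `|c x u|.

Lemma cost_bound_ge x u : `|c x u| <= cost_bound.
Proof.
rewrite /cost_bound (bigD1 x)//= (bigD1 u)//= -addrA lerDl addr_ge0//.
  by apply: sumr_ge0.
by apply: sumr_ge0 => y _; apply: sumr_ge0.
Qed.

Lemma pred_cost_le p a : `|pred_cost c p a| <= cost_bound.
Proof.
rewrite /pred_cost (le_trans (ler_norm_sum _ _ _))//.
rewrite -[leRHS]mul1r -(pdist_sum1 p) mulr_suml; apply: ler_sum => x _.
by rewrite normrM ger0_norm ?pdist_ge0// ler_wpM2l ?pdist_ge0// cost_bound_ge.
Qed.

Lemma bmf_pred_cost a : bounded_measurable (fun p : S => pred_cost c p a).
Proof.
apply: (bmf_ext (f := fun p : S => \sum_x c x (a.2 (a.1, a.1 x)) * p x)).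
  by move=> p; apply: eq_bigr => x _; rewrite mulrC.
by apply: bmf_sum => x; apply: bmfZ; exact: bmf_eval.
Qed.

Lemma card_act_gt0 : 0 < (#|{: A}|%:R : R).
Proof. by rewrite ltr0n; apply/card_gt0P; exists ([ffun=> point], [ffun=> point]). Qed.

Definition uniform_policy : policy pm := fun _ _ _ => (#|{: A}|%:R)^-1.

Lemma admissible_uniform : admissible uniform_policy.
Proof.
move=> h p; split => [a|]; first by rewrite invr_ge0 ltW// card_act_gt0.
rewrite /uniform_policy sumr_const -[LHS]mulr_natl mulfV// gt_eqF//; exact: card_act_gt0.
Qed.

Lemma predictor_weight_ge0 (p : state pm) (a : action pm) (z : noise pm) :
  0 <= weight p a z.
Proof. exact: cell_mass_ge0. Qed.

Lemma predictor_weight_sum1 (p : state pm) (a : action pm) :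
  \sum_z weight p a z = 1.
Proof. exact: cell_mass_sum1. Qed.

Section Bridge.
Variables (pi0 : S) (d : measure_display) (Omega : measurableType d).
Variables (P : probability Omega R) (x : nat -> Omega -> X) (a : nat -> Omega -> A).
Hypothesis run : exploration_run K pi0 P x a.

Definition observed (z : X * A) : A * M := (z.2, z.2.1 z.1).

(** The conditional law of the source state and the action at time k, given
    the earlier ones. *)
Definition source_law (w : nat -> X * A) (k : nat) (z : X * A) : R :=
  (if k is j.+1 then K (w j).1 ((w j).2.2 ((w j).2.1, (w j).2.1 (w j).1)) z.1
   else pi0 z.1) * (#|{: A}|%:R)^-1.

Lemma adapted_source_law t : adapted t (fun w => source_law w t).
Proof. by case: t => [//|t] w w' h; apply/funext => z; rewrite /source_law h. Qed.

Lemma source_has_law : has_law source_law P (fun k om => (x k om, a k om)).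
Proof.
move=> [|t] w.
  have -> : cylinder (fun k om => (x k om, a k om)) 0 w = setT by apply/seteqP.
  by rewrite /word_prob big_ord0; split => //; exact: probability_setT.
have [mE PE] := run t (fun k => (w k).1) (fun k => (w k).2).
have -> : cylinder (fun k om => (x k om, a k om)) t.+1 w =
    [set om | forall k, (k <= t)%N -> x k om = (w k).1 /\ a k om = (w k).2].
  apply/seteqP; split => om h k kt; have := h k kt; case: (w k) => y b /=.
    by case=> -> ->.
  by case=> -> ->.
split=> //; rewrite PE; congr EFin.
rewrite /word_prob big_ord_recl [source_law _ _ _]/= /source_law/=.
rewrite big_split/= prodr_const card_ord exprS.
by rewrite -!mulrA; congr (_ * _); rewrite mulrCA.
Qed.

Lemma sum_observed (v : A * M) (F : X -> R) (G : X * A -> R) :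
  (forall y, v.1.1 y = v.2 -> G (y, v.1) = F y) ->
  \sum_z (observed z == v)%:R * G z = \sum_(y | v.1.1 y == v.2) F y.
Proof.
case: v => b q /= GF.
transitivity (\sum_y \sum_b' (observed (y, b') == (b, q))%:R * G (y, b')).
  by rewrite pair_big/=; apply: eq_bigr => -[].
rewrite [RHS]big_mkcond/=; apply: eq_bigr => y _.
rewrite (bigD1 b)//= big1 ?addr0 => [|b' bb'].
  rewrite /observed /= xpair_eqE eqxx /=; case: ifP => [/eqP e|_].
    by rewrite mul1r GF.
  by rewrite mul0r.
by rewrite /observed /= xpair_eqE (negbTE bb') mul0r.
Qed.

Definition matches (v : nat -> A * M) (t : nat) (w : nat -> X * A) : R :=
  \prod_(k < t) (observed (w k) == v k)%:R.

Lemma adapted_matches v t : adapted t (matches v t).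
Proof. by move=> w w' h; apply: eq_bigr => -[k kt] _ /=; rewrite h. Qed.

(** The filtering identity: given the observed actions and symbols before
    time t, the source at time t has the predictor as its law, and the action is
    uniform and independent of it. Here the hidden source is integrated out. *)
Lemma filter_law (z0 : X * A) (v : nat -> A * M) t (f : X * A -> R) :
  wE z0 source_law t.+1 (fun w => matches v t w * f (w t)) =
  word_prob (mdp_law uniform_policy pi0) t v *
  \sum_z (state_at (m := pm) pi0 v t : S) z.1 * (#|{: A}|%:R)^-1 * f z.
Proof.
elim: t f => [|t IH] f.
  rewrite /= /word_prob big_ord0 mul1r; apply: eq_bigr => z _.
  by rewrite /matches big_ord0 mul1r /upd eqxx.
set g := fun y : X * A => (observed y == v t)%:R *
  \sum_z K y.1 (y.2.2 (y.2.1, y.2.1 y.1)) z.1 * (#|{: A}|%:R)^-1 * f z.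
transitivity (wE z0 source_law t.+1 (fun w => matches v t w * g (w t))).
  change (wE z0 source_law t.+1 (fun w => \sum_z source_law w t.+1 z *
    (matches v t.+1 (upd w t.+1 z) * f (upd w t.+1 z t.+1))) =
    wE z0 source_law t.+1 (fun w => matches v t w * g (w t))).
  congr wE; apply/funext => w; rewrite /g mulrA mulr_sumr.
  apply: eq_bigr => z _.
  rewrite {1}/source_law (adapted_matches v (agree_upd w z (leqnn t.+1))).
  by rewrite /upd eqxx /matches big_ord_recr/= mulrCA.
rewrite IH word_probS -mulrA; congr (_ * _).
rewrite {1}/mdp_law /uniform_policy /=.
set n := (#|_|%:R)^-1 : R; set b := (v t).1; set q := (v t).2.
set p : S := state_at (m := pm) pi0 v t.
transitivity (\sum_(y | b.1 y == q) p y * n *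
    \sum_z K y (b.2 (b.1, q)) z.1 * n * f z).
  transitivity (\sum_z (observed z == v t)%:R * (p z.1 * n *
      \sum_z' K z.1 (z.2.2 (z.2.1, z.2.1 z.1)) z'.1 * n * f z')).
    by apply: eq_bigr => z _; rewrite /g mulrCA.
  by apply: sum_observed => y /= e; rewrite -/b e -/q.
transitivity (\sum_(y | b.1 y == q) \sum_z p y * n * (K y (b.2 (b.1, q)) z.1 * n * f z)).
  by apply: eq_bigr => y _; rewrite mulr_sumr.
rewrite exchange_big/= mulr_sumr; apply: eq_bigr => z _.
transitivity (n * (n * f z) * (cell_mass p b.1 q * predF K p b.1 b.2 q z.1)).
  by rewrite cell_mass_predF mulr_sumr; apply: eq_bigr => y _; ring.
ring.
Qed.

Definition observation (k : nat) (om : Omega) : A * M :=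
  (a k om, (a k om).1 (x k om)).

(** The observed pairs of actions and symbols are a trajectory of the
    predictor MDP under the uniform policy. *)
Theorem exploration_law : has_law (mdp_law uniform_policy pi0) P observation.
Proof.
move=> t v; pose z0 : X * A := (point, ([ffun=> point], [ffun=> point])).
have ind om : \1_(cylinder observation t v) om =
    matches v t (fun k => (x k om, a k om)).
  rewrite indicE; have [h|h] := pselect (cylinder observation t v om).
    rewrite mem_set// /matches big1// => -[k kt] _ /=.
    by rewrite -(h k kt) eqxx.
  rewrite memNset//; apply/esym.
  have /existsNP[k /not_implyP[kt /eqP ne]] := h.
  by rewrite /matches (bigD1 (Ordinal kt))//= (negbTE ne) mul0r.
have aM : adapted t.+1 (matches v t) by exact: (adaptedW (leqnSn t) (@adapted_matches v t)).
have bM := adapted_bmf z0 source_has_law aM.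
have mC : measurable (cylinder observation t v).
  apply/(measurable_indicP R); move: bM => [bM _].
  by move: bM; congr (measurable_fun setT _); apply/funext => om; rewrite ind.
split=> //.
have Pfin : P (cylinder observation t v) \is a fin_num by exact: fin_num_measure.
rewrite -(fineK Pfin); congr EFin; rewrite -expect_indic//.
under eq_Rintegral do rewrite ind.
rewrite (adapted_expect z0 adapted_source_law source_has_law aM).
have := filter_law z0 v t (fun=> 1).
under [X in wE _ _ _ X = _]funext do rewrite mulr1.
move=> ->; rewrite -[RHS]mulr1; congr (_ * _).
under eq_bigr do rewrite mulr1.
rewrite -(pair_big xpredT xpredT (fun y _ => (state_at (m := pm) pi0 v t : S) y * _))/=.
rewrite -[RHS](pdist_sum1 (state_at (m := pm) pi0 v t)).
apply: eq_bigr => y _; rewrite -mulr_sumr.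
by rewrite (admissible_uniform [::] pi0).2 mulr1.
Qed.

Lemma belief_state_at om t :
  belief K pi0 (x ^~ om) (a ^~ om) t = state_at (m := pm) pi0 (observation ^~ om) t.
Proof. by elim: t => [//|t IH] /=; rewrite IH. Qed.

End Bridge.
End PredictorFacts.
Arguments uniform_policy {R X U M} K c.
Arguments predictor_weight_ge0 {R X U M} K c.
Arguments predictor_weight_sum1 {R X U M} K c.

(** * Markov operators and the approximate Poisson equation *)

Section MarkovOperators.
Context {R : realType} {S : Type}.
Implicit Types (f g h : S -> R) (Q : (S -> R) -> S -> R).

Definition norm_bounded f := exists B : R, forall s, `|f s| <= B.

(** Kernels act here on all real functions, measurable or not, which makes
    sense because each transition has finitely many outcomes. *)
Definition markov_operator Q :=
  [/\ forall f g s, Q (fun x => f x + g x) s = Q f s + Q g s,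
      forall r f s, Q (fun x => r * f x) s = r * Q f s,
      forall f g, (forall x, f x <= g x) -> forall s, Q f s <= Q g s &
      forall r s, Q (fun=> r) s = r].

Lemma markov_iter Q i : markov_operator Q -> markov_operator (iter i Q).
Proof.
move=> mQ; have [QD QZ Qle Qc] := mQ; elim: i => [|i [ID IZ Ile Ic]].
  by split => // f g fg s; exact: fg.
split => [f g s|r f s|f g fg s|r s] /=.
- by rewrite -QD; congr (Q _ s); apply/funext => x; exact: ID.
- by rewrite -QZ; congr (Q _ s); apply/funext => x; exact: IZ.
- by apply: Qle => x; exact: Ile.
- by rewrite -[RHS](Qc r s); congr (Q _ s); apply/funext => x; exact: Ic.
Qed.

Lemma markov_average (Q : nat -> (S -> R) -> S -> R) N : (0 < N)%N ->
  (forall i, markov_operator (Q i)) ->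
  markov_operator (fun f s => N%:R^-1 * \sum_(i < N) Q i f s).
Proof.
move=> N0 mQ.
have N0' : 0 < N%:R^-1 :> R by rewrite invr_gt0 ltr0n.
split => [f g s|r f s|f g fg s|r s].
- rewrite -mulrDr -big_split/=; congr (_ * _); apply: eq_bigr => i _.
  by have [-> _ _ _] := mQ i.
- rewrite [RHS]mulrCA [X in _ = _ * X]mulr_sumr; congr (_ * _); apply: eq_bigr => i _.
  by have [_ -> _ _] := mQ i.
- rewrite ler_wpM2l ?(ltW N0')//; apply: ler_sum => i _.
  by have [_ _ h _] := mQ i; exact: h.
- rewrite (eq_bigr (fun=> r)); last by move=> i _; have [_ _ _ ->] := mQ i.
  by rewrite sumr_const card_ord -[r *+ _]mulr_natl mulKf// pnatr_eq0 -lt0n.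
Qed.

Lemma markov_bounds Q f lo hi : markov_operator Q ->
  (forall s, lo <= f s <= hi) -> forall s, lo <= Q f s <= hi.
Proof.
move=> [_ _ Qle Qc] fb s; rewrite -{1}(Qc lo s) -{1}(Qc hi s).
by rewrite !Qle// => x; have /andP[] := fb x.
Qed.

Lemma markov_norm_le Q f B : markov_operator Q ->
  (forall s, `|f s| <= B) -> forall s, `|Q f s| <= B.
Proof.
move=> mQ fB s; rewrite ler_norml; apply: markov_bounds => // x.
by rewrite -ler_norml.
Qed.

Lemma markovB Q f g s : markov_operator Q ->
  Q (fun x => f x - g x) s = Q f s - Q g s.
Proof.
move=> [QD QZ _ _]; rewrite -[X in _ = _ + X]mulN1r -QZ -QD; congr (Q _ s).
by apply/funext => x; rewrite mulN1r.
Qed.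

Lemma markov_sumZ Q n r (F : nat -> S -> R) s : markov_operator Q ->
  Q (fun x => \sum_(i < n) r * F i x) s = \sum_(i < n) r * Q (F i) s.
Proof.
move=> [QD QZ _ Qc]; elim: n => [|n IH].
  rewrite big_ord0 -[RHS](Qc 0 s); congr (Q _ s).
  by apply/funext => x; rewrite big_ord0.
rewrite big_ord_recr/= -IH -QZ -QD; congr (Q _ s).
by apply/funext => x; rewrite big_ord_recr.
Qed.

Section Coboundary.
Variable P : (S -> R) -> S -> R.
Hypothesis mP : markov_operator P.

(** Along a trajectory a coboundary has bounded sums, up to a martingale. *)
Definition coboundary f := exists2 H, norm_bounded H & forall s, f s = H s - P H s.

Lemma coboundary_ext f g : f =1 g -> coboundary f -> coboundary g.
Proof. by move=> fg [H bH e]; exists H => // s; rewrite -fg. Qed.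

Lemma coboundary0 : coboundary (fun=> 0).
Proof.
have [_ _ _ Pc] := mP.
exists (fun=> 0); first by exists 0 => s; rewrite normr0.
by move=> s; rewrite Pc subrr.
Qed.

Lemma coboundaryD f g : coboundary f -> coboundary g ->
  coboundary (fun s => f s + g s).
Proof.
have [PD _ _ _] := mP.
move=> [H1 [B1 b1] e1] [H2 [B2 b2] e2]; exists (fun s => H1 s + H2 s).
  by exists (B1 + B2) => s; rewrite (le_trans (ler_normD _ _)) ?lerD.
by move=> s; rewrite e1 e2 PD opprD addrACA.
Qed.

Lemma coboundaryZ r f : coboundary f -> coboundary (fun s => r * f s).
Proof.
have [_ PZ _ _] := mP.
move=> [H [B b] e]; exists (fun s => r * H s).
  by exists (`|r| * B) => s; rewrite normrM ler_wpM2l.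
by move=> s; rewrite e PZ mulrBr.
Qed.

Lemma coboundary_sum n (F : nat -> S -> R) : (forall i, coboundary (F i)) ->
  coboundary (fun s => \sum_(i < n) F i s).
Proof.
move=> cF; elim: n => [|n IH].
  by apply: coboundary_ext coboundary0 => s; rewrite big_ord0.
apply: coboundary_ext (coboundaryD IH (cF n)) => s.
by rewrite big_ord_recr.
Qed.

Lemma coboundary_iter i f : norm_bounded f ->
  coboundary (fun s => f s - iter i P f s).
Proof.
move=> [B fB]; elim: i => [|i IH].
  by apply: coboundary_ext coboundary0 => s; rewrite subrr.
apply: (coboundary_ext (f := fun s => (f s - iter i P f s) +
    (iter i P f s - P (iter i P f) s))); first by move=> s /=; rewrite subrKA.
apply: coboundaryD => //; exists (iter i P f) => //.
by exists B; apply: markov_norm_le => //; exact: markov_iter.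
Qed.

Variables (N : nat) (s0 : S) (eps : R).
Hypothesis N_gt0 : (0 < N)%N.
Hypothesis eps01 : 0 < eps <= 1.

(** An average over N steps, because the number of steps needed to reach
    the atom s0 depends on the starting point. *)
Definition average_operator f s := N%:R^-1 * \sum_(i < N) iter i.+1 P f s.

Hypothesis minorized : forall s, eps <= average_operator \1_[set s0] s.

Lemma markov_average_operator : markov_operator average_operator.
Proof.
exact: (markov_average N_gt0 (fun i => markov_iter i.+1 mP)).
Qed.

Lemma coboundary_average f : norm_bounded f ->
  coboundary (fun s => f s - average_operator f s).
Proof.
move=> bf; apply: (coboundary_ext (f := fun s =>
    N%:R^-1 * \sum_(i < N) (f s - iter i.+1 P f s))).
  move=> s; rewrite sumrB mulrBr; congr (_ - _).
  by rewrite sumr_const card_ord -[f s *+ _]mulr_natl mulKf// pnatr_eq0 -lt0n.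
apply: coboundaryZ; apply: (@coboundary_sum N (fun i s => f s - iter i.+1 P f s)).
by move=> i; exact: coboundary_iter.
Qed.

Lemma coboundary_iter_average m f : norm_bounded f ->
  coboundary (fun s => f s - iter m average_operator f s).
Proof.
move=> bf; have [B fB] := bf; elim: m => [|m IH].
  by apply: coboundary_ext coboundary0 => s; rewrite subrr.
apply: (coboundary_ext (f := fun s => (f s - iter m average_operator f s) +
    (iter m average_operator f s - average_operator (iter m average_operator f) s))).
  by move=> s /=; rewrite subrKA.
apply: coboundaryD => //; apply: coboundary_average.
exists B; apply: (markov_norm_le (Q := iter m average_operator)) => //.
exact: (markov_iter m markov_average_operator).
Qed.

(** Doeblin's argument: each averaged value gives weight at least eps to
    f s0, so both bounds move towards f s0 by this proportion. *)
Lemma average_contracts f lo hi : (forall s, lo <= f s <= hi) ->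
  exists lo' hi', (forall s, lo' <= average_operator f s <= hi') /\
    hi' - lo' = (1 - eps) * (hi - lo).
Proof.
move=> fb; have [AD AZ Ale Ac] := markov_average_operator.
have /andP[lof fhi] := fb s0.
exists (lo + eps * (f s0 - lo)), (hi - eps * (hi - f s0)); split; last by ring.
move=> s; apply/andP; split.
  apply: (@le_trans _ _ (lo + (f s0 - lo) * average_operator \1_[set s0] s)).
    by rewrite lerD2l mulrC ler_wpM2l// subr_ge0.
  rewrite -AZ -{1}(Ac lo s) -AD; apply: Ale => x.
  rewrite indicE; have [->|xs] := pselect (x = s0).
    by rewrite mem_set// mulr1 subrKC.
  by rewrite memNset// mulr0 addr0; have /andP[] := fb x.
apply: (@le_trans _ _ (hi + (f s0 - hi) * average_operator \1_[set s0] s)).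
  rewrite -AZ -{1}(Ac hi s) -AD; apply: Ale => x.
  rewrite indicE; have [->|xs] := pselect (x = s0).
    by rewrite mem_set// mulr1 subrKC.
  by rewrite memNset// mulr0 addr0; have /andP[] := fb x.
rewrite lerD2l -mulrN opprB mulrC ler_wnM2r// subr_le0//.
Qed.

Lemma average_iter_contracts f lo hi m : (forall s, lo <= f s <= hi) ->
  exists lo' hi', (forall s, lo' <= iter m average_operator f s <= hi') /\
    hi' - lo' = (1 - eps) ^+ m * (hi - lo).
Proof.
move=> fb; elim: m => [|m [lo' [hi' [h e]]]].
  by exists lo, hi; rewrite expr0 mul1r.
have [lo2 [hi2 [h2 e2]]] := average_contracts h.
by exists lo2, hi2; split => //; rewrite e2 e exprS mulrA.
Qed.

(** Up to a coboundary f is an iterate of the averaging operator, whose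
    range lies with ell in an interval of length (1 - eps) ^+ m * (2 * B). *)
Lemma approximate_poisson f B ell delta : (forall s, `|f s| <= B) ->
  (forall m lo hi, (forall s, lo <= iter m average_operator f s <= hi) ->
    lo <= ell <= hi) -> 0 < delta ->
  exists2 H, norm_bounded H & forall s, `|f s - ell - (H s - P H s)| <= delta.
Proof.
move=> fB hl d0.
have fb s : - B <= f s <= B by rewrite -ler_norml.
have c0 : (fun m => (1 - eps) ^+ m * (B - - B)) @ \oo --> (0 : R).
  rewrite -[X in _ --> X](mul0r (B - - B)); apply: cvgMl.
  apply: cvg_expr; have /andP[e0 e1] := eps01.
  by rewrite ger0_norm ?subr_ge0// gtrBl.
have /cvgn0P/(_ _ d0)[m /(_ m (leqnn m)) hm] := c0.
have [lo [hi [h e]]] := average_iter_contracts m fb.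
have [H bH eH] := coboundary_iter_average m (ex_intro _ B fB : norm_bounded f).
exists H => // s; rewrite -eH.
have /andP[l1 l2] := hl m lo hi h.
have /andP[s1 s2] := h s.
rewrite -e in hm; have hm' := le_trans (ler_norm _) hm.
rewrite ler_norml; lra.
Qed.

End Coboundary.
End MarkovOperators.

(** * One step of exploration *)

Section StaircaseApproximation.
Context {R : realType}.

Lemma staircase_count (y : R) N : 0 <= y <= N%:R ->
  `|y - \sum_(j < N) (j.+1%:R <= y)%R%:R| <= 1.
Proof.
move=> /andP[y0 yN].
have le_n n : \sum_(j < n) (j.+1%:R <= y)%R%:R <= (n%:R : R).
  rewrite -[n in leRHS]card_ord -sum1_card natr_sum; apply: ler_sum => j _.
  by case: (_ <= y).
have h n : \sum_(j < n) (j.+1%:R <= y)%R%:R <= y /\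
    (\sum_(j < n) (j.+1%:R <= y)%R%:R = (n%:R : R) \/
     y < \sum_(j < n) (j.+1%:R <= y)%R%:R + 1).
  elim: n => [|n [IH1 IH2]]; first by rewrite big_ord0; split=> //; left.
  rewrite big_ord_recr/=; case: IH2 => [e|lt].
    rewrite e; have [le|lt] := leP (n.+1%:R : R) y.
      by rewrite natr1; split => //; left.
    by rewrite addr0 -e; split => //; right; rewrite e natr1.
  have [le|lt'] := leP (n.+1%:R : R) y.
    have := lt_le_trans (le_lt_trans le lt) (lerD (le_n n) (lexx 1)).
    by rewrite natr1 ltxx.
  by rewrite addr0; split => //; right.
have [h1 h2] := h N.
rewrite ger0_norm ?subr_ge0// lerBlDl; case: h2 => [->|/ltW]; last by [].
by rewrite (le_trans yN)// lerDl.
Qed.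

(** Staircases approximate bounded functions uniformly by combinations of
    indicators of level sets. *)
Lemma staircase (B : R) N (y : R) : 0 < B -> (0 < N)%N -> `|y| <= B ->
  `|y - (- B + \sum_(j < N) 2 * B / N%:R * (- B + 2 * B / N%:R * j.+1%:R <= y)%R%:R)|
    <= 2 * B / N%:R.
Proof.
move=> B0 N0 yB.
have NR0 : 0 < (N%:R : R) by rewrite ltr0n.
set s := 2 * B / N%:R; have s0 : 0 < s by rewrite divr_gt0// mulr_gt0.
have sN : s * N%:R = 2 * B by rewrite /s divfK// gt_eqF.
have yb : 0 <= (y + B) / s <= N%:R.
  move: yB; rewrite ler_norml => /andP[y1 y2].
  by rewrite divr_ge0 ?(ltW s0)//= ?ler_pdivrMr// 1?mulrC ?sN; lra.
have -> : y - (- B + \sum_(j < N) s * (- B + s * j.+1%:R <= y)%R%:R) =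
    s * ((y + B) / s - \sum_(j < N) (j.+1%:R <= (y + B) / s)%R%:R).
  rewrite mulrBr mulrCA mulfV ?gt_eqF// mulr1 opprD opprK addrA; congr (_ - _).
  rewrite mulr_sumr; apply: eq_bigr => j _; congr (_ * _); congr (nat_of_bool _)%:R.
  by rewrite ler_pdivlMr// [in RHS]mulrC addrC lerBlDr.
rewrite normrM (gtr0_norm s0) -[leRHS]mulr1 ler_wpM2l ?(ltW s0)//.
exact: staircase_count.
Qed.

End StaircaseApproximation.

Lemma finite_lower_bound {R : realType} {X : finType} (e : X -> R) :
  (forall x, 0 < e x) -> exists2 delta, 0 < delta & forall x, delta <= e x.
Proof.
move=> e0; exists (1 + \sum_x (e x)^-1)^-1.
  by rewrite invr_gt0 ltr_pwDl// sumr_ge0// => x _; rewrite invr_ge0 ltW.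
move=> x; rewrite -[leRHS]invrK lef_pV2 ?posrE ?invr_gt0//; last first.
  by rewrite ltr_pwDl// sumr_ge0// => y _; rewrite invr_ge0 ltW.
rewrite (bigD1 x)//= addrCA lerDl addr_ge0// sumr_ge0// => y _.
by rewrite invr_ge0 ltW.
Qed.

Lemma indic_ge0_le1 {R : realType} {T : Type} (D : set T) x : 0 <= (\1_D x : R) <= 1.
Proof. by rewrite indicE; case: (x \in D); rewrite /= ?ler01 lexx. Qed.

Lemma indic_nneg {R : realType} {T : Type} (D : set T) x : 0 <= (\1_D x : R).
Proof. by have /andP[] := indic_ge0_le1 (R := R) D x. Qed.

Section Exploration.
Context {R : realType} {X U M : finPointedType}.
Variables (K : X -> U -> pdist R X) (c : X -> U -> R).
Local Notation S := (pdist R X).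
Local Notation A := (act X U M).
Local Notation pm := (predictor_mdp M K c).
Implicit Types (p : S) (a : A).

Definition step_mean (G : S -> R) p a : R :=
  \sum_q cell_mass p a.1 q * G (predF K p a.1 a.2 q).

Definition expl_mean (G : S -> A -> S -> R) p : R :=
  (#|{: A}|%:R)^-1 * \sum_a step_mean (G p a) p a.

Definition expl_op (h : S -> R) : S -> R := expl_mean (fun _ _ => h).

Let inv_card_gt0 : 0 < (#|{: A}|%:R)^-1 :> R.
Proof. by rewrite invr_gt0; exact: card_act_gt0. Qed.

Lemma step_mean_cst r p a : step_mean (fun=> r) p a = r.
Proof. by rewrite /step_mean -mulr_suml cell_mass_sum1 mul1r. Qed.

Lemma le_step_mean G H p a : (forall p', G p' <= H p') ->
  step_mean G p a <= step_mean H p a.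
Proof.
by move=> GH; apply: ler_sum => q _; rewrite ler_wpM2l ?cell_mass_ge0.
Qed.

Lemma expl_mean_cst r p : expl_mean (fun _ _ _ => r) p = r.
Proof.
rewrite /expl_mean (eq_bigr (fun=> r)); last by move=> a _; exact: step_mean_cst.
by rewrite sumr_const -[r *+ _]mulr_natl mulKf// gt_eqF// card_act_gt0.
Qed.

Lemma le_expl_mean G H p : (forall p a p', G p a p' <= H p a p') ->
  expl_mean G p <= expl_mean H p.
Proof.
move=> GH; rewrite ler_wpM2l ?(ltW inv_card_gt0)//; apply: ler_sum => a _.
exact: le_step_mean.
Qed.

Lemma expl_meanD G H p : expl_mean (fun p a p' => G p a p' + H p a p') p =
  expl_mean G p + expl_mean H p.
Proof.
rewrite /expl_mean -mulrDr -big_split/=; congr (_ * _); apply: eq_bigr => a _.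
by rewrite /step_mean -big_split/=; apply: eq_bigr => q _; rewrite mulrDr.
Qed.

Lemma expl_meanZ r G p : expl_mean (fun p a p' => r * G p a p') p =
  r * expl_mean G p.
Proof.
rewrite /expl_mean [RHS]mulrCA [X in _ = _ * X]mulr_sumr; congr (_ * _).
apply: eq_bigr => a _.
by rewrite /step_mean mulr_sumr; apply: eq_bigr => q _; rewrite mulrCA.
Qed.

Lemma markov_expl_op : markov_operator expl_op.
Proof.
split => [f g p|r f p|f g fg p|r p]; rewrite /expl_op.
- exact: expl_meanD.
- exact: expl_meanZ.
- exact: le_expl_mean.
- exact: expl_mean_cst.
Qed.

Lemma bmf_step_mean (G : S -> R) a : bounded_measurable G ->
  bounded_measurable (fun p => step_mean G p a).
Proof.
move=> bG; apply: bmf_sum => q; apply: bmfM; first exact: bmf_cell_mass.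
exact: (bmf_comp (measurable_predF K a.1 a.2 q) bG).
Qed.

Lemma bmf_expl_op h : bounded_measurable h -> bounded_measurable (expl_op h).
Proof. by move=> bh; apply: bmfZ; apply: bmf_sum => a; exact: bmf_step_mean. Qed.

Lemma expl_op_single (h : S -> R) p a : (forall p', 0 <= h p') ->
  (#|{: A}|%:R)^-1 * step_mean h p a <= expl_op h p.
Proof.
move=> h0; rewrite ler_wpM2l ?(ltW inv_card_gt0)//.
rewrite [leRHS](bigD1 a)//= lerDl; apply: sumr_ge0 => b _.
by apply: sumr_ge0 => q _; rewrite mulr_ge0 ?cell_mass_ge0.
Qed.

Definition const_controller (u : U) : controller X U M := [ffun=> u].

(** Regeneration. When Q isolates x0 and its symbol q is received, the next
    predictor is K x0 u, whatever the past. From p this happens with probability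
    at least p x0 over the number of actions, and irreducibility under the
    constant action u brings mass to x0 from any starting point. So K x0 u
    is an atom in the sense of Doeblin. *)
Lemma minorization (u : U) (Q : quantizer X M) (x0 : X) (q : M) :
  [set y | Q y = q] = [set x0] ->
  irreducible_chain (fun x y => K x u y) ->
  exists N eps, [/\ (0 < N)%N, 0 < eps <= 1 &
    forall p, eps <= average_operator expl_op N \1_[set K x0 u] p].
Proof.
move=> cellE irr; pose n := (#|{: A}|%:R)^-1 : R.
have n0 : 0 < n by exact: inv_card_gt0.
have [_ _ Pmono _] := markov_expl_op; have [_ PZ _ _] := markov_expl_op.
have Qx0 : Q x0 = q by have : [set x0] x0 by []; rewrite -cellE.
have Qx y : Q y == q = (y == x0).
  apply/eqP/eqP => [h|->//]; have : [set y | Q y = q] y by [].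
  by rewrite cellE.
pose b : A := (Q, const_controller u).
have one p : n * p x0 <= expl_op \1_[set K x0 u] p.
  apply: le_trans (expl_op_single p b _); last first.
    by move=> p'; exact: indic_nneg.
  rewrite ler_wpM2l ?(ltW n0)// /step_mean (bigD1 q)//= -[leLHS]addr0; apply: lerD.
    have cm : cell_mass p Q q = p x0.
      by rewrite /cell_mass (eq_bigl (pred1 x0)) ?big_pred1_eq.
    have [p0|p0] := eqVneq (p x0) 0.
      by rewrite p0 mulr_ge0 ?cell_mass_ge0// indic_nneg.
    rewrite cm indicE mem_set ?mulr1//=; apply: pdist_eq => y.
    rewrite predFE cm// (eq_bigl (pred1 x0))// big_pred1_eq mulrCA mulVf// mulr1.
    by rewrite ffunE.
  by apply: sumr_ge0 => z _; rewrite mulr_ge0 ?cell_mass_ge0// indic_nneg.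
have iterate i p : n ^+ i * \sum_x p x * nstep (fun x y => K x u y) i x x0 <=
    iter i expl_op (fun p => p x0) p.
  elim: i p => [|i IH] p /=.
    rewrite expr0 mul1r (bigD1 x0)//= eqxx mulr1 big1 ?addr0// => x xx0.
    by rewrite (negbTE xx0) mulr0.
  apply: (@le_trans _ _ (expl_op (fun p => n ^+ i *
      \sum_x p x * nstep (fun x y => K x u y) i x x0) p)); last exact: Pmono.
  rewrite PZ exprSr -mulrA ler_wpM2l ?exprn_ge0 ?(ltW n0)//.
  have nst x y : 0 <= nstep (fun x y => K x u y) i x y.
    elim: i x {IH} => [|i IHi] x /=; first exact: ler0n.
    by apply: sumr_ge0 => z _; rewrite mulr_ge0 ?pdist_ge0.
  apply: le_trans (expl_op_single p b _); last first.
    by move=> p'; apply: sumr_ge0 => x _; rewrite mulr_ge0 ?pdist_ge0.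
  rewrite ler_wpM2l ?(ltW n0)// /step_mean le_eqVlt; apply/orP; left; apply/eqP.
  transitivity (\sum_z \sum_x' (cell_mass p Q z * predF K p Q (const_controller u) z x') *
      nstep (fun x y => K x u y) i x' x0); last first.
    apply: eq_bigr => z _; rewrite mulr_sumr; apply: eq_bigr => x' _.
    by rewrite mulrA.
  rewrite exchange_big/=.
  transitivity (\sum_x' \sum_x p x * (K x u x' * nstep (fun x y => K x u y) i x' x0)).
    rewrite exchange_big/=; apply: eq_bigr => x _; rewrite mulr_sumr.
    by apply: eq_bigr.
  apply: eq_bigr => x' _; rewrite (partition_big (fun x => Q x) xpredT)//=.
  apply: eq_bigr => z _; rewrite cell_mass_predF mulr_suml; apply: eq_bigr => x _.
  by rewrite ffunE mulrA; congr (_ * _); rewrite mulrC.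
have hit i p : n ^+ i.+1 * \sum_x p x * nstep (fun x y => K x u y) i x x0 <=
    iter i.+1 expl_op \1_[set K x0 u] p.
  rewrite iterSr; have [_ iZ imono _] := markov_iter i markov_expl_op.
  apply: le_trans (imono (fun p => n * p x0) _ one p).
  by rewrite iZ exprS -mulrA ler_wpM2l ?(ltW n0).
have [t ht] := choice (fun x => irr x x0).
have e0 x : 0 < n ^+ (t x).+1 * nstep (fun x y => K x u y) (t x) x x0.
  by rewrite mulr_gt0 ?exprn_gt0.
have [delta d0 hd] := finite_lower_bound e0.
pose N := (\max_x t x).+1.
have tN x : (t x < N)%N by rewrite ltnS; exact: leq_bigmax.
have nst i x y : 0 <= nstep (fun x y => K x u y) i x y.
  elim: i x => [|i IHi] x /=; first exact: ler0n.
  by apply: sumr_ge0 => z _; rewrite mulr_ge0 ?pdist_ge0.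
have bound p : N%:R^-1 * delta <= average_operator expl_op N \1_[set K x0 u] p.
  rewrite /average_operator ler_wpM2l ?invr_ge0//.
  apply: (@le_trans _ _ (\sum_(i < N) n ^+ i.+1 *
      \sum_x p x * nstep (fun x y => K x u y) i x x0)); last exact: ler_sum.
  under eq_bigr do rewrite mulr_sumr.
  rewrite exchange_big/= -[leLHS]mul1r -(pdist_sum1 p) mulr_suml.
  apply: ler_sum => x _.
  rewrite (bigD1 (Ordinal (tN x)))//= -[leLHS]addr0 mulrCA; apply: lerD.
    by rewrite ler_wpM2l ?pdist_ge0.
  apply: sumr_ge0 => i _.
  by rewrite !mulr_ge0 ?exprn_ge0 ?(ltW n0) ?pdist_ge0.
exists N, (N%:R^-1 * delta); split => //.
rewrite mulr_gt0 ?invr_gt0 ?ltr0n//= (le_trans (bound (K x0 u)))//.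
have mA := markov_average_operator markov_expl_op (isT : (0 < N)%N).
by have /andP[_ ->] := markov_bounds mA (indic_ge0_le1 [set K x0 u]) (K x0 u).
Qed.

End Exploration.

(** * The ergodic theorem under exploration *)

Section ErgodicTheorem.
Context {R : realType} {X U M : finPointedType}.
Variables (K : X -> U -> pdist R X) (c : X -> U -> R).
Local Notation S := (pdist R X).
Local Notation A := (act X U M).
Local Notation pm := (predictor_mdp M K c).
Variable lam : probability S R.
Hypothesis lam_inv : exploration_invariant M K c lam.

Lemma invariant_indic (D : set S) : measurable D ->
  \int[lam]_p expl_op (U := U) (M := M) K \1_D p = \int[lam]_p (\1_D p : R).
Proof.
by move=> mD; rewrite expect_indic// (lam_inv mD).
Qed.

(** Invariance on sets extends to bounded functions through staircases. *)
Theorem invariant_expect (g : S -> R) : bounded_measurable g ->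
  \int[lam]_p expl_op (U := U) (M := M) K g p = \int[lam]_p g p.
Proof.
move=> bg; have [mg [B0 gB0]] := bg.
pose B := `|B0| + 1.
have B_gt0 : 0 < B by rewrite ltr_pwDr.
have gB p : `|g p| <= B.
  by rewrite (le_trans (gB0 p))// (le_trans (ler_norm _))// lerDl.
have mPop := markov_expl_op (M := M) K; have [PD PZ _ Pc] := mPop.
pose level N (j : nat) : set S := [set p | - B + 2 * B / N%:R * j.+1%:R <= g p].
have mlevel N j : measurable (level N j).
  rewrite (_ : level N j = g @^-1` `[- B + 2 * B / N%:R * j.+1%:R, +oo[%classic).
    by rewrite -[X in measurable X]setTI; apply: mg => //; exact: measurable_itv.
  by apply/seteqP; split => p; rewrite /level /= in_itv/= andbT.
pose s N (p : S) : R := - B + \sum_(j < N) 2 * B / N%:R * \1_(level N j) p.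
have bs N : bounded_measurable (s N).
  apply: bmfD; first exact: bmf_cst.
  by apply: bmf_sum => j; apply: bmfZ; exact: bmf_indic.
have gs N p : (0 < N)%N -> `|g p - s N p| <= 2 * B / N%:R.
  move=> N0; have := staircase B_gt0 N0 (gB p); congr (`|_ - (_ + _)| <= _).
  apply: eq_bigr => j _; congr (_ * _); rewrite indicE; congr (nat_of_bool _)%:R.
  by apply/idP/idP => [h|]; [rewrite mem_set|rewrite inE].
have Ps N p : expl_op (M := M) K (s N) p =
    - B + \sum_(j < N) 2 * B / N%:R * expl_op (M := M) K \1_(level N j) p.
  rewrite /s PD Pc; congr (_ + _).
  exact: (markov_sumZ _ _ (fun j => \1_(level N j)) p mPop).
have bPs N := bmf_expl_op (M := M) K (bs N).
have Es N : \int[lam]_p expl_op (M := M) K (s N) p = \int[lam]_p s N p.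
  under eq_Rintegral do rewrite Ps.
  have b1 j : bounded_measurable (fun p => 2 * B / N%:R * (\1_(level N j) p : R)).
    by apply: bmfZ; exact: bmf_indic.
  have b2 j : bounded_measurable
      (fun p => 2 * B / N%:R * expl_op (M := M) K \1_(level N j) p).
    by apply: bmfZ; apply: bmf_expl_op; exact: bmf_indic.
  rewrite /s !expectD; try exact: bmf_cst; try exact: bmf_sum.
  congr (_ + _); rewrite !expect_sum//; apply: eq_bigr => j _.
  have bi := bmf_indic (R := R) (mlevel N j).
  rewrite (expectZ lam _ bi) (expectZ lam _ (bmf_expl_op K bi)).
  by rewrite invariant_indic.
have bPg := bmf_expl_op (M := M) K bg.
have close N : (0 < N)%N ->
    `|\int[lam]_p expl_op (M := M) K g p - \int[lam]_p g p| <= 4 * B / N%:R.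
  move=> N0.
  have h1 : `|\int[lam]_p expl_op (M := M) K g p - \int[lam]_p s N p| <= 2 * B / N%:R.
    rewrite -Es -expectB//; apply: expect_norm_le; first exact: bmfB.
    move=> p; rewrite -(markovB g (s N) p mPop).
    by apply: (markov_norm_le mPop) => x; exact: gs.
  have h2 : `|\int[lam]_p g p - \int[lam]_p s N p| <= 2 * B / N%:R.
    by rewrite -expectB//; apply: expect_norm_le => [|p]; [exact: bmfB|exact: gs].
  rewrite -(subrKA (\int[lam]_p s N p)) (le_trans (ler_normD _ _))//.
  rewrite [`|_ - \int[lam]_p g p|]distrC (le_trans (lerD h1 h2))//.
  rewrite le_eqVlt; apply/orP; left; apply/eqP; ring.
apply/eqP; rewrite -subr_eq0 -normr_eq0 eq_le normr_ge0 andbT.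
apply/ler_addgt0Pr => e e0; rewrite add0r.
have [N hN] := exists_nat_gt (4 * B / e).
have N0 : (0 < N)%N.
  by rewrite -(ltr0n R) (le_lt_trans _ hN)// divr_ge0 ?(ltW e0)// mulr_ge0 ?(ltW B_gt0).
apply: (le_trans (close N N0)).
by rewrite ler_pdivrMr ?ltr0n// [leRHS]mulrC -ler_pdivrMr// ltW.
Qed.

Hypothesis singleton_cell : exists (Q : quantizer X M) (x : X) (q : M),
  [set y | Q y = q] = [set x].
Hypothesis irreducible : forall f : X -> U,
  irreducible_chain (fun x y => K x (f x) y).

Lemma poisson_predictor (g : S -> R) delta : bounded_measurable g -> 0 < delta ->
  exists2 H, norm_bounded H &
    forall p, `|g p - \int[lam]_p g p - (H p - expl_op (M := M) K H p)| <= delta.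
Proof.
move=> bg d0; have [mg [B gB]] := bg.
have [Q [x0 [q cellE]]] := singleton_cell.
have [N [eps [N0 eps01 hmin]]] := minorization cellE (irreducible (fun=> point)).
apply: (approximate_poisson (markov_expl_op (M := M) K) N0 eps01 hmin gB) => //.
move=> m lo hi h.
have bA f : bounded_measurable f -> bounded_measurable (average_operator (expl_op (M := M) K) N f).
  move=> bf; apply: bmfZ; apply: bmf_sum => i.
  by elim: (i.+1) => [//|j IH] /=; exact: bmf_expl_op.
have bP f i : bounded_measurable f -> bounded_measurable (iter i (expl_op (M := M) K) f).
  by move=> bf; elim: i => [//|j IH] /=; exact: bmf_expl_op.
have EP f i : bounded_measurable f ->
    \int[lam]_p iter i (expl_op (M := M) K) f p = \int[lam]_p f p.
  by move=> bf; elim: i => [//|j IH] /=; rewrite invariant_expect//; exact: bP.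
have EA f : bounded_measurable f ->
    \int[lam]_p average_operator (expl_op (M := M) K) N f p = \int[lam]_p f p.
  move=> bf; rewrite /average_operator expectZ; last first.
    by apply: bmf_sum => i; exact: bP.
  rewrite expect_sum; last by move=> i; exact: bP.
  under eq_bigr do rewrite EP//.
  by rewrite sumr_const card_ord -[X in _ * X]mulr_natl mulKf// pnatr_eq0 -lt0n.
have bAm k : bounded_measurable (iter k (average_operator (expl_op (M := M) K) N) g).
  by elim: k => [//|k IH] /=; exact: bA.
have EAm k : \int[lam]_p iter k (average_operator (expl_op (M := M) K) N) g p =
    \int[lam]_p g p.
  by elim: k => [//|k IH] /=; rewrite EA.
rewrite -(EAm m) -{1}(expect_cst lam lo) -{1}(expect_cst lam hi).
by rewrite !le_expect//; try exact: bmf_cst; move=> p; have /andP[] := h p.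
Qed.

Variables (pi0 : S) (d : measure_display) (Omega : measurableType d).
Variables (P : probability Omega R) (W : nat -> Omega -> A * M).
Hypothesis lawW : has_law (mdp_law (uniform_policy K c) pi0) P W.

(** With H an approximate solution of the Poisson equation for the mean of
    G, the terms G + H (next state), centred by their conditional means, are
    martingale differences. What remains of the sum of G is t * ell, a telescoping
    sum of H, and an error of at most t / (j + 1). *)
Theorem ergodic_theorem (G : S -> A -> S -> R) (B : R) :
  (forall p a p', `|G p a p'| <= B) -> bounded_measurable (expl_mean K G) ->
  {ae P, forall om,
    (fun t : nat => (\sum_(s < t) G (state_at (m := pm) pi0 (W ^~ om) s)
      (W s om).1 (state_at (m := pm) pi0 (W ^~ om) s.+1)) / t%:R) @ \oo -->
    \int[lam]_p expl_mean K G p}.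
Proof.
move=> GB bG; set ell := \int[lam]_p _.
pose st (w : nat -> A * M) t : S := state_at (m := pm) pi0 w t.
have d_gt0 (j : nat) : 0 < (j.+1%:R^-1 : R) by rewrite invr_gt0 ltr0n.
have [H hH] := choice (fun j => let: ex_intro2 H b h :=
  poisson_predictor bG (d_gt0 j) in ex_intro _ H (conj b h)).
pose GH j (p : S) (a : A) (p' : S) := G p a p' + H j p'.
(* D j is the centred form of G + H j, whose sum is a martingale. *)
pose D j t (w : nat -> A * M) : R :=
  GH j (st w t) (w t).1 (st w t.+1) - expl_mean K (GH j) (st w t).
have GHb j : exists B', forall p a p', `|GH j p a p'| <= B'.
  have [[BH hBH] _] := hH j; exists (B + BH) => p a p'.
  by rewrite (le_trans (ler_normD _ _))// lerD.
have Dadapted j t : adapted t.+1 (D j t).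
  move=> w w' h; rewrite /D /st (h t (ltnSn t)).
  have h' : agree t w w' by move=> k kt; apply: h; exact: ltnW.
  by rewrite (adapted_state_at (m := pm) pi0 h) (adapted_state_at (m := pm) pi0 h').
have Dmart j t w :
    \sum_z mdp_law (uniform_policy K c) pi0 w t z * D j t (upd w t z) = 0.
  transitivity (\sum_z mdp_law (uniform_policy K c) pi0 w t z *
    (GH j (st w t) z.1 (predF K (st w t) z.1.1 z.1.2 z.2) -
     expl_mean K (GH j) (st w t))).
    apply: eq_bigr => z _; congr (_ * _).
    have e1 : st (upd w t z) t = st w t.
      exact: (adapted_state_at (m := pm) pi0 (agree_upd w z (leqnn t))).
    have e2 : st (upd w t z) t.+1 = predF K (st w t) z.1.1 z.1.2 z.2.
      exact: (state_atS (m := pm)).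
    by rewrite /D e1 e2 /upd eqxx.
  rewrite (mdp_law_sum (uniform_policy K c) pi0 w t (fun z =>
    GH j (st w t) z.1 (predF K (st w t) z.1.1 z.1.2 z.2) -
    expl_mean K (GH j) (st w t))).
  transitivity ((#|{: A}|%:R)^-1 * \sum_(a : A)
      (step_mean K (GH j (st w t) a) (st w t) a - expl_mean K (GH j) (st w t))).
    rewrite mulr_sumr; apply: eq_bigr => a _; congr (_ * _).
    under eq_bigr do rewrite mulrBr.
    by rewrite sumrB -mulr_suml cell_mass_sum1 mul1r.
  rewrite sumrB mulrBr sumr_const -[X in _ - _ * X]mulr_natl mulKf ?subrr//.
  by rewrite gt_eqF// card_act_gt0.
have Dle j : exists B', forall t w, `|D j t w| <= B'.
  have [B' hB'] := GHb j; exists (B' + B') => t w.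
  rewrite (le_trans (ler_normB _ _))// lerD//.
  rewrite ler_norml; apply/andP; split.
    rewrite -(expl_mean_cst (U := U) (M := M) K (- B') (st w t)); apply: le_expl_mean => p a p'.
    by have := hB' p a p'; rewrite ler_norml => /andP[].
  rewrite -[leRHS](expl_mean_cst (U := U) (M := M) K B' (st w t)); apply: le_expl_mean => p a p'.
  by have := hB' p a p'; rewrite ler_norml => /andP[].
have uadm := @admissible_uniform R X U M K c.
have lln : {ae P, forall om, forall j,
    (fun t : nat => mart (D j) t (W ^~ om) / t%:R) @ \oo --> (0 : R)}.
  apply: ae_foralln => j; have [B' hB'] := Dle j.
  pose z0 : A * M := (([ffun=> point], [ffun=> point]), point).
  exact: (martingale_lln z0 (adapted_mdp_law (uniform_policy K c) pi0)
    (mdp_law_ge0 (predictor_weight_ge0 K c) uadm pi0)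
    (mdp_law_sum1 (predictor_weight_sum1 K c) uadm pi0) (Dadapted j) (Dmart j) hB' lawW).
apply: filterS lln => om hom.
pose x := st (W ^~ om); pose Sg t := \sum_(s < t) G (x s) (W s om).1 (x s.+1).
rewrite -[X in X @ _ --> _]/(fun t => Sg t / t%:R).
have decomp j t : Sg t - t%:R * ell = mart (D j) t (W ^~ om) +
    \sum_(s < t) (expl_mean K G (x s) - ell - (H j (x s) - expl_op (M := M) K (H j) (x s))) +
    (H j (x 0%N) - H j (x t)).
  elim: t => [|t IH]; first by rewrite /Sg /mart !big_ord0 mul0r !subrr !addr0.
  have -> : Sg t.+1 - t.+1%:R * ell =
      (Sg t - t%:R * ell) + (G (x t) (W t om).1 (x t.+1) - ell).
    by rewrite /Sg big_ord_recr/= -natr1; ring.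
  rewrite IH /mart !big_ord_recr/= /D -/(x t) -/(x t.+1) /GH expl_meanD.
  by rewrite -/(expl_op (M := M) K (H j) (x t)); ring.
apply/cvgnP => e e0.
have e3 : 0 < e / 3 by rewrite divr_gt0.
have [j hj] := exists_nat_gt (e / 3)^-1.
have dj : j.+1%:R^-1 <= e / 3.
  rewrite -[leRHS]invrK lef_pV2 ?posrE ?invr_gt0 ?ltr0n//.
  by rewrite (le_trans (ltW hj))// ler_nat.
have [[BH hBH] hP] := hH j.
have [N1 hN1] := (cvgn0P _).1 (hom j) _ e3.
have [N2 hN2] := exists_nat_gt (2 * BH / (e / 3)).
exists (maxn 1 (maxn N1 N2)) => t; rewrite !geq_max => /and3P[t0 t1 t2].
have tR0 : 0 < (t%:R : R) by rewrite ltr0n.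
have -> : Sg t / t%:R - ell = (Sg t - t%:R * ell) / t%:R.
  by rewrite mulrBl mulrAC mulfV ?mul1r// gt_eqF.
rewrite normrM normfV (gtr0_norm tR0) ler_pdivrMr// (decomp j).
have h1 : `|mart (D j) t (W ^~ om)| <= e / 3 * t%:R.
  by have := hN1 t t1; rewrite normrM normfV (gtr0_norm tR0) ler_pdivrMr.
have h2 : `|\sum_(s < t) (expl_mean K G (x s) - ell -
    (H j (x s) - expl_op (M := M) K (H j) (x s)))| <= e / 3 * t%:R.
  rewrite (le_trans (ler_norm_sum _ _ _))//.
  apply: (@le_trans _ _ (\sum_(s < t) e / 3)).
    by apply: ler_sum => s _; exact: le_trans (hP (x s)) dj.
  by rewrite sumr_const card_ord -[leLHS]mulr_natr.
have h3 : `|H j (x 0%N) - H j (x t)| <= e / 3 * t%:R.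
  rewrite (le_trans (ler_normB _ _))//.
  apply: (@le_trans _ _ (2 * BH)); first by rewrite mulr_natl mulr2n lerD.
  rewrite [leRHS]mulrC -ler_pdivrMr// (le_trans (ltW hN2))//.
  by rewrite ler_nat.
apply: (le_trans (ler_normD _ _)); apply: (le_trans (lerD (ler_normD _ _) (lexx _))).
lra.
Qed.

End ErgodicTheorem.

(** * Fixed points and regularity of the value function *)

Section MinOver.
Context {R : realType} {A : finType}.
Implicit Types f g : A -> R.

Lemma min_over_attained (a0 : A) f :
  exists2 a, min_over f = f a & forall b, f a <= f b.
Proof.
have [a _ ha] := Order.TotalTheory.arg_minP f (isT : xpredT a0).
exists a => [|b]; last exact: ha.
apply/eqP; rewrite eq_le; apply/andP; split.
  by apply: ge_inf; [exists (f a) => _ [b _ <-]; exact: ha|exists a].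
by apply: lb_le_inf; [exists (f a), a|move=> _ [b _ <-]; exact: ha].
Qed.

Lemma min_over_le f a : min_over f <= f a.
Proof. by have [b -> h] := min_over_attained a f; exact: h. Qed.

Lemma min_over_dist (a0 : A) f g e : (forall a, `|f a - g a| <= e) ->
  `|min_over f - min_over g| <= e.
Proof.
move=> fg; have [a fa ha] := min_over_attained a0 f.
have [b gb hb] := min_over_attained a0 g.
have := fg a; have := fg b; have := ha b; have := hb a.
rewrite fa gb !ler_norml => h1 h2 /andP[h3 h4] /andP[h5 h6].
by apply/andP; split; lra.
Qed.

Lemma min_over_norm_le (a0 : A) f B : (forall a, `|f a| <= B) -> `|min_over f| <= B.
Proof. by move=> fB; have [a -> _] := min_over_attained a0 f. Qed.

End MinOver.

Section FixedPoint.
Context {R : realType} {S : Type}.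
Variables (beta C : R) (T : (S -> R) -> S -> R).
Hypothesis beta01 : 0 < beta < 1.
Hypothesis T_contracts : forall V V' e, (forall s, `|V s - V' s| <= e) ->
  forall s, `|T V s - T V' s| <= beta * e.
Hypothesis T0_le : forall s, `|T (fun=> 0) s| <= C.

(** The iterates converge uniformly at a geometric rate, for any set S of
    arguments. The rate is kept, since regularity of the fixed point comes from
    the iterates. *)
Theorem contraction_fixed_point : exists2 V, forall s, T V s = V s &
  forall j s, `|V s - iter j T (fun=> 0) s| <= beta ^+ j * (C / (1 - beta)).
Proof.
pose Vj j := iter j T (fun=> 0).
have b0 : 0 <= beta by case/andP: beta01 => /ltW.
have step j s : `|Vj j.+1 s - Vj j s| <= C * beta ^+ j.
  elim: j s => [|j IH] s; first by rewrite expr0 mulr1 /Vj/= subr0.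
  by rewrite exprS mulrCA; apply: T_contracts => s'; exact: IH.
pose u s k := Vj k.+1 s - Vj k s.
have su s k : series (u s) k = Vj k s.
  by rewrite /series/= telescope_sumr// /Vj/= subr0.
have tail s := (series_tail beta01 (step ^~ s)).2.
exists (fun s => limn (series (u s))); last first.
  by move=> j s; have := tail s j; rewrite su.
move=> s; set V := fun s => limn (series (u s)).
have VVj j s' : `|V s' - Vj j s'| <= beta ^+ j * (C / (1 - beta)).
  by have := tail s' j; rewrite su.
apply/eqP; rewrite -subr_eq0 -normr_le0.
apply: (geometric_absorb beta01 (D := 2 * beta * (C / (1 - beta)))) => j.
have h1 : `|T V s - Vj j.+1 s| <= beta * (beta ^+ j * (C / (1 - beta))).
  exact: T_contracts.
have h2 := VVj j.+1 s.
rewrite add0r -(subrKA (Vj j.+1 s)) (le_trans (ler_normD _ _))//.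
rewrite (le_trans (lerD h1 (_ : _ <= beta ^+ j.+1 * (C / (1 - beta)))))//.
  by rewrite distrC.
by rewrite le_eqVlt; apply/orP; left; apply/eqP; rewrite exprS; ring.
Qed.

End FixedPoint.

Section Bellman.
Context {R : realType}.
Variables (m : mdp R) (beta C : R).
Local Notation S := (state m).
Local Notation A := (action m).
Local Notation Z := (noise m).
Hypothesis beta01 : 0 < beta < 1.
Hypothesis weight_ge0 : forall (s : S) (a : A) (z : Z), 0 <= weight s a z.
Hypothesis weight_sum1 : forall (s : S) (a : A), \sum_z weight s a z = 1.
Hypothesis cost_le : forall (s : S) (a : A), `|stage_cost s a| <= C.
Variable a0 : A.

Definition bellman (V : S -> R) (s : S) : R := min_over (action_value beta V s).

Lemma action_value_dist (V V' : S -> R) e s a : (forall s, `|V s - V' s| <= e) ->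
  `|action_value beta V s a - action_value beta V' s a| <= beta * e.
Proof.
move=> VV; have b0 : 0 <= beta by case/andP: beta01 => /ltW.
rewrite /action_value opprD addrACA subrr add0r -mulrBr -sumrB normrM ger0_norm//.
rewrite ler_wpM2l// (le_trans (ler_norm_sum _ _ _))//.
rewrite -[leRHS]mul1r -(weight_sum1 s a) mulr_suml; apply: ler_sum => z _.
by rewrite -mulrBr normrM ger0_norm// ler_wpM2l.
Qed.

Theorem bellman_fixed_point : exists2 V : S -> R,
  forall s, V s = min_over (action_value beta V s) &
  forall j s, `|V s - iter j bellman (fun=> 0) s| <= beta ^+ j * (C / (1 - beta)).
Proof.
have T0 s : `|bellman (fun=> 0) s| <= C.
  apply: (min_over_norm_le a0) => a; rewrite /action_value big1 ?mulr0 ?addr0//.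
  by move=> z _; rewrite mulr0.
have Tc V V' e : (forall s, `|V s - V' s| <= e) ->
    forall s, `|bellman V s - bellman V' s| <= beta * e.
  by move=> h s; apply: (min_over_dist a0) => a; exact: action_value_dist.
have [V VT Vj] := contraction_fixed_point beta01 Tc T0.
by exists V => // s; rewrite -[LHS]VT.
Qed.

End Bellman.

Section LipschitzValue.
Context {R : realType} {X U M : finPointedType}.
Variables (K : X -> U -> pdist R X) (c : X -> U -> R) (beta : R).
Hypothesis beta01 : 0 < beta < 1.
Local Notation S := (pdist R X).
Local Notation A := (act X U M).
Local Notation pm := (predictor_mdp M K c).
Local Notation C := (cost_bound c).

(** Lipschitz continuity in L1 of the positively homogeneous extension of V
    to the cone of finite measures. Since the product of the mass of a cell with
    the predictor is linear in p, this form is preserved by the Bellman operator,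
    whereas the predictor itself need not be continuous at null cells. *)
Definition cone_lipschitz (B : R) (V : S -> R) := forall (s t : R) (p p' : S),
  0 <= s -> 0 <= t -> `|s * V p - t * V p'| <= B * \sum_x `|s * p x - t * p' x|.

Lemma cost_bound_ge0 : 0 <= C.
Proof. by apply: sumr_ge0 => x _; apply: sumr_ge0. Qed.

(** For each symbol the two scalars are multiplied by the masses of the
    cells, and the resulting measures are images of the restrictions of s * p
    and t * p' to that cell under a stochastic matrix, which contracts L1. *)
Lemma action_value_lipschitz B V (a : A) : 0 <= B -> cone_lipschitz B V ->
  cone_lipschitz (C + beta * B) (fun p => action_value (m := pm) beta V p a).
Proof.
move=> B0 VL s t p p' s0 t0; have b0 : 0 <= beta by case/andP: beta01 => /ltW.
set D := \sum_x _.
rewrite /action_value /= !mulrDr opprD addrACA mulrDl.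
apply: (le_trans (ler_normD _ _)); apply: lerD.
  rewrite /pred_cost !mulr_sumr -sumrB (le_trans (ler_norm_sum _ _ _))//.
  apply: ler_sum => x _.
  rewrite !mulrA -mulrBl normrM [leRHS]mulrC ler_wpM2l//.
  exact: cost_bound_ge.
rewrite !(mulrCA _ beta) -mulrBr normrM ger0_norm// -[leRHS]mulrA ler_wpM2l//.
rewrite !mulr_sumr -sumrB (le_trans (ler_norm_sum _ _ _))//.
rewrite [leRHS](partition_big (fun x => a.1 x) xpredT)//=.
apply: ler_sum => q _; rewrite -mulr_sumr !mulrA.
apply: (le_trans (VL _ _ _ _ _ _)); rewrite ?mulr_ge0 ?cell_mass_ge0//.
rewrite ler_wpM2l//.
under eq_bigr do rewrite -!mulrA !cell_mass_predF !mulr_sumr -sumrB.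
apply: (@le_trans _ _ (\sum_x' \sum_(x | a.1 x == q)
    K x (a.2 (a.1, q)) x' * `|s * p x - t * p' x|)).
  apply: ler_sum => x' _; rewrite (le_trans (ler_norm_sum _ _ _))//.
  apply: ler_sum => x _; rewrite !(mulrCA _ (K _ _ _)) -mulrBr normrM.
  by rewrite ger0_norm ?pdist_ge0.
rewrite exchange_big/=; apply: ler_sum => x _.
by rewrite -mulr_suml pdist_sum1 mul1r.
Qed.

Lemma bellman_lipschitz B V : 0 <= B -> cone_lipschitz B V ->
  cone_lipschitz (C + beta * B) (bellman (m := pm) beta V).
Proof.
move=> B0 VL.
have a0 : A := ([ffun=> point], [ffun=> point]).
have half s t p p' : 0 <= s -> 0 <= t ->
    s * bellman (m := pm) beta V p - t * bellman (m := pm) beta V p' <=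
    (C + beta * B) * \sum_x `|s * p x - t * p' x|.
  move=> s0 t0; rewrite /bellman.
  have [a -> _] := min_over_attained (a0 : action pm) (action_value (m := pm) beta V p').
  apply: le_trans (le_trans (ler_norm _) (action_value_lipschitz a B0 VL p p' s0 t0)).
  by rewrite lerD2r ler_wpM2l// min_over_le.
move=> s t p p' s0 t0; rewrite ler_norml half// andbT.
rewrite lerNl opprB (le_trans (half _ _ _ _ t0 s0))//.
by under eq_bigr do rewrite distrC.
Qed.

Theorem optimal_value_lipschitz (V : S -> R) :
  (forall j s, `|V s - iter j (bellman (m := pm) beta) (fun=> 0) s| <=
    beta ^+ j * (C / (1 - beta))) ->
  cone_lipschitz (C / (1 - beta)) V.
Proof.
move=> Vj; set B := C / (1 - beta).
have /andP[b0 b1] := beta01.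
have B0 : 0 <= B by rewrite divr_ge0 ?cost_bound_ge0// subr_ge0 ltW.
have BE : C + beta * B = B by rewrite /B; field; rewrite subr_eq0 gt_eqF.
have Lj j : cone_lipschitz B (iter j (bellman (m := pm) beta) (fun=> 0)).
  elim: j => [|j IH] s t p p' s0 t0 /=.
    by rewrite !mulr0 subrr normr0 mulr_ge0// sumr_ge0.
  by rewrite -BE; exact: bellman_lipschitz.
move=> s t p p' s0 t0.
apply: (geometric_absorb beta01 (D := (s + t) * B)) => j.
pose v := iter j (bellman (m := pm) beta) (fun=> 0).
have h1 : `|s * V p - s * v p| <= s * (beta ^+ j * B).
  by rewrite -mulrBr normrM ger0_norm// ler_wpM2l//; exact: Vj.
have h2 : `|t * V p' - t * v p'| <= t * (beta ^+ j * B).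
  by rewrite -mulrBr normrM ger0_norm// ler_wpM2l//; exact: Vj.
have h3 := Lj j s t p p' s0 t0; rewrite -/v in h3.
have -> : s * V p - t * V p' = (s * V p - s * v p) + (s * v p - t * v p') -
    (t * V p' - t * v p') by ring.
apply: (le_trans (ler_normB _ _)); apply: (le_trans (lerD (ler_normD _ _) (lexx _))).
lra.
Qed.

End LipschitzValue.

(** * The quantized model *)

Section QuantizedModel.
Context {R : realType} {X U M : finPointedType}.
Variables (K : X -> U -> pdist R X) (c : X -> U -> R) (beta : R).
Hypothesis beta01 : 0 < beta < 1.
Local Notation S := (pdist R X).
Local Notation A := (act X U M).
Local Notation pm := (predictor_mdp M K c).
Variable lam : probability S R.
Hypothesis lam_inv : exploration_invariant M K c lam.
Variables (n : nat) (rho : S -> grid X n).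
Hypothesis rho_measurable : forall k, measurable (rho @^-1` [set k]).
Local Notation charged := (charged_grid lam rho).
Local Notation qm := (quantized_mdp M K c lam rho).

Let a0 : A := ([ffun=> point], [ffun=> point]).

Lemma measurable_bin k : measurable (bin rho k).
Proof. exact: rho_measurable. Qed.

Lemma bin_mass_gt0 (k : charged) : 0 < fine (lam (bin rho (val k))).
Proof.
rewrite fine_gt0// (valP k)/=.
by rewrite (le_lt_trans (probability_le1 lam (measurable_bin _))) ?ltry.
Qed.

Lemma bmf_integrableS (D : set S) (f : S -> R) : measurable D ->
  bounded_measurable f -> lam.-integrable D (EFin \o f).
Proof.
move=> mD bf; apply: (integrableS (E := setT)) => //; exact: bmf_integrable.
Qed.

Definition bin_mean (k : charged) (f : S -> R) : R :=
  (\int[lam]_(p in bin rho (val k)) f p) / fine (lam (bin rho (val k))).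

Lemma bin_mean_cst k r : bin_mean k (fun=> r) = r.
Proof.
rewrite /bin_mean Rintegral_cst//; last exact: measurable_bin.
by rewrite mulfK// gt_eqF// bin_mass_gt0.
Qed.

Lemma bin_meanD k f g : bounded_measurable f -> bounded_measurable g ->
  bin_mean k (fun p => f p + g p) = bin_mean k f + bin_mean k g.
Proof.
move=> bf bg; rewrite /bin_mean -mulrDl; congr (_ / _).
by apply: RintegralD; try exact: measurable_bin; apply: bmf_integrableS => //;
  exact: measurable_bin.
Qed.

Lemma bin_meanZ k r f : bounded_measurable f ->
  bin_mean k (fun p => r * f p) = r * bin_mean k f.
Proof.
move=> bf; rewrite /bin_mean mulrA; congr (_ / _).
by apply: RintegralZl; [exact: measurable_bin|apply: bmf_integrableS => //;
  exact: measurable_bin].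
Qed.

Lemma le_bin_mean k f g : bounded_measurable f -> bounded_measurable g ->
  (forall p, rho p = val k -> f p <= g p) -> bin_mean k f <= bin_mean k g.
Proof.
move=> bf bg fg; rewrite ler_wpM2r ?invr_ge0 ?(ltW (bin_mass_gt0 k))//.
apply: le_Rintegral; try exact: measurable_bin.
- by apply: bmf_integrableS => //; exact: measurable_bin.
- by apply: bmf_integrableS => //; exact: measurable_bin.
- by move=> p; exact: fg.
Qed.

Lemma bin_mean_sum k (I : Type) (s : seq I) (F : I -> S -> R) :
  (forall i, bounded_measurable (F i)) ->
  bin_mean k (fun p => \sum_(i <- s) F i p) = \sum_(i <- s) bin_mean k (F i).
Proof.
move=> bF; elim: s => [|i s IH].
  rewrite big_nil -[RHS](bin_mean_cst k 0); congr (bin_mean k _).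
  by apply/funext => p; rewrite big_nil.
rewrite big_cons -IH -bin_meanD//; last exact: bmf_sum.
by congr (bin_mean k _); apply/funext => p; rewrite big_cons.
Qed.

Definition uncharged (p : S) : R := (~~ (0 < lam (bin rho (rho p)))%E)%:R.

Lemma unchargedE p :
  uncharged p = \sum_k (~~ (0 < lam (bin rho k))%E)%:R * \1_(bin rho k) p.
Proof.
rewrite (bigD1 (rho p))//= big1 ?addr0 => [|k /eqP kp].
  by rewrite indicE mem_set// mulr1.
by rewrite indicE memNset ?mulr0// => e; apply: kp; rewrite -e.
Qed.

Lemma bmf_uncharged : bounded_measurable uncharged.
Proof.
apply: (bmf_ext (fun p => esym (unchargedE p))); apply: bmf_sum => k.
by apply: bmfZ; apply: bmf_indic; exact: measurable_bin.
Qed.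

Lemma uncharged_ge0 p : 0 <= uncharged p.
Proof. exact: ler0n. Qed.

Lemma expect_uncharged : \int[lam]_p uncharged p = 0.
Proof.
under eq_Rintegral do rewrite unchargedE.
have bi k : bounded_measurable (\1_(bin rho k) : S -> R).
  by apply: bmf_indic; exact: measurable_bin.
rewrite expect_sum => [|k]; last exact: bmfZ.
apply: big1 => k _; rewrite expectZ// expect_indic; last exact: measurable_bin.
case: ltP => [_|h]; first by rewrite mul0r.
have -> : lam (bin rho k) = 0%E by apply/eqP; rewrite eq_le h measure_ge0.
by rewrite mulr0.
Qed.

(** The probability that a step under a leads to an uncharged bin. *)
Definition escape (a : A) (p : S) : R := step_mean K uncharged p a.

Lemma bmf_escape a : bounded_measurable (escape a).
Proof. by apply: bmf_step_mean; exact: bmf_uncharged. Qed.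

Lemma escape_ge0 a p : 0 <= escape a p.
Proof.
by apply: sumr_ge0 => q _; rewrite mulr_ge0 ?cell_mass_ge0 ?uncharged_ge0.
Qed.

(** Uncharged bins have total mass 0, and by invariance the same holds after
    a step of exploration, in which each action has positive probability. *)
Lemma expect_escape a : \int[lam]_p escape a p = 0.
Proof.
apply/eqP; rewrite eq_le; apply/andP; split; last first.
  by apply: Rintegral_ge0 => p _; exact: escape_ge0.
have h : \int[lam]_p ((#|{: A}|%:R)^-1 * escape a p) <= 0.
  rewrite -expect_uncharged -(invariant_expect lam_inv bmf_uncharged).
  apply: le_expect.
  - by apply: bmfZ; exact: bmf_escape.
  - by apply: bmf_expl_op; exact: bmf_uncharged.
  - by move=> p; apply: expl_op_single => p'; exact: uncharged_ge0.
rewrite expectZ in h; last exact: bmf_escape.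
by rewrite pmulr_rle0// ?invr_gt0 in h; exact: card_act_gt0.
Qed.

Lemma bin_mean_escape k a : bin_mean k (escape a) = 0.
Proof.
rewrite /bin_mean; suff -> : \int[lam]_(p in bin rho (val k)) escape a p = 0.
  by rewrite mul0r.
apply/eqP; rewrite eq_le; apply/andP; split; last first.
  by apply: Rintegral_ge0 => p _; exact: escape_ge0.
rewrite -(expect_escape a) Rintegral_mkcond; apply: le_expect.
- apply: (bmf_ext (f := fun p => escape a p * \1_(bin rho (val k)) p)).
    move=> p; rewrite patchE indicE; case: ifP => _; by rewrite ?mulr1 ?mulr0.
  by apply: bmfM; [exact: bmf_escape|apply: bmf_indic; exact: measurable_bin].
- exact: bmf_escape.
- by move=> p; rewrite patchE; case: ifP => // _; exact: escape_ge0.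
Qed.

(** Escape has mean 0 over each bin, so that a bound up to a multiple of it
    passes to bin means. *)
Lemma bin_mean_close k a (f : S -> R) (x y r : R) : bounded_measurable f ->
  (forall p, rho p = val k -> `|f p - x| <= y + r * escape a p) ->
  `|bin_mean k f - x| <= y.
Proof.
move=> bf h; have be := bmf_escape a.
have E z s : bin_mean k (fun p => z + s * escape a p) = z.
  rewrite bin_meanD; [|exact: bmf_cst|exact: bmfZ].
  by rewrite bin_meanZ// bin_mean_escape mulr0 addr0 bin_mean_cst.
have bE z s : bounded_measurable (fun p => z + s * escape a p).
  by apply: bmfD; [exact: bmf_cst|exact: bmfZ].
rewrite ler_distl; apply/andP; split.
  rewrite -(E (x - y) (- r)); apply: le_bin_mean => // p /h.
  rewrite ler_norml => /andP[h1 h2]; lra.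
rewrite -(E (x + y) r); apply: le_bin_mean => // p /h.
by rewrite ler_norml => /andP[h1 h2]; lra.
Qed.

Lemma charged_sum (F : charged -> R) (p : S) (k : charged) : rho p = val k ->
  \sum_(k' : charged) \1_(bin rho (val k')) p * F k' = F k.
Proof.
move=> pk; rewrite (bigD1 k)//= big1 ?addr0 => [|k' kk'].
  by rewrite indicE mem_set ?mul1r.
rewrite indicE memNset ?mul0r// => e; move/eqP: kk'; apply; apply: val_inj.
by rewrite -pk; exact: esym e.
Qed.

Lemma uncharged_sum (F : charged -> R) (p : S) : uncharged p = 1 ->
  \sum_(k' : charged) \1_(bin rho (val k')) p * F k' = 0.
Proof.
move=> up; apply: big1 => k _; rewrite indicE memNset ?mul0r// => e.
have e' : rho p = val k := e.
by move: up; rewrite /uncharged e' (valP k)/= => /eqP; rewrite eq_sym oner_eq0.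
Qed.

Lemma chargedP (p : S) : (exists k : charged, rho p = val k) \/ uncharged p = 1.
Proof.
have [h|h] := boolP (0 < lam (bin rho (rho p)))%E; last by right; rewrite /uncharged h.
by left; exists (Sub (rho p) h); rewrite SubK.
Qed.

Lemma uncharged_charged (p : S) (k : charged) : rho p = val k -> uncharged p = 0.
Proof. by move=> e; rewrite /uncharged e (valP k). Qed.

Lemma step_mean_sum (F : charged -> R) p a :
  \sum_(k' : charged) Defs.kernel (m := pm) p a (bin rho (val k')) * F k' =
  step_mean K (fun p' => \sum_(k' : charged) \1_(bin rho (val k')) p' * F k') p a.
Proof.
rewrite /step_mean /Defs.kernel/=.
under [RHS]eq_bigr do rewrite mulr_sumr.
rewrite exchange_big/=; apply: eq_bigr => k' _; rewrite mulr_suml.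
by apply: eq_bigr => q _; rewrite mulrA.
Qed.

Lemma bmf_kernel a (D : set S) : measurable D ->
  bounded_measurable (fun p : S => Defs.kernel (m := pm) p a D).
Proof. by move=> mD; apply: (bmf_step_mean K a); exact: bmf_indic. Qed.

Lemma quantized_weight_ge0 (k : state qm) (a : action qm) (z : noise qm) :
  0 <= weight k a z.
Proof.
apply: divr_ge0; last by rewrite fine_ge0.
apply: Rintegral_ge0 => p _; apply: sumr_ge0 => q _.
by rewrite mulr_ge0 ?cell_mass_ge0 ?indic_nneg.
Qed.

Lemma quantized_sum (F : charged -> R) (k : charged) (a : A) :
  \sum_(k' : charged) bin_kernel K c k a k' * F k' =
  bin_mean k (step_mean K
    (fun p' => \sum_(k' : charged) \1_(bin rho (val k')) p' * F k') ^~ a).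
Proof.
have bk k' : bounded_measurable
    (fun p : S => Defs.kernel (m := pm) p a (bin rho (val k')) * F k').
  by apply: bmfM; [apply: bmf_kernel; exact: measurable_bin|exact: bmf_cst].
rewrite -[RHS](congr1 (bin_mean k) (funext (fun p => step_mean_sum F p a))).
rewrite bin_mean_sum//; apply: eq_bigr => k' _.
under [in RHS]eq_fun do rewrite mulrC.
by rewrite bin_meanZ 1?mulrC//; apply: bmf_kernel; exact: measurable_bin.
Qed.

(** What the charged bins miss is the escape probability. *)
Lemma quantized_weight_sum1 (k : state qm) (a : action qm) :
  \sum_z weight k a z = 1.
Proof.
transitivity (\sum_(k' : charged) bin_kernel K c k a k' * 1).
  by apply: eq_bigr => k' _; rewrite mulr1.
rewrite quantized_sum; apply/eqP; rewrite -subr_eq0 -normr_le0.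
apply: (@bin_mean_close k a _ _ _ 1).
  apply: (bmf_step_mean K a); apply: bmf_sum => k'.
  by apply: bmfM; [apply: bmf_indic; exact: measurable_bin|exact: bmf_cst].
move=> p _; rewrite add0r mul1r.
rewrite -[X in _ - X](step_mean_cst K 1 p a) /step_mean /escape -sumrB.
rewrite (le_trans (ler_norm_sum _ _ _))//; apply: ler_sum => q _.
rewrite -mulrBr normrM ger0_norm ?cell_mass_ge0// ler_wpM2l ?cell_mass_ge0//.
case: (chargedP (predF K p a.1 a.2 q)) => [[k' e]|e].
  by rewrite (charged_sum _ e) subrr normr0 uncharged_ge0.
by rewrite (uncharged_sum _ e) sub0r normrN normr1 e.
Qed.

Lemma quantized_cost_le (k : state qm) (a : action qm) :
  `|stage_cost k a| <= cost_bound c.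
Proof.
rewrite -[X in `|X|]subr0; apply: (@bin_mean_close k a _ _ _ 0).
  exact: bmf_pred_cost.
by move=> p _; rewrite subr0 mul0r addr0; exact: pred_cost_le.
Qed.

Section Comparison.
Variables (V : S -> R) (Vn : charged -> R) (B delta : R).
Hypothesis V_fix : forall p, V p = min_over (action_value (m := pm) beta V p).
Hypothesis V_lip : cone_lipschitz B V.
Hypothesis V_le : forall p, `|V p| <= B.
Hypothesis B_fix : cost_bound c + beta * B = B.
Hypothesis Vn_fix : forall k, Vn k = min_over (action_value (m := qm) beta Vn k).
Hypothesis Vn_le : forall k, `|Vn k| <= B.
Hypothesis bin_diameter : forall p p' : S, rho p = rho p' ->
  \sum_x `|p x - p' x| <= delta.

Let B_ge0 : 0 <= B.
Proof. exact: le_trans (normr_ge0 _) (V_le point). Qed.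

(** For each predictor of the bin, the quantized continuation differs from
    the exact one by at most e, except where the step escapes; and over the bin
    the exact action value varies by at most B * delta. The integrand compared is
    the quantized one, so V itself is never integrated. *)
Lemma quantized_action_value_close e (k : charged) p a : rho p = val k ->
  (forall k p, rho p = val k -> `|Vn k - V p| <= e) ->
  `|action_value (m := qm) beta Vn k a - action_value (m := pm) beta V p a| <=
    beta * e + B * delta.
Proof.
move=> pk Ve; have b0 : 0 <= beta by case/andP: beta01 => /ltW.
pose G (p' : S) : R := \sum_(k' : charged) \1_(bin rho (val k')) p' * Vn k'.
have bG : bounded_measurable G.
  apply: bmf_sum => k'.
  by apply: bmfM; [apply: bmf_indic; exact: measurable_bin|exact: bmf_cst].
have -> : action_value (m := qm) beta Vn k a =
    bin_mean k (fun p => pred_cost c p a + beta * step_mean K G p a).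
  rewrite bin_meanD; [|exact: bmf_pred_cost|].
    by rewrite bin_meanZ /action_value/= ?quantized_sum//; exact: bmf_step_mean.
  by apply: bmfZ; exact: bmf_step_mean.
apply: (@bin_mean_close k a _ _ _ (beta * B)).
  apply: bmfD; first exact: bmf_pred_cost.
  by apply: bmfZ; exact: bmf_step_mean.
move=> p' pk'.
have h1 : `|action_value (m := pm) beta V p' a - action_value (m := pm) beta V p a|
    <= B * delta.
  have := @action_value_lipschitz R X U M K c beta beta01 B V a B_ge0 V_lip 1 1 p' p ler01 ler01.
  rewrite !mul1r B_fix => h; apply: (le_trans h); rewrite ler_wpM2l//.
  under eq_bigr do rewrite !mul1r.
  by apply: bin_diameter; rewrite pk pk'.
have h2 : `|(pred_cost c p' a + beta * step_mean K G p' a) -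
    action_value (m := pm) beta V p' a| <= beta * (e + B * escape a p').
  rewrite /action_value/= opprD addrACA subrr add0r -mulrBr normrM ger0_norm//.
  rewrite ler_wpM2l// /step_mean -sumrB (le_trans (ler_norm_sum _ _ _))//.
  rewrite -[e]mul1r -(cell_mass_sum1 p' a.1) mulr_suml mulr_sumr -big_split/=.
  apply: ler_sum => q _; rewrite -mulrBr normrM ger0_norm ?cell_mass_ge0//.
  rewrite mulrCA -mulrDr ler_wpM2l ?cell_mass_ge0//.
  case: (chargedP (predF K p' a.1 a.2 q)) => [[k' ek]|ek].
    by rewrite /G (charged_sum _ ek) (uncharged_charged ek) mulr0 addr0 Ve.
  rewrite /G (uncharged_sum _ ek) ek mulr1 sub0r normrN.
  rewrite (le_trans (V_le _))// lerDr.
  exact: le_trans (normr_ge0 _) (Ve k p pk).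
apply: (le_trans (ler_distD (action_value (m := pm) beta V p' a) _ _)).
apply: (le_trans (lerD h2 h1)).
by rewrite mulrDr mulrA addrAC.
Qed.

(** An error bound e improves to beta * e + B * delta; iteration from the
    trivial bound 2 * B gives the fixed point of this map. *)
Lemma quantized_value_close k p : rho p = val k ->
  `|Vn k - V p| <= B * delta / (1 - beta).
Proof.
move=> pk; have /andP[b0 b1] := beta01.
apply: (geometric_absorb beta01 (D := 2 * B)) => j.
elim: j k p pk => [|j IH] k p pk.
  have d0 : 0 <= delta.
    by have := bin_diameter (erefl (rho p)); rewrite big1// => x _; rewrite subrr normr0.
  rewrite expr0 mul1r (le_trans (ler_normB _ _))//.
  rewrite (le_trans (lerD (Vn_le k) (V_le p)))//.
  by rewrite -[leLHS]add0r mulr_natl mulr2n lerD// divr_ge0 ?mulr_ge0// subr_ge0 ltW.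
rewrite (Vn_fix k) (V_fix p).
apply: (le_trans (min_over_dist a0 (fun a => quantized_action_value_close a pk IH))).
rewrite le_eqVlt; apply/orP; left; apply/eqP; rewrite exprS; field.
by rewrite subr_eq0 gt_eqF.
Qed.

Lemma quantized_greedy (ghat : charged -> A) k p : rho p = val k ->
  (forall k a, action_value (m := qm) beta Vn k (ghat k) <=
     action_value (m := qm) beta Vn k a) ->
  action_value (m := pm) beta V p (ghat k) <= V p + 2 * (B * delta / (1 - beta)).
Proof.
move=> pk greedy; have /andP[b0 b1] := beta01.
set e := _ / (1 - beta).
have h := quantized_action_value_close (ghat k) pk quantized_value_close.
have ee : beta * (B * delta / (1 - beta)) + B * delta = e.
  by rewrite /e; field; rewrite subr_eq0 gt_eqF.
rewrite ee ler_norml in h; case/andP: h => h1 h2.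
have : action_value (m := qm) beta Vn k (ghat k) <= Vn k.
  by rewrite Vn_fix; have [a -> _] := min_over_attained (a0 : action qm)
    (action_value (m := qm) beta Vn k); exact: greedy.
have := quantized_value_close pk; rewrite -/e ler_norml => /andP[h3 h4] h5.
lra.
Qed.

End Comparison.

(** By invariance the mass of the successor is at least the mass of p times
    the probability of this transition under exploration. *)
Lemma atom_closed (p : S) (a : A) (q : M) : (0 < lam [set p])%E ->
  0 < cell_mass p a.1 q -> (0 < lam [set predF K p a.1 a.2 q])%E.
Proof.
move=> lp mq; set p' := predF _ _ _ _ _.
have msing r := measurable_pdist_set1 (R := R) (X := X) r.
have fing r : lam [set r] \is a fin_num by exact: fin_num_measure.
suff : 0 < fine (lam [set p']) by rewrite -lte_fin fineK.
have n0 : 0 < (#|{: A}|%:R)^-1 :> R by rewrite invr_gt0; exact: card_act_gt0.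
have bi r := bmf_indic (R := R) (msing r).
rewrite -expect_indic// -(invariant_expect lam_inv (bi p')).
apply: (@lt_le_trans _ _ (\int[lam]_x ((#|{: A}|%:R)^-1 * cell_mass p a.1 q * \1_[set p] x))).
  rewrite expectZ// expect_indic// !mulr_gt0// fine_gt0// lp/=.
  by rewrite -ge0_fin_numE.
apply: le_expect; [exact: bmfZ|exact: bmf_expl_op|].
move=> x; rewrite indicE; have [->|xp] := pselect (x = p); last first.
  rewrite memNset// mulr0; have [_ _ Ple Pc] := markov_expl_op (M := M) K.
  by rewrite -[leLHS](Pc 0 x); apply: Ple => y; exact: indic_nneg.
rewrite mem_set// mulr1.
apply: le_trans (expl_op_single K p a (fun y => indic_nneg _ y)).
rewrite ler_wpM2l ?(ltW n0)// /step_mean (bigD1 q)//= -/p'.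
rewrite [X in _ * X]indicE mem_set// mulr1 lerDl sumr_ge0// => z _.
by rewrite mulr_ge0 ?cell_mass_ge0 ?indic_nneg.
Qed.

Lemma atom_charged (p : S) : (0 < lam [set p])%E -> exists k : charged, rho p = val k.
Proof.
move=> lp; have h : (0 < lam (bin rho (rho p)))%E.
  apply: (lt_le_trans lp); apply: le_measure; rewrite ?inE.
  - exact: measurable_pdist_set1.
  - exact: measurable_bin.
  - by move=> _ ->.
by exists (Sub (rho p) h); rewrite SubK.
Qed.

End QuantizedModel.

(** * The diameter of the bins *)

Section Compactness.
Context {R : realType} {X : finPointedType}.
Local Notation S := (pdist R X).

Definition l1_dist (p p' : S) : R := \sum_x `|p x - p' x|.

Lemma l1_distC p p' : l1_dist p p' = l1_dist p' p.
Proof. by apply: eq_bigr => x _; rewrite distrC. Qed.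

Lemma l1_dist_triangle p2 p1 p3 : l1_dist p1 p3 <= l1_dist p1 p2 + l1_dist p2 p3.
Proof. by rewrite -big_split; apply: ler_sum => x _; exact: ler_distD. Qed.

Lemma cvgn_subsequence (u : nat -> R) (l : R) (phi : nat -> nat) : (forall j, (j <= phi j)%N) ->
  u @ \oo --> l -> (u \o phi) @ \oo --> l.
Proof.
move=> hphi /cvgnP h; apply/cvgnP => e /h[N hN].
by exists N => j Nj; apply: hN; exact: leq_trans (hphi j).
Qed.

Lemma cvgn_sum (I : Type) (s : seq I) (u : I -> nat -> R) (l : I -> R) :
  (forall i, u i @ \oo --> l i) ->
  (fun k => \sum_(i <- s) u i k) @ \oo --> \sum_(i <- s) l i.
Proof.
move=> ul; elim: s => [|i s IH].
  rewrite big_nil; have -> : (fun k => \sum_(i <- [::]) u i k) = fun=> (0 : R).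
    by apply/funext => k; rewrite big_nil.
  exact: cvg_cst.
rewrite big_cons; have -> : (fun k => \sum_(j <- i :: s) u j k) =
    (fun k => u i k + \sum_(j <- s) u j k).
  by apply/funext => k; rewrite big_cons.
exact: cvgD.
Qed.

Lemma increasing_seq_ge (f : nat -> nat) : increasing_seq f -> forall j, (j <= f j)%N.
Proof.
move=> fi; elim=> [//|j IH]; apply: leq_ltn_trans IH _.
have := fi j.+1 j; rewrite ltnn => h; rewrite ltnNge; apply/negP => h'.
by move: h; rewrite /Order.le/= h'.
Qed.

(** That phi dominates the identity replaces strict monotonicity: it is all
    that limits along phi require, and it is stable under composition. *)
Lemma pdist_sequentially_compact (u : nat -> S) : exists p : S, exists phi : nat -> nat,
  (forall j, (j <= phi j)%N) /\ forall x, (fun j => u (phi j) x) @ \oo --> p x.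
Proof.
(* Bolzano-Weierstrass, one coordinate after the other. *)
have [phi [phi_ge phi_cvg]] : exists phi : nat -> nat, (forall j, (j <= phi j)%N) /\
    forall x, x \in enum X -> cvgn (fun j => u (phi j) x).
  elim: (enum X) => [|x s [phi [phi_ge phi_cvg]]].
    by exists id.
  have [|f fi fc] := @bolzano_weierstrass R (fun j => u (phi j) x).
    exists 1; split; first exact: num_real.
    move=> y y1 j _ /=; rewrite ger0_norm ?pdist_ge0//.
    by rewrite (le_trans (pdist_le1 _ _))// ltW.
  exists (phi \o f); split.
    by move=> j; apply: leq_trans (increasing_seq_ge fi j) (phi_ge _).
  move=> y; rewrite inE => /orP[/eqP -> //|/phi_cvg /cvg_ex[l hl]].
  apply/cvg_ex; exists l.
  exact: (cvgn_subsequence (increasing_seq_ge fi) hl).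
have lim_ex x : exists l : R, (fun j => u (phi j) x) @ \oo --> l.
  by apply/cvg_ex; apply: phi_cvg; rewrite mem_enum.
have [l hl] := choice lim_ex.
have l0 x : 0 <= l x.
  rewrite -(cvg_lim _ (hl x))//; apply: limr_ge; first by apply/cvg_ex; exists (l x).
  by apply: nearW => j; exact: pdist_ge0.
have l1 : \sum_x l x = 1.
  have h := @cvgn_sum _ (index_enum X) _ _ hl.
  rewrite -(cvg_lim _ h)//; apply: lim_near_cst => //.
  by apply: nearW => j; exact: pdist_sum1.
have hp : [forall x, 0 <= [ffun x => l x] x] && (\sum_x [ffun x => l x] x == 1).
  apply/andP; split; first by apply/forallP => x; rewrite ffunE.
  by rewrite -l1; apply/eqP; apply: eq_bigr => x _; rewrite ffunE.
exists (Pdist hp), phi; split => // x.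
by rewrite /= ffunE; exact: hl.
Qed.

Lemma weak_cvgP (u : nat -> S) p :
  weak_cvg u p <-> forall x, (fun j => u j x) @ \oo --> p x.
Proof.
split=> [h x|h f].
  have := h (fun y => (y == x)%:R).
  have E q : \sum_y (y == x)%:R * (q : S) y = q x.
    rewrite (bigD1 x)//= eqxx mul1r big1 ?addr0// => y /negbTE ->.
    by rewrite mul0r.
  rewrite E; have -> : (fun k => \sum_y (y == x)%:R * u k y) = (fun k => u k x).
    by apply/funext => k; exact: E.
  by [].
apply: (@cvgn_sum _ _ (fun x k => f x * u k x) (fun x => f x * p x)) => x.
by apply: cvgMr; exact: h.
Qed.

Lemma weak_cvg_l1 (u : nat -> S) p :
  weak_cvg u p <-> (fun j => l1_dist (u j) p) @ \oo --> (0 : R).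
Proof.
rewrite weak_cvgP; split=> [h|/cvgn0P h x].
  have z0 : \sum_(x : X) (0 : R) = 0 by rewrite big1.
  rewrite -[X in _ --> X]z0.
  apply: (@cvgn_sum _ _ (fun x j => `|u j x - p x|) (fun=> 0)) => x.
  apply/cvgn0P => e e0.
  have [N hN] := (cvgnP _ _).1 (h x) e e0.
  by exists N => j /hN; rewrite normr_id.
apply/cvgnP => e /h[N hN]; exists N => j /hN; apply: le_trans.
rewrite /l1_dist (le_trans _ (ler_norm _))// (bigD1 x)//= lerDl.
exact: sumr_ge0.
Qed.

(** All coordinates are rounded down, and one of them receives the missing
    mass, which is less than one unit for each coordinate. *)
Lemma grid_rounding n (p : S) : exists k : grid X n,
  l1_dist p (grid_point R k) <= 2 * #|X|%:R / n.+1%:R.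
Proof.
have n0 : 0 < (n.+1%:R : R) by rewrite ltr0n.
pose m x := Num.truncn (n.+1%:R * p x).
have y0 x : 0 <= n.+1%:R * p x by rewrite mulr_ge0 ?pdist_ge0// ltW.
have m_le x : ((m x)%:R : R) <= n.+1%:R * p x by rewrite truncn_le.
have m_gt x : n.+1%:R * p x < ((m x).+1%:R : R) by exact: truncnS_gt.
have sum_le : (\sum_x m x <= n.+1)%N.
  rewrite -(ler_nat R) natr_sum (le_trans (ler_sum _ (fun x _ => m_le x)))//.
  by rewrite -mulr_sumr pdist_sum1 mulr1.
have sum_gt : (n.+1 - \sum_x m x <= #|X|)%N.
  rewrite leq_subLR -(ler_nat R) natrD natr_sum.
  apply: (@le_trans _ _ (\sum_x n.+1%:R * p x)).
    by rewrite -mulr_sumr pdist_sum1 mulr1.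
  apply: (@le_trans _ _ (\sum_x ((m x)%:R + 1))).
    by apply: ler_sum => x _; rewrite natr1 ltW ?m_gt.
  by rewrite big_split/= lerD2l sumr_const.
pose x0 : X := point.
pose r := (n.+1 - \sum_x m x)%N.
pose k x := (m x + (x == x0) * r)%N.
have ksum : (\sum_x k x = n.+1)%N.
  rewrite big_split/= (bigD1 (P := xpredT) (F := fun x => ((x == x0) * r)%N) x0)//=.
  rewrite eqxx mul1n [X in (_ + (_ + X))%N]big1 ?addn0 ?subnKC// => x /negbTE ->.
  by rewrite mul0n.
have klt x : (k x < n.+2)%N.
  by rewrite ltnS -ksum (bigD1 x)//= leq_addr.
have kP : (\sum_x [ffun x => Ordinal (klt x)] x == n.+1)%N.
  apply/eqP; transitivity (\sum_x k x)%N; last exact: ksum.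
  by apply: eq_bigr => x _; rewrite ffunE.
exists (Sub [ffun x => Ordinal (klt x)] kP : grid X n).
apply: (@le_trans _ _ (\sum_x (1 + (x == x0)%:R * r%:R) / n.+1%:R)).
  apply: ler_sum => x _; rewrite /= !ffunE/=.
  rewrite ler_pdivlMr// -{2}(gtr0_norm n0) -normrM mulrBl divfK ?gt_eqF// mulrC.
  have := m_le x; have := m_gt x; rewrite /k natrD natrM -natr1 ler_norml => h1 h2.
  have : (0 : R) <= (x == x0)%:R * r%:R by rewrite mulr_ge0.
  by move=> h3; apply/andP; split; lra.
rewrite -mulr_suml ler_wpM2r ?invr_ge0 ?(ltW n0)// big_split/=.
have -> : 2 * #|X|%:R = #|X|%:R + #|X|%:R :> R by ring.
rewrite sumr_const lerD//.
rewrite (bigD1 x0)//= eqxx mul1r big1 ?addr0 ?ler_nat// => x /negbTE ->.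
by rewrite mul0r.
Qed.

(** Otherwise predictors at distance bounded below from their nearest
    neighbours exist for arbitrarily fine grids. A subsequence converges to some
    p, and so do the roundings of p, hence also the nearest neighbours, which in
    the metric d are at least as close to the predictors; but weak convergence of
    both sequences to p is convergence in L1. *)
Theorem bin_diameter_cvg0 (d : S -> S -> R) (rho : forall n, S -> grid X n) :
  weak_metric d -> (forall n, nearest_neighbour (rho n) d) ->
  forall e, 0 < e -> exists N, forall n, (N <= n)%N ->
    forall p p' : S, rho n p = rho n p' -> l1_dist p p' <= e.
Proof.
move=> [d_ge0 d_eq0 dC d_tri d_weak] nn e e0.
suff [N hN] : exists N, forall n, (N <= n)%N -> forall p,
    l1_dist p (grid_point R (rho n p)) <= e / 2.
  exists N => n Nn p p' pp.
  rewrite (le_trans (l1_dist_triangle (grid_point R (rho n p)) _ _))//.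
  have h1 := hN n Nn p; have h2 := hN n Nn p'.
  rewrite -pp l1_distC in h2; lra.
apply: contrapT => H.
have {}H N : exists np : nat * S, (N <= np.1)%N /\
    e / 2 < l1_dist np.2 (grid_point R (rho np.1 np.2)).
  apply: contrapT => h; apply: H; exists N => n Nn p; rewrite leNgt; apply/negP => h'.
  by apply: h; exists (n, p).
have [np hnp] := choice H.
have [p [phi [phi_ge phi_cvg]]] := pdist_sequentially_compact (fun j => (np j).2).
pose u j := (np (phi j)).2; pose nu j := (np (phi j)).1.
have nu_ge j : (j <= nu j)%N.
  exact: leq_trans (phi_ge j) (hnp (phi j)).1.
have uw : weak_cvg u p by apply/weak_cvgP.
have vex j : exists v : S, (exists k : grid X (nu j), v = grid_point R k) /\
    l1_dist p v <= 2 * #|X|%:R / (nu j).+1%:R.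
  by have [k hk] := grid_rounding (nu j) p; exists (grid_point R k); split => //; exists k.
have [v hv] := choice vex.
have vw : weak_cvg v p.
  apply/weak_cvg_l1/cvgn0P => e' e'0.
  have [N hN] := exists_nat_gt (2 * #|X|%:R / e').
  exists N => j Nj.
  rewrite ger0_norm ?sumr_ge0// l1_distC (le_trans (hv j).2)//.
  rewrite ler_pdivrMr ?ltr0n// [leRHS]mulrC -ler_pdivrMr// (le_trans (ltW hN))//.
  by rewrite ler_nat (leq_trans Nj)// (leq_trans (nu_ge j)).
pose z j : S := grid_point R (rho (nu j) (u j)).
have zw : weak_cvg z p.
  apply/d_weak/cvgn0P => e' e'0.
  have e3 : 0 < e' / 3 by rewrite divr_gt0.
  have [N1 hN1] := (cvgn0P _).1 ((d_weak _ _).1 uw) _ e3.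
  have [N2 hN2] := (cvgn0P _).1 ((d_weak _ _).1 vw) _ e3.
  exists (maxn N1 N2) => j; rewrite geq_max => /andP[/hN1 + /hN2].
  rewrite !ger0_norm// => h1 h2.
  have h3 := d_tri (z j) (u j) p.
  have h4 : d (u j) (z j) <= d (u j) (v j).
    by have [[k ->] _] := hv j; exact: (nn (nu j)).1.
  have h5 := d_tri (u j) p (v j).
  rewrite (dC p (v j)) in h5; rewrite (dC (z j) (u j)) in h3; lra.
have e4 : 0 < e / 8 by rewrite divr_gt0.
have [N1 hN1] := (cvgn0P _).1 ((weak_cvg_l1 _ _).1 uw) _ e4.
have [N2 hN2] := (cvgn0P _).1 ((weak_cvg_l1 _ _).1 zw) _ e4.
pose j := maxn N1 N2.
have h1 := le_trans (ler_norm _) (hN1 j (leq_maxl _ _)).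
have h2 := le_trans (ler_norm _) (hN2 j (leq_maxr _ _)).
have h3 : e / 2 < l1_dist (u j) (z j) := (hnp (phi j)).2.
have h4 := l1_dist_triangle p (u j) (z j).
rewrite (l1_distC (z j) p) in h2; lra.
Qed.

End Compactness.

(** * Quantized Q-learning along a path *)

Section QLearning.
Context {R : realType} {X U M : finPointedType}.
Variables (c : X -> U -> R) (beta : R).
Hypothesis beta01 : 0 < beta < 1.
Local Notation S := (pdist R X).
Local Notation A := (act X U M).
Variable lam : probability S R.
Variables (n : nat) (rho : S -> grid X n).
Local Notation charged := (charged_grid lam rho).
Variables (p : nat -> S) (a : nat -> A).
Local Notation Q := (Qlearn c beta rho p a).

Let a0 : A := ([ffun=> point], [ffun=> point]).

Definition visit (k : grid X n) (b : A) (s : nat) : R := ((rho (p s), a s) == (k, b))%:R.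
Definition visits (k : grid X n) (b : A) (t : nat) : R := \sum_(s < t) visit k b s.

Lemma visit_ge0 k b s : 0 <= visit k b s. Proof. exact: ler0n. Qed.

Lemma visits_ge0 k b t : 0 <= visits k b t.
Proof. by apply: sumr_ge0 => s _; exact: visit_ge0. Qed.

Lemma visitsS k b t : visits k b t.+1 = visits k b t + visit k b t.
Proof. by rewrite /visits big_ord_recr. Qed.

Lemma learning_rateE t k b :
  learning_rate rho p a t k b = visit k b t / (1 + visits k b t.+1).
Proof.
rewrite /learning_rate /visits /visit; case: ifP => _; last by rewrite mul0r.
by rewrite mul1r.
Qed.

(** With these learning rates an iterate is the plain average of the initial
    value 0 and of the targets met at the visits. *)
Lemma Qlearn_average t k b : (1 + visits k b t) * Q t k b =
  \sum_(s < t) visit k b s *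
    (pred_cost c (p s) (a s) + beta * min_over (Q s (rho (p s.+1)))).
Proof.
elim: t => [|t IH]; first by rewrite /= mulr0 big_ord0.
rewrite big_ord_recr/= -IH learning_rateE visitsS.
set y := _ + beta * _; set q := Q t k b; set N := visits k b t.
have N0 : 0 <= N by exact: visits_ge0.
have v0 : 0 <= visit k b t by exact: visit_ge0.
have v01 : visit k b t = 0 \/ visit k b t = 1.
  by rewrite /visit; case: (_ == _); [right|left].
case: v01 => ->; first by rewrite addr0 !mul0r subr0 mul1r !addr0.
by field; rewrite gt_eqF// ltr_pwDl// addr_ge0.
Qed.

Lemma Qlearn_bound C : (forall (p : S) (b : A), `|pred_cost c p b| <= C) ->
  forall t k b, `|Q t k b| <= C / (1 - beta).
Proof.
move=> cC; have /andP[b0 b1] := beta01; have b1' : 0 < 1 - beta by rewrite subr_gt0.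
have C0 : 0 <= C by exact: le_trans (normr_ge0 _) (cC point a0).
set B := C / (1 - beta); have B0 : 0 <= B by rewrite divr_ge0 ?(ltW b1').
have BE : C + beta * B = B by rewrite /B; field; rewrite gt_eqF.
elim=> [|t IH] k b; first by rewrite /= normr0.
rewrite /=; set al := learning_rate _ _ _ _ _ _; set y := _ + beta * _.
have yB : `|y| <= B.
  rewrite -BE (le_trans (ler_normD _ _))// lerD// normrM gtr0_norm// ler_wpM2l ?(ltW b0)//.
  exact: min_over_norm_le.
have [al0 al1] : 0 <= al /\ al <= 1.
  rewrite /al learning_rateE; have v0 := visit_ge0 k b t.
  have V0 := visits_ge0 k b t.
  have D0 : 0 < 1 + visits k b t.+1 by rewrite ltr_pwDl// visits_ge0.
  split; first by rewrite divr_ge0// ltW.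
  by rewrite ler_pdivrMr// mul1r visitsS addrA lerDr addr_ge0.
rewrite (le_trans (ler_normD _ _))// !normrM (ger0_norm al0) ger0_norm ?subr_ge0//.
have h1 : (1 - al) * `|Q t k b| <= (1 - al) * B by rewrite ler_wpM2l ?subr_ge0.
have h2 : al * `|y| <= al * B by rewrite ler_wpM2l.
by rewrite (le_trans (lerD h1 h2))// -mulrDl subrK mul1r.
Qed.

Variables (Qs : charged -> A -> R) (C : R).
Hypothesis cost_le : forall (p : S) (b : A), `|pred_cost c p b| <= C.
Local Notation B := (C / (1 - beta)).
Hypothesis Qs_le : forall k b, `|Qs k b| <= B.

(** The value to which the minimum of the iterates should converge, extended
    by 0 to the uncharged bins. *)
Definition limit_value (p' : S) : R :=
  \sum_(k' : charged) \1_(bin rho (val k')) p' * min_over (Qs k').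

Definition bellman_error (k : charged) (b : A) (s : nat) : R :=
  visit (val k) b s *
    (pred_cost c (p s) b + beta * limit_value (p s.+1) - Qs k b).

Definition escapes (k : charged) (b : A) (s : nat) : R :=
  visit (val k) b s * uncharged lam rho (p s.+1).

Definition eventually_within (E : R) := exists T, forall t, (T <= t)%N ->
  forall k b, `|Q t (val k) b - Qs k b| <= E.

Let B_ge0 : 0 <= B.
Proof.
have /andP[b0 b1] := beta01; rewrite divr_ge0 ?subr_ge0 ?(ltW b1)//.
exact: le_trans (normr_ge0 _) (cost_le point a0).
Qed.

Let bB_ge0 : 0 <= beta * (2 * B).
Proof.
have /andP[b0 b1] := beta01.
by rewrite mulr_ge0 ?(ltW b0)// mulr_ge0 ?ler0n// B_ge0.
Qed.

(** The three terms cover the times after T, the times before T, and the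
    uncharged bins, where the iterates are controlled only by their bound B. *)
Lemma value_error (T : nat) E s p' : 0 <= E ->
  (forall t, (T <= t)%N -> forall k b, `|Q t (val k) b - Qs k b| <= E) ->
  `|min_over (Q s (rho p')) - limit_value p'| <=
    E + 2 * B * (s < T)%N%:R + 2 * B * uncharged lam rho p'.
Proof.
move=> E0 hE; have QB := Qlearn_bound cost_le.
have u0 : 0 <= uncharged lam rho p' by exact: uncharged_ge0.
case: (chargedP lam rho p') => [[k e]|e].
  rewrite /limit_value (charged_sum _ e) e (uncharged_charged e) mulr0 addr0.
  have [sT|Ts] := ltnP s T; last first.
    by rewrite mulr0 addr0; apply: (min_over_dist a0) => b; exact: hE.
  rewrite mulr1 (le_trans (ler_normB _ _))//.
  rewrite -[leLHS]add0r lerD// mulr_natl mulr2n lerD//.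
    by apply: (min_over_norm_le a0) => b; exact: QB.
  by apply: (min_over_norm_le a0) => b; exact: Qs_le.
rewrite /limit_value (uncharged_sum _ e) subr0 e mulr1.
apply: (@le_trans _ _ B); first by apply: (min_over_norm_le a0) => b; exact: QB.
have : 0 <= 2 * B * (s < T)%N%:R by rewrite mulr_ge0// mulr_ge0.
by move: B_ge0; lra.
Qed.

Lemma Qlearn_error (T t : nat) E k b : 0 <= E ->
  (forall t, (T <= t)%N -> forall k b, `|Q t (val k) b - Qs k b| <= E) ->
  (1 + visits (val k) b t) * `|Q t (val k) b - Qs k b| <=
  `|\sum_(s < t) bellman_error k b s| + B + beta * E * visits (val k) b t +
  beta * (2 * B) * T%:R + beta * (2 * B) * \sum_(s < t) escapes k b s.
Proof.
move=> E0 hE; have /andP[b0 b1] := beta01.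
set N := visits _ _ _; have N0 : 0 <= N by exact: visits_ge0.
have N1 : 0 <= 1 + N by rewrite addr_ge0.
rewrite -{1}(ger0_norm N1) -normrM mulrBr Qlearn_average.
pose err s := visit (val k) b s * (beta * (min_over (Q s (rho (p s.+1))) - limit_value (p s.+1))).
have -> : \sum_(s < t) visit (val k) b s * (pred_cost c (p s) (a s) +
      beta * min_over (Q s (rho (p s.+1)))) - (1 + N) * Qs k b =
    \sum_(s < t) bellman_error k b s - Qs k b + \sum_(s < t) err s.
  have e1 : \sum_(s < t) bellman_error k b s + \sum_(s < t) err s =
      \sum_(s < t) visit (val k) b s * (pred_cost c (p s) (a s) +
      beta * min_over (Q s (rho (p s.+1)))) - N * Qs k b.
    rewrite -big_split /N /visits mulr_suml -sumrB; apply: eq_bigr => s _ /=.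
    rewrite /err /bellman_error /visit.
    have [/eqP[_ ->]|_] := boolP ((rho (p s), a s) == (val k, b)); first by ring.
    by rewrite !mul0r !addr0 subrr.
  by rewrite addrAC e1; ring.
have errle : `|\sum_(s < t) err s| <= beta * E * N + beta * (2 * B) * T%:R +
    beta * (2 * B) * \sum_(s < t) escapes k b s.
  apply: (@le_trans _ _ (\sum_(s < t) beta * (visit (val k) b s *
      (E + 2 * B * (s < T)%N%:R + 2 * B * uncharged lam rho (p s.+1))))).
    rewrite (le_trans (ler_norm_sum _ _ _))//; apply: ler_sum => s _.
    rewrite /err mulrCA normrM gtr0_norm// ler_wpM2l ?(ltW b0)//.
    rewrite normrM ger0_norm ?visit_ge0// ler_wpM2l ?visit_ge0//.
    exact: value_error.
  have -> : \sum_(s < t) beta * (visit (val k) b s *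
      (E + 2 * B * (s < T)%N%:R + 2 * B * uncharged lam rho (p s.+1))) =
    beta * E * N + beta * (2 * B) * \sum_(s < t) visit (val k) b s * (s < T)%N%:R +
    beta * (2 * B) * \sum_(s < t) escapes k b s.
    rewrite /N /visits !mulr_sumr -!big_split/=; apply: eq_bigr => s _.
    by rewrite /escapes; ring.
  rewrite lerD2r lerD2l; apply: (ler_wpM2l bB_ge0).
  have hT u : \sum_(s < u) (s < T)%N%:R <= (T%:R : R).
    have -> : \sum_(s < u) (s < T)%N%:R = (minn u T)%:R :> R.
      elim: u => [|u IH]; first by rewrite big_ord0 min0n.
      rewrite big_ord_recr/= IH -natrD; congr (_%:R); case: ltnP; lia.
    by rewrite ler_nat geq_minr.
  apply: le_trans (hT t); apply: ler_sum => s _.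
  by rewrite ler_piMl// /visit; case: (_ == _).
rewrite (le_trans (ler_normD _ _))//.
have h1 := ler_normB (\sum_(s < t) bellman_error k b s) (Qs k b).
have h2 := Qs_le k b.
lra.
Qed.

Lemma eventually_forall (I : finType) (P : I -> nat -> Prop) :
  (forall i, exists T, forall t, (T <= t)%N -> P i t) ->
  exists T, forall t, (T <= t)%N -> forall i, P i t.
Proof.
move=> /choice[T hT]; exists (\max_i T i)%N => t Tt i; apply: hT.
by apply: leq_trans Tt; exact: leq_bigmax.
Qed.

Hypothesis visits_freq : forall (k : charged) b, exists2 phi : R, 0 < phi &
  (fun t => visits (val k) b t / t%:R) @ \oo --> phi.
Hypothesis bellman_error_avg : forall (k : charged) b,
  (fun t => (\sum_(s < t) bellman_error k b s) / t%:R) @ \oo --> (0 : R).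
Hypothesis escapes_avg : forall (k : charged) b,
  (fun t => (\sum_(s < t) escapes k b s) / t%:R) @ \oo --> (0 : R).

(** In the error bound for Q-learning all terms except
    beta * E * (number of visits) are negligible against t, while the number of
    visits grows linearly in t. *)
Lemma eventually_within_step E eta : 0 <= E -> 0 < eta ->
  eventually_within E -> eventually_within (beta * E + eta).
Proof.
move=> E0 eta0 [T hE]; have /andP[b0 b1] := beta01.
suff [T' hT'] : exists T', forall t, (T' <= t)%N -> forall kb : charged * A,
    `|Q t (val kb.1) kb.2 - Qs kb.1 kb.2| <= beta * E + eta.
  by exists T' => t Tt k b; exact: (hT' t Tt (k, b)).
apply: (eventually_forall (P := fun (kb : charged * A) t =>
  `|Q t (val kb.1) kb.2 - Qs kb.1 kb.2| <= beta * E + eta)) => -[k b] /=.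
have [phi phi0 hphi] := visits_freq k b.
have phi2 : 0 < phi / 2 by rewrite divr_gt0.
(* Three errors of at most kap * t each are divided by at least phi / 2 * t
   visits, and 3 * kap / (phi / 2) is less than eta. *)
pose kap := eta * phi / 8.
have kap0 : 0 < kap by rewrite /kap divr_gt0// mulr_gt0.
(* The 1 keeps the divisor positive when B is 0. *)
pose D := beta * (2 * B) + 1.
have D1 : 1 <= D by rewrite /D lerDr.
have D0 : 0 < D by exact: lt_le_trans D1.
have [N1 hN1] := (cvgnP _ _).1 hphi _ phi2.
have [N2 hN2] := (cvgn0P _).1 (bellman_error_avg k b) _ kap0.
have [N3 hN3] := (cvgn0P _).1 (escapes_avg k b) _ (divr_gt0 kap0 D0).
have [N4 hN4] := exists_nat_gt ((B + beta * (2 * B) * T%:R) / kap).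
exists (maxn 1 (maxn (maxn N1 N2) (maxn N3 N4))) => t.
rewrite !geq_max => /and3P[t0 /andP[t1 t2] /andP[t3 t4]].
have tR : 0 < (t%:R : R) by rewrite ltr0n.
have N0 : 0 <= visits (val k) b t by exact: visits_ge0.
have h1 : phi / 2 * t%:R <= visits (val k) b t.
  have := hN1 t t1; rewrite ler_norml => /andP[h _].
  by rewrite -ler_pdivlMr//; lra.
have h2 : `|\sum_(s < t) bellman_error k b s| <= kap * t%:R.
  by have := hN2 t t2; rewrite normrM normfV (gtr0_norm tR) ler_pdivrMr.
have h3 : beta * (2 * B) * \sum_(s < t) escapes k b s <= kap * t%:R.
  have := hN3 t t3; rewrite normrM normfV (gtr0_norm tR) ler_pdivrMr// => h.
  have h' : \sum_(s < t) escapes k b s <= kap / D * t%:R by exact: le_trans (ler_norm _) h.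
  have e0 : 0 <= \sum_(s < t) escapes k b s.
    by apply: sumr_ge0 => s _; rewrite mulr_ge0 ?visit_ge0 ?uncharged_ge0.
  apply: (@le_trans _ _ (D * \sum_(s < t) escapes k b s)).
    by rewrite ler_wpM2r// /D lerDl.
  rewrite (_ : kap * t%:R = D * (kap / D * t%:R)); first by rewrite ler_wpM2l ?(ltW D0).
  by rewrite mulrA mulrCA mulfV ?mulr1// gt_eqF.
have h4 : B + beta * (2 * B) * T%:R <= kap * t%:R.
  rewrite [leRHS]mulrC -ler_pdivrMr// (le_trans (ltW hN4))//.
  by rewrite ler_nat.
have h5 := Qlearn_error t k b E0 hE.
set N := visits _ _ _ in N0 h1 h5; set q := `|_ - _| in h5 *.
have N1p : 0 < 1 + N by rewrite ltr_pwDl.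
rewrite -(ler_pM2l N1p); apply: (le_trans h5).
have h6 : kap * t%:R * 4 <= eta * N.
  rewrite (_ : _ * 4 = eta * (phi / 2 * t%:R)); last by rewrite /kap; field.
  by rewrite ler_wpM2l// ltW.
have h7 : 0 <= beta * E by rewrite mulr_ge0// ltW.
have h8 : 0 <= kap * t%:R by rewrite mulr_ge0// ltW.
have -> : (1 + N) * (beta * E + eta) = beta * E + beta * E * N + eta + eta * N by ring.
lra.
Qed.

(** The bounds beta ^+ j * (2 * B) + e / 2 hold eventually for each j. *)
Theorem Qlearn_cvg k b : (fun t => Q t (val k) b) @ \oo --> Qs k b.
Proof.
have /andP[b0 b1] := beta01; have b1' : 0 < 1 - beta by rewrite subr_gt0.
apply/cvgnP => e e0.
(* The map E |-> beta * E + eta has fixed point e / 2. *)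
pose eta := e * (1 - beta) / 2.
have eta0 : 0 < eta by rewrite /eta divr_gt0// mulr_gt0.
have within j : eventually_within (beta ^+ j * (2 * B) + e / 2).
  elim: j => [|j IH].
    exists 0%N => t _ k' b'; rewrite expr0 mul1r (le_trans (ler_normB _ _))//.
    have h1 := Qlearn_bound cost_le t (val k') b'; have h2 := Qs_le k' b'; lra.
  have -> : beta ^+ j.+1 * (2 * B) + e / 2 =
      beta * (beta ^+ j * (2 * B) + e / 2) + eta.
    by rewrite /eta exprS; field; rewrite gt_eqF.
  apply: eventually_within_step => //.
  rewrite addr_ge0 ?(divr_ge0 (ltW e0))// mulr_ge0 ?exprn_ge0 ?(ltW b0)//.
  by rewrite mulr_ge0 ?ler0n// B_ge0.
have c0 : (fun j => beta ^+ j * (2 * B)) @ \oo --> (0 : R).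
  rewrite -[X in _ --> X](mul0r (2 * B)); apply: cvgMl; apply: cvg_expr.
  by rewrite gtr0_norm.
have e2 : 0 < e / 2 by rewrite divr_gt0.
have [j hj] := (cvgn0P _).1 c0 _ e2.
have [T hT] := within j.
exists T => t Tt; apply: (le_trans (hT t Tt k b)).
have := le_trans (ler_norm _) (hj j (leqnn j)); lra.
Qed.

End QLearning.

(** * Almost sure convergence of Q-learning *)

Section AlmostSureConvergence.
Context {R : realType} {X U M : finPointedType}.
Variables (K : X -> U -> pdist R X) (c : X -> U -> R) (beta : R).
Hypothesis beta01 : 0 < beta < 1.
Hypothesis singleton_cell : exists (Q : quantizer X M) (x : X) (q : M),
  [set y | Q y = q] = [set x].
Hypothesis irreducible : forall f : X -> U,
  irreducible_chain (fun x y => K x (f x) y).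
Local Notation S := (pdist R X).
Local Notation A := (act X U M).
Local Notation pm := (predictor_mdp M K c).
Variable lam : probability S R.
Hypothesis lam_inv : exploration_invariant M K c lam.
Variables (n : nat) (rho : S -> grid X n).
Hypothesis rho_measurable : forall k, measurable (rho @^-1` [set k]).
Local Notation charged := (charged_grid lam rho).
Local Notation qm := (quantized_mdp M K c lam rho).

Let a0 : A := ([ffun=> point], [ffun=> point]).

Definition visit_fun (k : charged) (b : A) (H : S -> S -> R) (p : S) (a : A) (p' : S) : R :=
  ((rho p, a) == (val k, b))%:R * H p p'.

Lemma expl_mean_visit k b H p : expl_mean K (visit_fun k b H) p =
  (#|{: A}|%:R)^-1 * (\1_(bin rho (val k)) p * step_mean K (H p) p b).
Proof.
rewrite /expl_mean; congr (_ * _); rewrite (bigD1 b)//= big1 ?addr0 => [|a ab].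
  rewrite /step_mean mulr_sumr; apply: eq_bigr => q _.
  rewrite /visit_fun xpair_eqE eqxx andbT mulrCA; congr (_ * _).
  rewrite indicE; congr (nat_of_bool _)%:R.
  by apply/eqP/idP => [e|]; [rewrite mem_set|rewrite inE].
apply: big1 => q _.
by rewrite /visit_fun xpair_eqE (negbTE ab) andbF mul0r mulr0.
Qed.

(** Averages over the visits to a charged pair see the restriction of lam to
    the bin, weighted by the probability of the action under exploration. *)
Lemma expect_visit k b H :
  bounded_measurable (fun p => step_mean K (H p) p b) ->
  bounded_measurable (expl_mean K (visit_fun k b H)) /\
  \int[lam]_p expl_mean K (visit_fun k b H) p =
  (#|{: A}|%:R)^-1 * fine (lam (bin rho (val k))) *
  bin_mean k (fun p => step_mean K (H p) p b).
Proof.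
move=> bH.
have mb := measurable_bin rho_measurable (val k).
have bI : bounded_measurable
    (fun p => \1_(bin rho (val k)) p * step_mean K (H p) p b).
  by apply: bmfM => //; exact: bmf_indic.
have E := funext (expl_mean_visit k b H).
rewrite E; split; first exact: bmfZ.
rewrite (expectZ lam _ bI) -mulrA; congr (_ * _).
rewrite /bin_mean mulrC divfK; last first.
  by rewrite gt_eqF//; exact: (bin_mass_gt0 rho_measurable).
rewrite [RHS]Rintegral_mkcond; apply: eq_Rintegral => p _.
by rewrite patchE indicE; case: ifP => _; rewrite ?mul1r ?mul0r.
Qed.

Variables (pi0 : S) (d : measure_display) (Omega : measurableType d).
Variables (P : probability Omega R) (x : nat -> Omega -> X) (a : nat -> Omega -> A).
Hypothesis run : exploration_run K pi0 P x a.

Let pth (om : Omega) : nat -> S := belief K pi0 (x ^~ om) (a ^~ om).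

Lemma visit_average (k : charged) (b : A) (H : S -> S -> R) C0 : (forall p p', `|H p p'| <= C0) ->
  bounded_measurable (fun p => step_mean K (H p) p b) ->
  {ae P, forall om,
    (fun t => (\sum_(s < t) visit rho (pth om) (a ^~ om) (val k) b s *
       H (pth om s) (pth om s.+1)) / t%:R) @ \oo -->
    (#|{: A}|%:R)^-1 * fine (lam (bin rho (val k))) *
    bin_mean k (fun p => step_mean K (H p) p b)}.
Proof.
move=> HC bH; have [bG EG] := expect_visit k bH.
have GB p b' p' : `|visit_fun k b H p b' p'| <= C0.
  rewrite normrM (le_trans _ (HC p p'))// ler_piMl//.
  by rewrite ger0_norm//; case: (_ == _).
have lawW := exploration_law (c := c) run.
have := ergodic_theorem lam_inv singleton_cell irreducible lawW GB bG.
apply: filterS => om; rewrite EG => h; apply: cvg_trans h.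
apply: near_eq_cvg; apply: nearW => t; congr (_ / _).
apply: eq_bigr => s _; rewrite /visit_fun /visit /pth.
by rewrite -!(belief_state_at K c).
Qed.

(** The ergodic theorem is applied to visits, to Bellman errors, whose mean
    is 0 by the optimality equation of the quantized model, and to escapes,
    whose mean is 0 by invariance of lam. *)
Theorem Qlearn_almost_sure (Qs : charged -> A -> R) :
  (forall k b, `|Qs k b| <= cost_bound c / (1 - beta)) ->
  (forall k b, Qs k b = action_value (m := qm) beta (fun k' => min_over (Qs k')) k b) ->
  {ae P, forall om, forall k b,
    (fun t => Qlearn c beta rho (pth om) (a ^~ om) t (val k) b) @ \oo --> Qs k b}.
Proof.
move=> Qs_le Qs_fix.
pose n0 := (#|{: A}|%:R)^-1 : R.
have n0_gt0 : 0 < n0 by rewrite invr_gt0; exact: card_act_gt0.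
have freq (kb : charged * A) : {ae P, forall om, exists2 phi : R, 0 < phi &
    (fun t => visits rho (pth om) (a ^~ om) (val kb.1) kb.2 t / t%:R) @ \oo --> phi}.
  have sm : (fun p : S => step_mean K (fun=> 1) p kb.2) = fun=> (1 : R).
    by apply/funext => p; exact: step_mean_cst.
  have le1 (p p' : S) : `|1 : R| <= 1 by rewrite normr1.
  have b1 : bounded_measurable (fun p : S => step_mean K (fun=> 1) p kb.2).
    by rewrite sm; exact: bmf_cst.
  have := visit_average kb.1 le1 b1; rewrite sm; apply: filterS.
  move=> om h; exists (n0 * fine (lam (bin rho (val kb.1)))).
    by rewrite mulr_gt0//; exact: (bin_mass_gt0 rho_measurable).
  move: h; rewrite (bin_mean_cst rho_measurable) mulr1; apply: cvg_trans.
  apply: near_eq_cvg; apply: nearW => t; congr (_ / _).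
  by apply: eq_bigr => s _; rewrite mulr1.
have Lb : bounded_measurable (limit_value Qs).
  apply: bmf_sum => k'; apply: bmfM; last exact: bmf_cst.
  by apply: bmf_indic; exact: measurable_bin.
have [_ [BL hBL]] := Lb.
have err (kb : charged * A) : {ae P, forall om,
    (fun t => (\sum_(s < t) bellman_error c beta (pth om) (a ^~ om) Qs kb.1 kb.2 s)
      / t%:R) @ \oo --> (0 : R)}.
  case: kb => k b /=.
  pose H (p p' : S) : R := pred_cost c p b + beta * limit_value Qs p' - Qs k b.
  have sm : (fun p : S => step_mean K (H p) p b) =
      (fun p => pred_cost c p b - Qs k b + beta * step_mean K (limit_value Qs) p b).
    apply/funext => p; rewrite -(step_mean_cst K (pred_cost c p b - Qs k b) p b).
    rewrite /step_mean mulr_sumr -big_split/=; apply: eq_bigr => q _.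
    by rewrite /H; ring.
  have bsm := bmf_step_mean K b Lb.
  have b1 : bounded_measurable (fun p : S => pred_cost c p b - Qs k b).
    by apply: bmfB; [exact: bmf_pred_cost|exact: bmf_cst].
  have bH : bounded_measurable (fun p : S => step_mean K (H p) p b).
    by rewrite sm; apply: bmfD => //; exact: bmfZ.
  have HC (p p' : S) : `|H p p'| <= cost_bound c + `|beta| * BL + `|Qs k b|.
    rewrite (le_trans (ler_normB _ _))// lerD//.
    rewrite (le_trans (ler_normD _ _))// lerD//; first exact: pred_cost_le.
    by rewrite normrM ler_wpM2l.
  apply: filterS (visit_average k HC bH).
  move=> om; rewrite sm.
  rewrite (bin_meanD rho_measurable)//; last exact: bmfZ.
  rewrite (bin_meanD rho_measurable); [|exact: bmf_pred_cost|exact: bmf_cst].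
  rewrite (bin_mean_cst rho_measurable) (bin_meanZ rho_measurable)//.
  rewrite [X in _ * X](_ : _ = 0) ?mulr0//.
  rewrite [in X in - X]Qs_fix /action_value /= (quantized_sum K c rho_measurable).
  rewrite -/(limit_value Qs) /bin_cost -/(bin_mean k _); ring.
have esc (kb : charged * A) : {ae P, forall om,
    (fun t => (\sum_(s < t) escapes (pth om) (a ^~ om) kb.1 kb.2 s)
      / t%:R) @ \oo --> (0 : R)}.
  case: kb => k b /=.
  have UC (p p' : S) : `|uncharged lam rho p'| <= 1.
    by rewrite ger0_norm ?uncharged_ge0// /uncharged; case: (~~ _).
  apply: filterS (visit_average k UC (bmf_escape K lam rho_measurable b)).
  move=> om; rewrite -/(escape K lam rho b) (bin_mean_escape lam_inv rho_measurable).
  by rewrite mulr0.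
have ae_P := ae_filter_ringOfSetsType P.
move: (filter_forall ae_P freq) (filter_forall ae_P err) (filter_forall ae_P esc).
apply: filterS3 => om hf he hs k b.
apply: (Qlearn_cvg beta01 (pred_cost_le c) Qs_le).
- by move=> k' b'; exact: (hf (k', b')).
- by move=> k' b'; exact: (he (k', b')).
- by move=> k' b'; exact: (hs (k', b')).
Qed.

End AlmostSureConvergence.

(** * Near optimality of the learned policies *)

Theorem mainTheorem6 (R : realType) (X U M : finPointedType)
    (K : X -> U -> pdist R X) (c : X -> U -> R) (beta : R)
    (beta01 : 0 < beta < 1)
    (singleton_cell : exists (Q : quantizer X M) (x : X) (q : M),
       [set y | Q y = q] = [set x])
    (ergodic : forall f : X -> U,
       irreducible_chain (fun x y => K x (f x) y) /\
       aperiodic_chain (fun x y => K x (f x) y))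
    (lam : probability (pdist R X) R)
    (lam_inv : exploration_invariant M K c lam)
    (d : pdist R X -> pdist R X -> R) (d_metric : weak_metric d)
    (rho : forall n, pdist R X -> grid X n)
    (rho_nn : forall n, nearest_neighbour (rho n) d) :
  exists Qstar : forall n, charged_grid lam (rho n) -> act X U M -> R,
    [/\
      forall (n : nat) (pi0 : pdist R X)
          (disp : measure_display) (Omega : measurableType disp)
          (P : probability Omega R)
          (x : nat -> Omega -> X) (a : nat -> Omega -> act X U M),
        exploration_run K pi0 P x a ->
        forall (k : charged_grid lam (rho n)) (b : act X U M),
          {ae P, forall om,
            (fun t => Qlearn c beta (rho n)
                        (belief K pi0 (x ^~ om) (a ^~ om)) (a ^~ om)
                        t (val k) b) @ \oo --> Qstar n k b},
      forall (n : nat) (k : charged_grid lam (rho n)) (b : act X U M),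
        Qstar n k b =
        bin_cost c k b +
        beta * \sum_(k' : charged_grid lam (rho n))
                 bin_kernel K c k b k' * min_over (Qstar n k'),
      forall n : nat,
        dcoe (m := quantized_mdp M K c lam (rho n)) beta
          (fun k => min_over (Qstar n k)) &
      forall ghat : forall n, charged_grid lam (rho n) -> act X U M,
        (forall n k b, Qstar n k (ghat n k) <= Qstar n k b) ->
        (forall n : nat,
           optimal_policy (m := quantized_mdp M K c lam (rho n)) beta
             (stationary (m := quantized_mdp M K c lam (rho n)) (ghat n))) /\
        (forall gtilde : nat -> pdist R X -> act X U M,
           (forall n (p : pdist R X) (k : charged_grid lam (rho n)),
              rho n p = val k -> gtilde n p = ghat n k) ->
           forall pi0 : pdist R X, (0 < lam [set pi0])%E ->
             (fun n =>
                `|discounted_cost (m := predictor_mdp M K c) beta pi0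
                    (stationary (m := predictor_mdp M K c) (gtilde n)) -
                  optimal_cost (m := predictor_mdp M K c) beta pi0|)
             @ \oo --> (0 : R))].
Proof.
have /andP[b0 b1] := beta01; have b1' : 0 < 1 - beta by rewrite subr_gt0.
have irr f := (ergodic f).1.
have rho_m n : forall k, measurable (rho n @^-1` [set k]) := (rho_nn n).2.
have a0 : act X U M := ([ffun=> point], [ffun=> point]).
pose C := cost_bound c; pose B := C / (1 - beta).
have B0 : 0 <= B by rewrite divr_ge0 ?cost_bound_ge0// ltW.
have BE : C + beta * B = B by rewrite /B; field; rewrite gt_eqF.
pose qm n := quantized_mdp M K c lam (rho n).
pose pm := predictor_mdp M K c.
have qw0 n := @quantized_weight_ge0 R X U M K c lam n (rho n).
have qw1 n := quantized_weight_sum1 lam_inv (rho_m n).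
have qc n := quantized_cost_le lam_inv (rho_m n).
pose VnP n := cid2 (bellman_fixed_point beta01 (qw0 n) (qw1 n) (qc n) (a0 : action (qm n))).
pose Vn n : state (qm n) -> R := s2val (VnP n).
have Vn_fix n : forall k, Vn n k = min_over (action_value (m := qm n) beta (Vn n) k).
  exact: s2valP (VnP n).
have Vn_le n k : `|Vn n k| <= B.
  by have := s2valP' (VnP n) 0%N k; rewrite /= subr0 expr0 mul1r.
pose Qstar n k b := action_value (m := qm n) beta (Vn n) k b.
have Vn_min n : (fun k => min_over (Qstar n k)) = Vn n.
  by apply/funext => k; rewrite (Vn_fix n k).
have Qs_le n k b : `|Qstar n k b| <= B.
  rewrite -BE /Qstar /action_value (le_trans (ler_normD _ _))// lerD ?qc//.
  rewrite normrM gtr0_norm// ler_wpM2l ?(ltW b0)// (le_trans (ler_norm_sum _ _ _))//.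
  rewrite -[leRHS]mul1r -(qw1 n k b) mulr_suml; apply: ler_sum => z _.
  by rewrite normrM ger0_norm ?qw0// ler_wpM2l ?qw0.
exists Qstar; split.
- move=> n pi0 disp Omega P x a run k b.
  have Qs_fix k' b' : Qstar n k' b' =
      action_value (m := qm n) beta (fun k0 => min_over (Qstar n k0)) k' b'.
    by rewrite Vn_min.
  apply: filterS (Qlearn_almost_sure beta01 singleton_cell irr lam_inv (rho_m n) run
    (Qs_le n) Qs_fix) => om h; exact: h.
- move=> n k b; rewrite /Qstar {1}/action_value /=; congr (_ + beta * _).
  by apply: eq_bigr => k' _; rewrite -(congr1 (fun f => f k') (Vn_min n)).
- by move=> n; rewrite (Vn_min n); exact: Vn_fix.
move=> ghat greedy; split.
  move=> n; split; first exact: admissible_stationary.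
  move=> k.
  have Vn_low k' b : Vn n k' <= action_value (m := qm n) beta (Vn n) k' b.
    by rewrite [leLHS](Vn_fix n k'); exact: min_over_le.
  have Vn_greedy k' : action_value (m := qm n) beta (Vn n) k' (ghat n k') <= Vn n k'.
    rewrite [leRHS](Vn_fix n k').
    have [b -> _] := min_over_attained (a0 : action (qm n))
      (action_value (m := qm n) beta (Vn n) k').
    exact: greedy.
  by have [-> ->] := optimal_cost_eq beta01 (qw0 n) (qw1 n) (qc n) k (Vn_le n)
    Vn_low Vn_greedy.
move=> gtilde gtildeE pi0 pi0_atom.
have pw0 := @predictor_weight_ge0 R X U M K c.
have pw1 := @predictor_weight_sum1 R X U M K c.
have pc := @pred_cost_le R X U M c.
have [V V_fix V_iter] := @bellman_fixed_point R pm beta C beta01 pw0 pw1 pc a0.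
have V_le p : `|V p| <= B by have := V_iter 0%N p; rewrite /= subr0 expr0 mul1r.
have V_lip : cone_lipschitz B V by exact: (optimal_value_lipschitz beta01 V_iter).
have V_low q b : V q <= action_value (m := pm) beta V q b.
  by rewrite [leLHS](V_fix q); exact: min_over_le.
have V_opt p : optimal_cost (m := pm) beta p = V p.
  have fex q : exists b, action_value (m := pm) beta V q b <= V q.
    have [b e _] := min_over_attained (a0 : action pm) (action_value (m := pm) beta V q).
    by exists b; rewrite [leRHS](V_fix q) e.
  have [f hf] := choice fex.
  by have [-> _] := optimal_cost_eq beta01 pw0 pw1 pc p V_le V_low hf.
apply/cvgn0P => e e0.
(* The greedy policy loses at most 2 * B * delta / (1 - beta) ^+ 2; B + 1 is
   positive even when all costs are 0. *)
pose delta := e * (1 - beta) ^+ 2 / (2 * (B + 1)).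
have B1 : 0 < B + 1 by rewrite ltr_wpDl.
have delta0 : 0 < delta by rewrite divr_gt0 ?mulr_gt0 ?exprn_gt0.
have [N hN] := bin_diameter_cvg0 d_metric rho_nn delta0.
exists N => n Nn.
rewrite normr_id V_opt.
have lower : V pi0 <= discounted_cost (m := pm) beta pi0 (stationary (m := pm) (gtilde n)).
  apply: (discounted_cost_ge beta01 pw0 pw1 pc pi0 V_le V_low).
  exact: admissible_stationary.
have upper : discounted_cost (m := pm) beta pi0 (stationary (m := pm) (gtilde n)) <=
    V pi0 + 2 * (B * delta / (1 - beta)) / (1 - beta).
  apply: (@stationary_cost_upper R pm beta C beta01 pw0 pw1 pc V B _
    [set p | (0 < lam [set p])%E] pi0 (gtilde n) V_le) => //.
  - by rewrite mulr_ge0// divr_ge0 ?(ltW b1')// mulr_ge0// ltW.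
  - by move=> p b q; exact: (atom_closed lam_inv).
  move=> p p_atom; have [k pk] := atom_charged (rho_m n) p_atom.
  rewrite (gtildeE n p k pk).
  exact: (quantized_greedy beta01 lam_inv (rho_m n) V_fix V_lip V_le BE (Vn_fix n)
    (Vn_le n) (hN n Nn) pk (greedy n)).
rewrite ger0_norm ?subr_ge0// lerBlDl (le_trans upper)// lerD2l.
have -> : 2 * (B * delta / (1 - beta)) / (1 - beta) = e * (B / (B + 1)).
  by rewrite /delta; field; rewrite !gt_eqF.
by rewrite ler_piMr ?(ltW e0)// ler_pdivrMr// mul1r lerDl.
Qed.
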